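(* Let $A\in\{\mathbb{C},\mathbb{H},\mathbb{O}\}$ and let $\Omega\subseteq A$ be a circular open set. The set $\mathcal{SEM}(\Omega)$ of semiregular functions on $\Omega$ is an alternative $*$-algebra with respect to $+,\cdot,{}^c$ (addition, slice multiplication, slice conjugation). - If $\Omega$ is a slice domain, $\mathcal{SEM}(\Omega)$ is a division algebra. - If $\Omega$ is a product domain, then $\mathcal{SEM}(\Omega)$ is a singular algebra, that is, it includes some element $f\not\equiv0$ with $N(f)\equiv0$. However, every element $f$ with $N(f)\not\equiv0$ admits a multiplicative inverse within the algebra.
   Context: $A$ is one of the real $*$-algebras $\mathbb{C},\mathbb{H},\mathbb{O}$ (complex numbers, quaternions, octonions) with standard conjugation $x\mapsto x^c$, Euclidean norm $|\cdot|$ and topology; $t(x)=x+x^c$, $n(x)=xx^c$, $\operatorname{Re}(x)=t(x)/2$, $\operatorname{Im}(x)=x-\operatorname{Re}(x)$; $\mathbb{S}=\{w\in A: w^2=-1\}$, $\mathbb{C}_J=\mathbb{R}+\mathbb{R}J$. For $x=\alpha+\beta J$ with $\alpha,\beta\in\mathbb{R}$, $J\in\mathbb{S}$, $\mathbb{S}_x=\{\alpha+\beta I: I\in\mathbb{S}\}$. For nonempty $D\subseteq\mathbb{C}$ invariant under complex conjugation, $\Omega_D=\{\alpha+\beta J:\alpha,\beta\in\mathbb{R},\,J\in\mathbb{S},\,\alpha+i\beta\in D\}$; sets of this form are called circular. If $D$ is open, connected and intersects $\mathbb{R}$, $\Omega_D$ is a slice domain; if $D$ is open, does not intersect $\mathbb{R}$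 and has two connected components switched by complex conjugation, $\Omega_D$ is a product domain. For $D$ open and $\Omega=\Omega_D$, $\mathcal{SR}(\Omega)$ is the set of slice regular functions: functions $f:\Omega\to A$ for which there are $C^1$ functions $F_1,F_2:D\to A$ with $F_1(\bar z)=F_1(z)$, $F_2(\bar z)=-F_2(z)$, $f(\alpha+\beta J)=F_1(\alpha+i\beta)+JF_2(\alpha+i\beta)$ for all $\alpha+i\beta\in D$, $J\in\mathbb{S}$, and $\partial F_1/\partial\alpha=\partial F_2/\partial\beta$, $\partial F_1/\partial\beta=-\partial F_2/\partial\alpha$. The slice product $f\cdot g$ corresponds to $(F_1G_1-F_2G_2,\;F_1G_2+F_2G_1)$, the slice conjugate $f^c$ to $(F_1^c,F_2^c)$, and $N(f)=f\cdot f^c$. Let $\Delta_y(x)=x^2-xt(y)+n(y)$. For $n\in\mathbb{Z}$, $(x-y)^{\bullet n}$ is the $n$-th power of $x\mapsto x-y$ with respect to the slice product, where $(x-y)^{-\bullet}=\Delta_y(x)^{-1}(x-y^c)$ on $A\setminus\mathbb{S}_y$; $(x-y)^{\bullet n}\cdot a$ is the slice product with the constant $a$. If $x,y$ lie in a common $\mathbb{C}_J$, set $\sigma(x,y)=\tau(x,y)=|x-y|$; otherwise $\sigma(x,y)=\sqrt{(\operatorname{Re}x-\operatorname{Re}y)^2+(|\operatorname{Im}x|+|\operatorname{Im}y|)^2}$ and $\tau(x,y)=\sqrt{(\operatorname{Re}x-\operatorname{Re}y)^2+(|\operatorname{Im}x|-|\operatorname{Im}y|)^2}$. Let $\Sigma(y,0,R)=\{x\in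 A:\tau(x,y)>0,\ \sigma(x,y)<R\}$. A point $y$ is a singularity for $f\in\mathcal{SR}(\Omega)$ if $\Sigma(y,0,R)\subseteq\Omega$ for some $R>0$; then there is a unique sequence $\{a_n\}_{n\in\mathbb{Z}}$ in $A$ with $f(x)=\sum_{n\in\mathbb{Z}}(x-y)^{\bullet n}\cdot a_n$ in $\Sigma(y,0,R)$. It is a pole for $f$ if there is $m\ge0$ with $a_n=0$ for all $n<-m$. It is a removable singularity if $f$ extends to a slice regular function on a circular open set containing $y$. A function $f$ is semiregular in a nonempty circular open set $\widetilde\Omega$ if there exists a circular open subset $\Omega_0\subseteq\widetilde\Omega$ such that $f\in\mathcal{SR}(\Omega_0)$ and every point of $\widetilde\Omega\setminus\Omega_0$ is a pole (or a removable singularity) for $f$. Semiregular functions agreeing on their common domain of regularity are identified; sums, slice products and conjugates are computed on common domains of regularity. An algebra is alternative if the associator $(x,y,z)=(xy)z-x(yz)$ vanishes whenever two arguments coincide; a $*$-algebra is a real algebra with a linear involution satisfying $(x^c)^c=x$, $(xy)^c=y^cx^c$ and $r^c=r$ for $r\in\mathbb{R}$. Division algebra means that every nonzero element has a multiplicative inverse. *)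

(* Defs.v *)
From HB Require Import structures.
From mathcomp Require Import all_boot all_order all_algebra.
From mathcomp Require Import all_classical all_reals all_analysis.
Set Implicit Arguments.
Unset Strict Implicit.
Unset Printing Implicit Defensive.
Import Order.TTheory GRing.Theory Num.Theory.
Import numFieldNormedType.Exports.
Local Open Scope classical_set_scope.
Local Open Scope ring_scope.

(* The Cayley-Dickson tower over R: CD R 1, CD R 2 and CD R 3 are the complex
   numbers, the quaternions and the octonions. The library norm on CD R k is a
   maximum norm; it induces the Euclidean topology. The Euclidean norm itself
   is enorm below. *)
Fixpoint CD (R : realType) (k : nat) : normedModType R :=
  if k is k'.+1 then (CD R k' * CD R k')%type else R^o.

Fixpoint cd_one (R : realType) (k : nat) : CD R k :=
  match k with
  | 0 => (1 : R)
  | k'.+1 => (cd_one R k', 0)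
  end.

Fixpoint cd_conj (R : realType) (k : nat) : CD R k -> CD R k :=
  match k with
  | 0 => fun x => x
  | k'.+1 => fun x => (cd_conj x.1, - x.2)
  end.

Fixpoint cd_mul (R : realType) (k : nat) : CD R k -> CD R k -> CD R k :=
  match k with
  | 0 => fun x y => (x : R) * (y : R)
  | k'.+1 => fun x y =>
      (cd_mul x.1 y.1 - cd_mul (cd_conj y.2) x.2,
       cd_mul y.2 x.1 + cd_mul x.2 (cd_conj y.1))
  end.

(* the coordinate along cd_one *)
Fixpoint cd_coord1 (R : realType) (k : nat) : CD R k -> R :=
  match k with
  | 0 => fun x => x
  | k'.+1 => fun x => cd_coord1 x.1
  end.

Fixpoint cd_sumsq (R : realType) (k : nat) : CD R k -> R :=
  match k with
  | 0 => fun x => (x : R) ^+ 2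
  | k'.+1 => fun x => cd_sumsq x.1 + cd_sumsq x.2
  end.

Definition enorm (R : realType) (k : nat) (x : CD R k) : R :=
  Num.sqrt (cd_sumsq x).

Section SliceFunctions.
Context {R : realType} {k : nat}.
Local Notation A := (CD R k).
Local Notation "x ** y" := (cd_mul x y) (at level 40, left associativity).

Definition cd_real (r : R) : A := r *: cd_one R k.

Definition cd_trace (x : A) : A := x + cd_conj x.
Definition cd_n (x : A) : A := x ** cd_conj x.

(* cd_trace x lies in R 1, and is read as a real number *)
Definition cd_re (x : A) : R := cd_coord1 (cd_trace x) / 2.
Definition cd_im (x : A) : A := x - cd_real (cd_re x).

(* the inverse in C, H, O, with inverse of 0 equal to 0 *)
Definition cd_inv (x : A) : A := (cd_sumsq x)^-1 *: cd_conj x.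

Definition imag_unit : set A := [set w | w ** w = - cd_one R k].

(* the point a + b J *)
Definition slice_pt (a b : R) (J : A) : A := cd_real a + b *: J.

Definition common_slice (x y : A) : Prop :=
  exists2 J, imag_unit J &
    (exists a b, x = slice_pt a b J) /\ (exists a b, y = slice_pt a b J).

Definition sphere_of (x : A) : set A :=
  [set w | exists a b J I, [/\ imag_unit J, imag_unit I,
                               x = slice_pt a b J & w = slice_pt a b I]].

(* Subsets D of the complex plane are subsets of R * R, with (a, b) standing
   for a + i b. *)
Definition plane_conj (z : R * R) : R * R := (z.1, - z.2).

Definition conj_invariant (D : set (R * R)) : Prop :=
  D !=set0 /\ (forall z, D z -> D (plane_conj z)).

Definition circularization (D : set (R * R)) : set A :=
  [set x | exists a b J, [/\ imag_unit J, D (a, b) & x = slice_pt a b J]].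

Definition circular (Om : set A) : Prop :=
  exists2 D, conj_invariant D & Om = circularization D.

Definition slice_domain (Om : set A) : Prop :=
  exists D : set (R * R),
    [/\ conj_invariant D, open D, connected D, (exists a, D (a, 0))
      & Om = circularization D].

Definition product_domain (Om : set A) : Prop :=
  exists D : set (R * R),
    [/\ conj_invariant D, open D, (forall a, ~ D (a, 0)),
        (exists C1 C2 : set (R * R),
          [/\ C1 <> C2,
              [set connected_component D z | z in D] = [set C1; C2]
            & plane_conj @` C1 = C2])
      & Om = circularization D].

Definition C1_on (D : set (R * R)) (F : R * R -> A) : Prop :=
  forall z, D z ->
    [/\ derivable F z (1, 0), derivable F z (0, 1),
        {for z, continuous ('D_(1, 0) F)} & {for z, continuous ('D_(0, 1) F)}].

(* F = (F_1, F_2) is a stem function inducing f on Om and witnessing that f is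
   slice regular there; only the values of f on Om and those of F on D
   matter. *)
Definition regular_stem (Om : set A) (f : A -> A)
    (F : (R * R -> A) * (R * R -> A)) : Prop :=
  exists D : set (R * R),
    [/\ conj_invariant D, open D & Om = circularization D] /\
    [/\ C1_on D F.1, C1_on D F.2,
        (forall z, D z -> F.1 (plane_conj z) = F.1 z
                       /\ F.2 (plane_conj z) = - F.2 z),
        (forall a b J, D (a, b) -> imag_unit J ->
           f (slice_pt a b J) = F.1 (a, b) + J ** F.2 (a, b))
      & (forall z, D z -> 'D_(1, 0) F.1 z = 'D_(0, 1) F.2 z
                       /\ 'D_(0, 1) F.1 z = - 'D_(1, 0) F.2 z)].

Definition slice_regular (Om : set A) (f : A -> A) : Prop :=
  exists F, regular_stem Om f F.

(* A function with domain [dom] is a total function whose values outside [dom]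
   are irrelevant. *)
Record pfun := PFun { dom : set A; fn : A -> A }.

(* Stem functions are unique on the plane set underlying dom f. *)
Definition stem (f : pfun) : (R * R -> A) * (R * R -> A) :=
  xget (fun=> 0, fun=> 0) [set F | regular_stem (dom f) (fn f) F].

(* The function a + b J |-> F_1(a,b) + J F_2(a,b), computed from the
   decomposition x = Re x + |Im x| (Im x / |Im x|). At real x, Im x = 0 and the
   second term vanishes, as does F_2 there by oddness. *)
Definition induced (F : (R * R -> A) * (R * R -> A)) (x : A) : A :=
  let a := cd_re x in
  let b := enorm (cd_im x) in
  F.1 (a, b) + (b^-1 *: cd_im x) ** F.2 (a, b).

Definition stem_mul (F G : (R * R -> A) * (R * R -> A)) :=
  (fun z => F.1 z ** G.1 z - F.2 z ** G.2 z,
   fun z => F.1 z ** G.2 z + F.2 z ** G.1 z).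

Definition stem_conj (F : (R * R -> A) * (R * R -> A)) :=
  (fun z => cd_conj (F.1 z), fun z => cd_conj (F.2 z)).

Definition padd (f g : pfun) : pfun :=
  PFun (dom f `&` dom g) (fun x => fn f x + fn g x).
Definition pscale (r : R) (f : pfun) : pfun :=
  PFun (dom f) (fun x => r *: fn f x).
Definition pmul (f g : pfun) : pfun :=
  PFun (dom f `&` dom g) (induced (stem_mul (stem f) (stem g))).
Definition pconj (f : pfun) : pfun :=
  PFun (dom f) (induced (stem_conj (stem f))).
Definition pcst (Om : set A) (a : A) : pfun := PFun Om (fun=> a).
Definition pnorm (f : pfun) : pfun := pmul f (pconj f).

(* equality on the common domain of regularity *)
Definition agree (f g : pfun) : Prop :=
  forall x, dom f x -> dom g x -> fn f x = fn g x.

Definition Delta (y x : A) : A := x ** x - x ** cd_trace y + cd_n y.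

Definition ppow (f : pfun) (n : nat) : pfun :=
  iter n (pmul f) (pcst (dom f) (cd_one R k)).

(* (x - y)^{. n} for n an integer; Negz m is - (m + 1) *)
Definition binomial_pow (y : A) (n : int) : pfun :=
  match n with
  | Posz m => ppow (PFun setT (fun x => x - y)) m
  | Negz m =>
      ppow (PFun (~` sphere_of y)
                 (fun x => cd_inv (Delta y x) ** (x - cd_conj y))) m.+1
  end.

Definition laurent_term (y : A) (a : int -> A) (n : int) : A -> A :=
  fn (pmul (binomial_pow y n) (pcst setT (a n))).

Definition sigma (x y : A) : R :=
  if `[< common_slice x y >] then enorm (x - y)
  else Num.sqrt ((cd_re x - cd_re y) ^+ 2
                 + (enorm (cd_im x) + enorm (cd_im y)) ^+ 2).

Definition tau (x y : A) : R :=
  if `[< common_slice x y >] then enorm (x - y)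
  else Num.sqrt ((cd_re x - cd_re y) ^+ 2
                 + (enorm (cd_im x) - enorm (cd_im y)) ^+ 2).

Definition Sigma0 (y : A) (r : R) : set A :=
  [set x | 0 < tau x y /\ sigma x y < r].

Definition laurent_expansion (f : pfun) (y : A) (r : R) (a : int -> A) : Prop :=
  forall x, Sigma0 y r x ->
    exists s1 s2 : A,
      [/\ series (fun m : nat => laurent_term y a (Posz m) x) @ \oo --> s1,
          series (fun m : nat => laurent_term y a (Negz m) x) @ \oo --> s2
        & fn f x = s1 + s2].

Definition singularity (f : pfun) (y : A) : Prop :=
  exists2 r : R, 0 < r & Sigma0 y r `<=` dom f.

Definition pole (f : pfun) (y : A) : Prop :=
  exists r : R, [/\ 0 < r, Sigma0 y r `<=` dom f &
    exists2 a : int -> A, laurent_expansion f y r a &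
      exists m : nat, forall n : int, n < - m%:Z -> a n = 0].

Definition removable (f : pfun) (y : A) : Prop :=
  singularity f y /\
  exists g : pfun,
    [/\ [/\ circular (dom g), open (dom g) & slice_regular (dom g) (fn g)],
        dom f `<=` dom g, dom g y & forall x, dom f x -> fn g x = fn f x].

Definition semiregular (Om : set A) (f : pfun) : Prop :=
  [/\ [/\ circular (dom f), open (dom f) & dom f `<=` Om],
      slice_regular (dom f) (fn f)
    & forall y, Om y -> ~ dom f y -> pole f y \/ removable f y].

End SliceFunctions.

Arguments pfun : clear implicits.

(* The unital real algebra structures below live on the quotient of the subset
   S of T by the relation e. *)
Section Algebras.
Context {R : realType} {T : Type}.
Variables (S : set T) (e : T -> T -> Prop).
Variables (add : T -> T -> T) (scale : R -> T -> T) (mul : T -> T -> T).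
Variables (conj : T -> T) (zero one : T).

Definition associator (x y z : T) : T :=
  add (mul (mul x y) z) (scale (-1) (mul x (mul y z))).

Record quotient_operations : Prop := QuotientOperations {
  quo_refl : forall x, S x -> e x x;
  quo_sym : forall x y, S x -> S y -> e x y -> e y x;
  quo_trans : forall x y z, S x -> S y -> S z -> e x y -> e y z -> e x z;
  quo_zero : S zero;
  quo_one : S one;
  quo_add : forall x y, S x -> S y -> S (add x y);
  quo_scale : forall r x, S x -> S (scale r x);
  quo_mul : forall x y, S x -> S y -> S (mul x y);
  quo_conj : forall x, S x -> S (conj x);
  quo_add_congr : forall x x' y y', S x -> S x' -> S y -> S y' ->
    e x x' -> e y y' -> e (add x y) (add x' y');
  quo_scale_congr : forall r x x', S x -> S x' ->
    e x x' -> e (scale r x) (scale r x');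
  quo_mul_congr : forall x x' y y', S x -> S x' -> S y -> S y' ->
    e x x' -> e y y' -> e (mul x y) (mul x' y');
  quo_conj_congr : forall x x', S x -> S x' ->
    e x x' -> e (conj x) (conj x') }.

Record algebra_laws : Prop := AlgebraLaws {
  alg_addA : forall x y z, S x -> S y -> S z ->
    e (add x (add y z)) (add (add x y) z);
  alg_addC : forall x y, S x -> S y -> e (add x y) (add y x);
  alg_add0 : forall x, S x -> e (add zero x) x;
  alg_addN : forall x, S x -> e (add x (scale (-1) x)) zero;
  alg_scaleA : forall r s x, S x -> e (scale r (scale s x)) (scale (r * s) x);
  alg_scale1 : forall x, S x -> e (scale 1 x) x;
  alg_scaleDr : forall r x y, S x -> S y ->
    e (scale r (add x y)) (add (scale r x) (scale r y));
  alg_scaleDl : forall r s x, S x ->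
    e (scale (r + s) x) (add (scale r x) (scale s x));
  alg_mulDl : forall x y z, S x -> S y -> S z ->
    e (mul (add x y) z) (add (mul x z) (mul y z));
  alg_mulDr : forall x y z, S x -> S y -> S z ->
    e (mul x (add y z)) (add (mul x y) (mul x z));
  alg_scaleAl : forall r x y, S x -> S y ->
    e (mul (scale r x) y) (scale r (mul x y));
  alg_scaleAr : forall r x y, S x -> S y ->
    e (mul x (scale r y)) (scale r (mul x y));
  alg_mul1l : forall x, S x -> e (mul one x) x;
  alg_mul1r : forall x, S x -> e (mul x one) x }.

Record alternative_laws : Prop := AlternativeLaws {
  alt_left : forall x y, S x -> S y -> e (associator x x y) zero;
  alt_flex : forall x y, S x -> S y -> e (associator x y x) zero;
  alt_right : forall x y, S x -> S y -> e (associator y x x) zero }.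

Record star_laws : Prop := StarLaws {
  star_add : forall x y, S x -> S y -> e (conj (add x y)) (add (conj x) (conj y));
  star_scale : forall r x, S x -> e (conj (scale r x)) (scale r (conj x));
  star_invol : forall x, S x -> e (conj (conj x)) x;
  star_mul : forall x y, S x -> S y -> e (conj (mul x y)) (mul (conj y) (conj x));
  star_real : forall r, e (conj (scale r one)) (scale r one) }.

Definition alternative_star_algebra : Prop :=
  [/\ quotient_operations, algebra_laws, alternative_laws & star_laws].

Definition has_inverse (x : T) : Prop :=
  exists y, [/\ S y, e (mul x y) one & e (mul y x) one].

Definition division_algebra : Prop :=
  forall x, S x -> ~ e x zero -> has_inverse x.

End Algebras.

(* Main.v *)
(* Identify a slice function with its stem F_1 + i F_2, a map from the plane set D
   to the complexification of A. A point of D is at most a pole exactly when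
   |z - w|^m F(z) stays bounded near it for some m, so the semiregular functions
   are the meromorphic maps F on D such that conjugating z changes the sign of F_2.
   The complexification of A is an alternative *-algebra and F conj(F) is a scalar
   function N(F); hence the laws hold pointwise, and N(F)^-1 conj(F) is an inverse
   of F as soon as N(F) vanishes identically near no point of D.
   By the identity theorem this is the case when N(F) is not locally zero at one
   point of each component of D. If D contains a real point, F takes there values
   in A, on which N is the squared Euclidean norm. If D has two conjugate
   components, conjugation transports a zero of infinite order from one to the
   other, while F = 1 + i I on one and F = 1 - i I on the other has N(F) = 0.
   Complex analysis is done without integrals: Cauchy's formula on a circle is
   replaced by means over roots of unity, whose number tends to infinity. *)
Require Import Defs.
From HB Require Import structures.
From mathcomp Require Import all_boot all_order all_algebra.
From mathcomp Require Import all_classical all_reals all_analysis.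
From mathcomp Require Import complex ring lra.
Import Order.TTheory GRing.Theory Num.Theory.
Import numFieldNormedType.Exports.
Local Open Scope classical_set_scope.
Local Open Scope ring_scope.
Set Implicit Arguments.
Unset Strict Implicit.
Unset Printing Implicit Defensive.

(** * Holomorphic functions of one complex variable *)

(** Two choices shape the argument. Strict differentiability serves as holomorphy because its error
    bound concerns pairs of points: it yields continuity of the derivative and, by compactness, one
    mesh size for a whole disc, which makes the sums over polygons converge. Singularities are
    treated in the plane: a pole is defined at a point of A by a series of slice powers, but on the
    slice of the centre this becomes an ordinary Laurent series whose scalars act on the
    coefficients through left multiplication by J. Growth of the stem function is visibly stable
    under sums and products and speaks of a whole sphere at once. The way back from growth to a
    series meets one obstacle: at a real centre all slices meet, so a single sequence of
    coefficients has to serve every imaginary unit; the parity of the stem function provides it.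
    Non-associativity does no harm, since slice powers of x - y stay in the commutative
    complexification of C_J, and since the inverse is a scalar multiple of the conjugate. *)

Section ComplexModulus.
Variable R : realType.
Local Notation C := R[i].
Implicit Types z w : C.

Definition cabs z : R := Normc.normc z.

Lemma cabsM z w : cabs (z * w) = cabs z * cabs w.
Proof. exact: Normc.normcM. Qed.

Lemma cabs0 : cabs 0 = 0. Proof. exact: Normc.normc0. Qed.

Lemma cabsBB z : cabs (z - z) = 0. Proof. by rewrite subrr cabs0. Qed.

Lemma cabs1 : cabs 1 = 1. Proof. exact: Normc.normc1. Qed.

Lemma cabsV z : cabs z^-1 = (cabs z)^-1.
Proof. exact: Normc.normcV. Qed.

Lemma cabsN z : cabs (- z) = cabs z.
Proof. exact: normcN. Qed.

Lemma cabsB z w : cabs (z - w) = cabs (w - z).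
Proof. by rewrite -cabsN opprB. Qed.

Lemma cabsX z n : cabs (z ^+ n) = cabs z ^+ n.
Proof. by elim: n => [|n IH]; rewrite ?expr0 ?cabs1// !exprS cabsM IH. Qed.

Lemma cabs_ge0 z : 0 <= cabs z.
Proof. by case: z => a b; rewrite /cabs /= sqrtr_ge0. Qed.

Lemma cabs_eq0 z : (cabs z == 0) = (z == 0).
Proof. by apply/eqP/eqP => [/Normc.eq0_normc//|->]; rewrite cabs0. Qed.

Lemma cabs_gt0 z : (0 < cabs z) = (z != 0).
Proof. by rewrite lt_def cabs_ge0 andbT cabs_eq0. Qed.

Lemma cabsD z w : cabs (z + w) <= cabs z + cabs w.
Proof. exact: le_normcD. Qed.

Lemma cabsBD z w : cabs (z - w) <= cabs z + cabs w.
Proof. by rewrite -[cabs w]cabsN cabsD. Qed.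

Lemma cabs_sub_ge z w : cabs z - cabs w <= cabs (z - w).
Proof. by have := cabsD (z - w) w; rewrite subrK; lra. Qed.

Lemma cabs_sum (I : Type) (s : seq I) (P : pred I) (F : I -> C) :
  cabs (\sum_(i <- s | P i) F i) <= \sum_(i <- s | P i) cabs (F i).
Proof.
elim/big_ind2: _ => [|z r w t zr wt|//]; first by rewrite cabs0.
by rewrite (le_trans (cabsD _ _))// lerD.
Qed.

Lemma cabs_real (r : R) : cabs r%:C%C = `|r|.
Proof. by rewrite /cabs /= expr0n/= addr0 sqrtr_sqr. Qed.

Lemma cabs_nat n : cabs n%:R = n%:R.
Proof. by rewrite -[_%:R](rmorph_nat (real_complex R)) cabs_real ger0_norm. Qed.

Lemma cabs_sqr z : cabs z ^+ 2 = complex.Re z ^+ 2 + complex.Im z ^+ 2.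
Proof. by case: z => a b; rewrite /cabs /= sqr_sqrtr// addr_ge0// sqr_ge0. Qed.

Lemma ler_Re_cabs z : `|complex.Re z| <= cabs z.
Proof.
by rewrite -(@ler_pXn2r _ 2)// ?nnegrE ?cabs_ge0// real_normK ?num_real// cabs_sqr lerDl sqr_ge0.
Qed.

Lemma ler_Im_cabs z : `|complex.Im z| <= cabs z.
Proof.
by rewrite -(@ler_pXn2r _ 2)// ?nnegrE ?cabs_ge0// real_normK ?num_real// cabs_sqr lerDr sqr_ge0.
Qed.

Lemma cabs_le_ReIm z : cabs z <= `|complex.Re z| + `|complex.Im z|.
Proof.
rewrite -(@ler_pXn2r _ 2)// ?nnegrE ?cabs_ge0 ?addr_ge0// cabs_sqr sqrrD.
by rewrite !real_normK ?num_real// lerD2r lerDl mulrn_wge0// mulr_ge0.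
Qed.

End ComplexModulus.

Arguments cabs {R} z : simpl never.

(** * Strict complex differentiability and its calculus *)

Section StrictDifferentiability.
Variable R : realType.
Local Notation C := R[i].
Implicit Types (f g : C -> C) (z w d : C).

(* Strict (as opposed to pointwise) complex differentiability at every point
   of an open set amounts to being C1 and satisfying the Cauchy-Riemann
   equations there. *)
Definition sdiff f z d := forall e : R, 0 < e -> exists2 r : R, 0 < r &
  forall z1 z2, cabs (z1 - z) < r -> cabs (z2 - z) < r ->
    cabs (f z1 - f z2 - d * (z1 - z2)) <= e * cabs (z1 - z2).

Lemma sdiff_cst c z : sdiff (fun=> c) z 0.
Proof.
move=> e e0; exists 1 => // z1 z2 _ _.
by rewrite subrr mul0r subr0 cabs0 mulr_ge0// ?cabs_ge0// ltW.
Qed.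

Lemma sdiff_id z : sdiff id z 1.
Proof.
move=> e e0; exists 1 => // z1 z2 _ _.
by rewrite mul1r subrr cabs0 mulr_ge0// ?cabs_ge0// ltW.
Qed.

Lemma sdiffD f g z d d' : sdiff f z d -> sdiff g z d' ->
  sdiff (fun x => f x + g x) z (d + d').
Proof.
move=> hf hg e e0.
have e2 : 0 < e / 2 by rewrite divr_gt0.
have [r r0 Hr] := hf _ e2; have [s s0 Hs] := hg _ e2.
exists (Num.min r s) => [|z1 z2]; first by rewrite lt_min r0.
rewrite !lt_min => /andP[a1 a2] /andP[b1 b2].
have := Hr _ _ a1 b1; have := Hs _ _ a2 b2.
set A := _ - d' * _; set B := _ - d * _ => HA HB.
have -> : f z1 + g z1 - (f z2 + g z2) - (d + d') * (z1 - z2) = B + A.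
  by rewrite /A /B; ring.
have := cabsD B A; lra.
Qed.

Lemma sdiff_lipschitz f z d : sdiff f z d -> exists2 r : R, 0 < r &
  forall z1 z2, cabs (z1 - z) < r -> cabs (z2 - z) < r ->
    cabs (f z1 - f z2) <= (cabs d + 1) * cabs (z1 - z2).
Proof.
move=> /(_ 1 ltr01) [r r0 H]; exists r => // z1 z2 a b.
have := H _ _ a b; have := cabsD (f z1 - f z2 - d * (z1 - z2)) (d * (z1 - z2)).
rewrite subrK cabsM; lra.
Qed.

Lemma sdiff_continuous f z d : sdiff f z d -> forall e : R, 0 < e ->
  exists2 r : R, 0 < r & forall w, cabs (w - z) < r -> cabs (f w - f z) < e.
Proof.
move=> /sdiff_lipschitz [r r0 H] e e0.
have K0 : 0 < cabs d + 1 by have := cabs_ge0 d; lra.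
exists (Num.min r (e / (cabs d + 1))) => [|w]; first by rewrite lt_min r0 divr_gt0.
rewrite lt_min => /andP[a]; rewrite ltr_pdivlMr// mulrC => b.
by rewrite (le_lt_trans (H _ _ a _))// subrr cabs0.
Qed.

Lemma sdiff_bounded f z d : sdiff f z d -> exists M r : R, [/\ 0 < M, 0 < r &
  forall w, cabs (w - z) < r -> cabs (f w) <= M].
Proof.
move=> /sdiff_continuous /(_ 1 ltr01) [r r0 H].
exists (cabs (f z) + 1), r; split=> // [|w /H]; first by have := cabs_ge0 (f z); lra.
by have := cabsD (f w - f z) (f z); rewrite subrK; lra.
Qed.

Lemma sdiffM f g z d d' : sdiff f z d -> sdiff g z d' ->
  sdiff (fun x => f x * g x) z (f z * d' + d * g z).
Proof.
move=> hf hg e e0.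
have [Kf [rf [Kf0 rf0 Hf]]] := sdiff_bounded hf.
have [Kg [rg [Kg0 rg0 Hg]]] := sdiff_bounded hg.
have e4 K : 0 < K -> 0 < e / 4 / K by move=> K0; rewrite !divr_gt0.
have [r1 r10 H1] := hf _ (e4 _ Kg0); have [r2 r20 H2] := hg _ (e4 _ Kf0).
have Dp x : 0 < cabs x + 1 :> R by have := cabs_ge0 x; lra.
have [r3 r30 H3] := sdiff_continuous hf (e4 _ (Dp d')).
have [r4 r40 H4] := sdiff_continuous hg (e4 _ (Dp d)).
exists (Num.min (Num.min rf rg) (Num.min (Num.min r1 r2) (Num.min r3 r4))) => [|z1 z2].
  by rewrite !lt_min rf0 rg0 r10 r20 r30 r40.
rewrite !lt_min => /andP[/andP[a1 a2]] /andP[/andP[a3 a4] /andP[a5 a6]].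
move=> /andP[/andP[b1 b2]] /andP[/andP[b3 b4] /andP[b5 b6]].
set x := z1 - z2.
(* The errors of the two factors come first; the last two terms account for taking the other factor
   at [z1] or [z2] instead of [z]. Each of the four gets a quarter of [e]. *)
have -> : f z1 * g z1 - f z2 * g z2 - (f z * d' + d * g z) * x =
  f z1 * (g z1 - g z2 - d' * x) + (f z1 - f z2 - d * x) * g z2
  + ((f z1 - f z) * d' * x + d * (g z2 - g z) * x) by ring.
have n0 := cabs_ge0 x.
have t1 : cabs (f z1 * (g z1 - g z2 - d' * x)) <= e / 4 * cabs x.
  rewrite cabsM (le_trans (ler_pM (cabs_ge0 _) (cabs_ge0 _) (Hf _ a1) (H2 _ _ a4 b4)))//.
  by rewrite mulrA mulrCA divff ?mulr1// gt_eqF.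
have t2 : cabs ((f z1 - f z2 - d * x) * g z2) <= e / 4 * cabs x.
  rewrite cabsM (le_trans (ler_pM (cabs_ge0 _) (cabs_ge0 _) (H1 _ _ a3 b3) (Hg _ b2)))//.
  by rewrite mulrAC divfK// gt_eqF.
have t3 : cabs ((f z1 - f z) * d' * x) <= e / 4 * cabs x.
  rewrite !cabsM ler_wpM2r//.
  have := H3 _ a5; rewrite ltr_pdivlMr// => h3; apply/ltW/(le_lt_trans _ h3).
  by rewrite mulrDr mulr1 lerDl cabs_ge0.
have t4 : cabs (d * (g z2 - g z) * x) <= e / 4 * cabs x.
  rewrite !cabsM ler_wpM2r// mulrC.
  have := H4 _ b6; rewrite ltr_pdivlMr// => h3; apply/ltW/(le_lt_trans _ h3).
  by rewrite mulrDr mulr1 lerDl cabs_ge0.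
rewrite (le_trans (cabsD _ _))// (le_trans (lerD (cabsD _ _) (cabsD _ _)))//; lra.
Qed.

Lemma sdiffV f z d : sdiff f z d -> f z != 0 ->
  sdiff (fun x => (f x)^-1) z (- d / f z ^+ 2).
Proof.
move=> hf fz0 e e0.
have [m Em] : exists m, m = cabs (f z) / 2 by eexists.
have m0 : 0 < m by rewrite Em divr_gt0// cabs_gt0.
have [r1 r10 H1] := sdiff_continuous hf m0.
have fm w : cabs (w - z) < r1 -> m < cabs (f w).
  move=> /H1; have := cabs_sub_ge (f z) (f w); rewrite cabsB Em; lra.
have em0 : 0 < e / 2 * (m * m) by rewrite !mulr_gt0.
have [r2 r20 H2] := hf _ em0.
have [r3 r30 H3] := sdiff_lipschitz hf.
have K0 : 0 < cabs d + 1 by have := cabs_ge0 d; lra.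
(* The cube of [m] compensates the factor [5 * m] from the numerator and [1 / (4 * m ^ 4)] from the
   denominators below; what remains is [5 / 16 * e], less than [e / 2]. *)
pose eta := e / 4 * (m * (m * m)) / (cabs d + 1).
have eta0 : 0 < eta by rewrite divr_gt0// !mulr_gt0.
have [r4 r40 H4] := sdiff_continuous hf eta0.
exists (Num.min (Num.min r1 r2) r4) => [|z1 z2]; first by rewrite !lt_min r10 r20.
rewrite !lt_min => /andP[/andP[a1 a2] a3] /andP[/andP[b1 b2] b3].
have f10 : f z1 != 0 by rewrite -cabs_gt0 (lt_trans m0 (fm _ a1)).
have f20 : f z2 != 0 by rewrite -cabs_gt0 (lt_trans m0 (fm _ b1)).
set x := z1 - z2.
(* The first term carries the error of [f], the second the replacement of [f z ^ 2] by [f z1 * f z2]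
   in the denominator. *)
have -> : (f z1)^-1 - (f z2)^-1 - - d / f z ^+ 2 * x =
  - (f z1 - f z2 - d * x) * ((f z1)^-1 * (f z2)^-1)
  + d * ((f z1 - f z) * f z2 + f z * (f z2 - f z)) * x *
    ((f z1)^-1 * (f z2)^-1 * ((f z)^-1 * (f z)^-1)).
  by field; rewrite fz0 f10 f20.
have n0 := cabs_ge0 x.
have vm w : m < cabs w -> cabs w^-1 <= m^-1.
  by move=> mw; rewrite cabsV lef_pV2 ?posrE ?ltW//; exact: lt_trans mw.
have t1 : cabs (- (f z1 - f z2 - d * x) * ((f z1)^-1 * (f z2)^-1)) <= e / 2 * cabs x.
  rewrite !cabsM cabsN.
  have := ler_pM (cabs_ge0 _) (mulr_ge0 (cabs_ge0 _) (cabs_ge0 _)) (H2 _ _ a2 b2)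
    (ler_pM (cabs_ge0 _) (cabs_ge0 _) (vm _ (fm _ a1)) (vm _ (fm _ b1))).
  move=> /le_trans; apply.
  rewrite [leLHS](_ : _ = e / 2 * cabs x)//; field; exact: lt0r_neq0.
have fz2 : cabs (f z) = 2 * m by rewrite Em; field.
have fzV : cabs (f z)^-1 = (2 * m)^-1 by rewrite cabsV fz2.
have fz2b : cabs (f z2) <= 3 * m.
  have := H1 _ b1; have := cabsD (f z2 - f z) (f z); rewrite subrK fz2; lra.
have t2 : cabs (d * ((f z1 - f z) * f z2 + f z * (f z2 - f z)) * x *
    ((f z1)^-1 * (f z2)^-1 * ((f z)^-1 * (f z)^-1))) <= e / 2 * cabs x.
  have h1 := ltW (H4 _ a3); have h2 := ltW (H4 _ b3).
  have q1 : cabs ((f z1 - f z) * f z2 + f z * (f z2 - f z)) <= eta * (5 * m).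
    rewrite (le_trans (cabsD _ _))// !cabsM fz2.
    have := ler_pM (cabs_ge0 _) (cabs_ge0 _) h1 fz2b.
    have := ler_wpM2l (ltW m0) h2; lra.
  have q2 : cabs d * cabs ((f z1 - f z) * f z2 + f z * (f z2 - f z)) <=
    e / 4 * (m * (m * m)) * (5 * m).
    apply: (@le_trans _ _ ((cabs d + 1) * (eta * (5 * m)))).
      by rewrite ler_pM ?cabs_ge0// lerDl.
    by rewrite mulrA (_ : (cabs d + 1) * eta = e / 4 * (m * (m * m)))// mulrC divfK// gt_eqF.
  have q3 : cabs ((f z1)^-1 * (f z2)^-1 * ((f z)^-1 * (f z)^-1)) <=
     m^-1 * m^-1 * ((2 * m)^-1 * (2 * m)^-1).
    rewrite 3!cabsM fzV ler_wpM2r//.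
      by rewrite mulr_ge0// invr_ge0 mulr_ge0// ltW.
    by rewrite ler_pM ?cabs_ge0// vm// fm.
  rewrite cabsM [cabs (_ * x)]cabsM [cabs (d * _)]cabsM mulrAC.
  apply: (@le_trans _ _ (e / 4 * (m * (m * m)) * (5 * m) *
     (m^-1 * m^-1 * ((2 * m)^-1 * (2 * m)^-1)) * cabs x)).
    rewrite ler_wpM2r// ler_pM ?cabs_ge0//.
    by rewrite mulr_ge0 ?cabs_ge0.
  rewrite ler_wpM2r//.
  rewrite [leLHS](_ : _ = e * (5 / 16)); first by lra.
  by field; exact: lt0r_neq0.
rewrite (le_trans (cabsD _ _))//; lra.
Qed.

Lemma sdiff_eq_near f g z d (r : R) : 0 < r ->
  (forall w, cabs (w - z) < r -> f w = g w) -> sdiff f z d -> sdiff g z d.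
Proof.
move=> r0 fg hf e e0; have [s s0 H] := hf _ e0.
exists (Num.min r s) => [|z1 z2]; first by rewrite lt_min r0.
rewrite !lt_min => /andP[a1 a2] /andP[b1 b2].
by rewrite -!fg//; apply: H.
Qed.

Lemma sdiff_shift f c z d : sdiff f (c + z) d -> sdiff (fun x => f (c + x)) z d.
Proof.
move=> hf e e0; have [s s0 H] := hf _ e0.
exists s => // z1 z2 h1 h2.
have Es (x y : C) : c + x - (c + y) = x - y by ring.
by have := H (c + z1) (c + z2); rewrite !Es; apply.
Qed.

Lemma sdiff_pow z n : exists d, sdiff (fun x => x ^+ n) z d.
Proof.
elim: n => [|n [d IH]]; first by exists 0; apply: sdiff_cst.
exists (z * d + 1 * z ^+ n) => //.
apply: (@sdiff_eq_near (fun x => x * x ^+ n) _ _ _ 1) => // [w _|].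
  by rewrite exprS.
exact: sdiffM (@sdiff_id z) IH.
Qed.

(** The strict estimates at [z] and at [w] both apply to the same small increment from [w];
    subtracting them bounds [(g w - g z) * x] by a multiple of [|x|]. *)
Lemma sdiff_deriv_continuous f g z (r0 : R) : 0 < r0 ->
  (forall w, cabs (w - z) < r0 -> sdiff f w (g w)) ->
  forall e : R, 0 < e -> exists2 r : R, 0 < r &
    forall w, cabs (w - z) < r -> cabs (g w - g z) <= e.
Proof.
move=> r00 hf e e0; have e2 : 0 < e / 2 by rewrite divr_gt0.
have [r r_gt0 H] := hf z (ltac:(rewrite subrr cabs0//)) _ e2.
exists (Num.min r r0) => [|w]; first by rewrite lt_min r_gt0.
rewrite lt_min => /andP[wr wr0].
have [s s0 Hs] := hf w wr0 _ e2.
pose t := Num.min (s / 2) ((r - cabs (w - z)) / 2).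
have t0 : 0 < t by rewrite lt_min !divr_gt0// subr_gt0.
have [ts tr] : t <= s / 2 /\ t <= (r - cabs (w - z)) / 2 by rewrite !ge_min !lexx orbT.
pose x : C := t%:C%C.
have cx : cabs x = t by rewrite cabs_real gtr0_norm.
have h1 : cabs (w + x - z) < r.
  have := cabsD (w - z) x; rewrite cx addrAC; lra.
have h2 : cabs (w + x - w) < s by rewrite addrC addKr cx; lra.
have h3 : cabs (w - w) < s by rewrite cabsBB.
have := H _ _ h1 wr; have := Hs _ _ h2 h3.
rewrite (_ : w + x - w = x); last by rewrite addrC addKr.
set A := _ - g w * x; set B := _ - g z * x; rewrite cx => hA hB.
have : cabs ((g w - g z) * x) <= e * t.
  rewrite (_ : _ * x = B - A); last by rewrite /A /B; ring.
  have := cabsBD B A; lra.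
by rewrite cabsM cx ler_pM2r.
Qed.

End StrictDifferentiability.

(** * Roots of unity *)

Section RootsOfUnity.
Variable R : realType.
Local Notation C := R[i].

Definition expi (t : R) : C := (cos t +i* sin t)%C.

Lemma expiD s t : expi (s + t) = expi s * expi t.
Proof. by apply/eqP; rewrite eq_complex /= cosD sinD addrC eqxx/= addrC mulrC. Qed.

Lemma expiX t n : expi t ^+ n = expi (t *+ n).
Proof.
elim: n => [|n IH]; last by rewrite exprS IH mulrS expiD.
by apply/eqP; rewrite eq_complex /= mulr0n cos0 sin0 !eqxx.
Qed.

Lemma cabs_expi t : cabs (expi t) = 1.
Proof. by rewrite /cabs /= cos2Dsin2 sqrtr1. Qed.

Lemma expi_eq1 t : 0 < t < pi *+ 2 -> expi t <> 1.
Proof.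
move=> /andP[t0 t2] /eqP; rewrite eq_complex /= => /andP[/eqP ct _].
have s0 : 0 < sin (t / 2) by apply: sin_gt0_pi; move: t2; rewrite mulr2n; lra.
have : cos (t / 2 *+ 2) = 1 by rewrite -mulr_natr divfK.
rewrite cos_mulr2n cos2sin2 => H.
have := exprn_gt0 2 s0; lra.
Qed.

Definition zeta (n : nat) : C := expi (pi *+ 2 / n%:R).

Lemma cabs_zeta n : cabs (zeta n) = 1.
Proof. exact: cabs_expi. Qed.

Lemma zeta_prim n : (0 < n)%N -> n.-primitive_root (zeta n).
Proof.
move=> n0; apply/andP; split => //; apply/forallP => -[i /= ilt].
rewrite unity_rootE expiX.
have nR : n%:R != 0 :> R by rewrite pnatr_eq0 -lt0n.
rewrite -[X in expi X]mulr_natr -mulrA (mulrC _^-1); have [->|neq] := eqVneq i.+1 n.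
  by rewrite divff// mulr1 /expi cos2pi sin2pi eqxx.
suff /eqP : expi (pi *+ 2 * (i.+1%:R / n%:R)) <> 1 by move/negPf ->.
have pi0 := @pi_gt0 R.
have p20 : 0 < pi *+ 2 :> R by rewrite mulr2n addr_gt0.
apply: expi_eq1; rewrite mulr_gt0 ?divr_gt0 ?ltr0n//= gtr_pMr//.
by rewrite ltr_pdivrMr ?ltr0n// mul1r ltr_nat ltn_neqAle neq.
Qed.

(** The mesh of the polygon of [n]-th roots of unity is [|zeta n - 1|]; this makes it arbitrarily
    fine. *)
Lemma zeta_near1 (d : R) : 0 < d ->
  exists n0, forall n, (n0 <= n)%N -> cabs (zeta n - 1) < d.
Proof.
move=> d0; have d2 : 0 < d / 2 by rewrite divr_gt0.
have /cvgrPdist_lt /(_ _ d2) := @continuous_cos R 0.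
have /cvgrPdist_lt /(_ _ d2) := @continuous_sin R 0.
rewrite cos0 sin0 => hs hc.
have /nbhs_ballP[r /= r0 H] : nbhs (0 : R) (fun t => `|0 - sin t| < d / 2 /\ `|1 - cos t| < d / 2).
  by apply: filterS2 hs hc => t; split.
have pi0 := @pi_gt0 R.
exists (Num.truncn (pi *+ 2 / r)).+1 => n nn.
have n0 : 0 < n%:R :> R by rewrite ltr0n (leq_trans _ nn).
have Ez : cabs (zeta n - 1) <= `|cos (pi *+ 2 / n%:R) - 1| + `|sin (pi *+ 2 / n%:R)|.
  by rewrite (le_trans (cabs_le_ReIm _))//= subr0.
apply: (le_lt_trans Ez); have [] := H (pi *+ 2 / n%:R).
  have t0 : 0 < pi *+ 2 / n%:R :> R by rewrite divr_gt0// mulr2n addr_gt0.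
  rewrite -ball_normE /ball_ /= sub0r normrN gtr0_norm// ltr_pdivrMr//.
  rewrite mulrC -ltr_pdivrMr// (lt_le_trans (truncnS_gt _))// ler_nat//.
rewrite sub0r normrN => h1; rewrite distrC => h2.
lra.
Qed.

(** Orthogonality of characters: the sum is geometric with ratio [w ^ i / w ^ j], whose [n]-th power
    is 1. *)
Lemma sum_prim_root n (w : C) i j : n.-primitive_root w -> (i < n)%N -> (j < n)%N ->
  \sum_(l < n) (w ^+ l) ^+ i * ((w ^+ l)^-1) ^+ j = if i == j then n%:R else 0.
Proof.
move=> pw ilt jlt.
have w0 : w != 0 by rewrite (prim_root_eq0 pw) -lt0n (leq_trans _ ilt).
pose x := w ^+ i * w^-1 ^+ j.
rewrite (eq_bigr (fun l : 'I_n => x ^+ l)) => [|l _]; last first.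
  by rewrite /x exprMn -!exprVn -!exprM mulnC [(j * _)%N]mulnC.
have [eij|neq] := eqVneq i j.
  have -> : x = 1 by rewrite /x eij exprVn divff// expf_neq0.
  rewrite (eq_bigr (fun=> 1)) ?sumr_const ?card_ord// => l _; exact: expr1n.
apply: (@mulfI _ (x - 1)); last first.
  rewrite -subrX1 mulr0 /x exprMn -!exprM ![(_ * n)%N]mulnC !exprM (prim_expr_order pw).
  by rewrite exprVn (prim_expr_order pw) invr1 !expr1n mulr1 subrr.
rewrite subr_eq0 /x exprVn; apply: contra neq => /eqP e1.
have /eqP : w ^+ i = w ^+ j by rewrite -[RHS]mul1r -e1 divfK// expf_neq0.
by rewrite (eq_prim_root_expr pw) !modn_small.
Qed.

End RootsOfUnity.

Section UniformStrictDifferentiability.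
Variable R : realType.
Local Notation C := R[i].

(** Compactness is applied to the square of half-side [rho] around the disc, where [|z|] is only
    bounded by [|Re z| + |Im z| <= 2 * rho]; hence the margin between [rho] and [r]. *)
Lemma sdiff_uniform (G g : C -> C) (rho r : R) : 0 < rho -> 2 * rho < r ->
  (forall z, cabs z < r -> sdiff G z (g z)) ->
  forall e : R, 0 < e -> exists2 d : R, 0 < d &
    forall z1 z2, cabs z1 <= rho -> cabs (z2 - z1) < d ->
      cabs (G z1 - G z2 - g z1 * (z1 - z2)) <= e * cabs (z1 - z2).
Proof.
move=> rho0 rr HG e e0.
pose toC (p : R * R) : C := (p.1 +i* p.2)%C.
pose K : set (R * R) := `[- rho, rho] `*` `[- rho, rho].
have cK : compact K by apply: compact_setX; exact: segment_compact.
pose P (d : R) (p : R * R) := forall z2, cabs (z2 - toC p) < d ->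
      cabs (G (toC p) - G z2 - g (toC p) * (toC p - z2)) <= e * cabs (toC p - z2).
have /compact_near_coveringP /(_ R (0 : R)^'+ P _) H := cK.
have : \forall d \near (0 : R)^'+, K `<=` P d.
  apply: H => -[a b] [/= ]; rewrite !in_itv /= -!ler_norml => ka kb.
  have cz : cabs (toC (a, b)) < r.
    by rewrite (le_lt_trans (cabs_le_ReIm _))//= (le_lt_trans (lerD ka kb))//; lra.
  have e2 : 0 < e / 2 by rewrite divr_gt0.
  have [s s0 Hs] := HG _ cz _ e2.
  have near_r w : cabs (w - toC (a, b)) < r - cabs (toC (a, b)) -> sdiff G w (g w).
    by move=> h; apply: HG; have := cabsD (w - toC (a, b)) (toC (a, b)); rewrite subrK; lra.
  have rz : 0 < r - cabs (toC (a, b)) by rewrite subr_gt0.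
  have [t t0 Ht] := sdiff_deriv_continuous rz near_r e2.
  (* Below, [z1] lies within [2 * u] and [z2] within [3 * u] of the centre, so both stay where the
     strict estimate and the continuity of [g] hold. *)
  pose u := Num.min s t / 4.
  have u0 : 0 < u by rewrite divr_gt0// lt_min s0.
  have [us ut] : 4 * u <= s /\ 4 * u <= t.
    by rewrite mulrC /u divfK// !ge_min !lexx orbT.
  exists (ball (a, b) u, [set d | d < u]) => /=.
    split; first exact: nbhsx_ballx.
    exact: nbhs_right_lt.
  move=> [[a' b'] d] /= [[/= ba bb] du] z2 hz2.
  set z := toC (a, b) in Hs Ht hz2 *; set z1 := toC (a', b').
  have h1 : cabs (z1 - z) < 2 * u.
    rewrite (le_lt_trans (cabs_le_ReIm _))//= distrC [X in _ + X]distrC.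
    by move: ba bb; rewrite -!ball_normE /ball_ /=; lra.
  have h2 : cabs (z2 - z) < 3 * u.
    by have := cabsD (z2 - z1) (z1 - z); rewrite subrKA; move: hz2; rewrite -/z1; lra.
  have k1 : cabs (z1 - z) < s by lra.
  have k2 : cabs (z2 - z) < s by lra.
  have k3 : cabs (z1 - z) < t by lra.
  have := Hs _ _ k1 k2; have := Ht _ k3.
  set x := z1 - z2 => hg hG.
  have -> : G z1 - G z2 - g z1 * x = (G z1 - G z2 - g z * x) - (g z1 - g z) * x by ring.
  rewrite (le_trans (cabsBD _ _))// cabsM.
  have := ler_wpM2r (cabs_ge0 x) hg; lra.
move=> /nbhs_ballP[d /= d0 Hd]; exists (d / 2); first by rewrite divr_gt0.
have hd : ball (0 : R) d (d / 2).
  by rewrite -ball_normE /ball_ /= sub0r normrN gtr0_norm ?divr_gt0//; lra.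
have d20 : 0 < d / 2 by rewrite divr_gt0.
move=> [a b] z2 hz1 hz2; apply: (Hd _ hd d20 (a, b)) => //.
split; rewrite /= in_itv /= -ler_norml.
  by rewrite (le_trans _ hz1)//; exact: (ler_Re_cabs (a +i* b)%C).
by rewrite (le_trans _ hz1)//; exact: (ler_Im_cabs (a +i* b)%C).
Qed.

End UniformStrictDifferentiability.

(** * A discrete Cauchy formula *)

Section DiscreteCauchy.
Variable R : realType.
Local Notation C := R[i].

Variables (rho : R) (rho0 : 0 < rho) (n : nat) (w0 : C).
Hypotheses (w0_prim : n.-primitive_root w0) (cabs_w0 : cabs w0 = 1).

Definition circle_pt (j : nat) : C := rho%:C%C * w0 ^+ j.

Let n_gt0 : (0 < n)%N := prim_order_gt0 w0_prim.

Let nC0 : n%:R != 0 :> C. Proof. by rewrite pnatr_eq0 -lt0n. Qed.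

Let rhoC0 : rho%:C%C != 0. Proof. by rewrite eq_complex /= eqxx andbT gt_eqF. Qed.

Lemma cabs_circle_pt j : cabs (circle_pt j) = rho.
Proof. by rewrite cabsM cabsX cabs_w0 expr1n mulr1 cabs_real gtr0_norm. Qed.

Let pt0 j : circle_pt j != 0.
Proof. by rewrite -cabs_gt0 cabs_circle_pt. Qed.

Lemma circle_ptX j : circle_pt j ^+ n = rho%:C%C ^+ n.
Proof.
by rewrite exprMn -exprM mulnC exprM (prim_expr_order w0_prim) expr1n mulr1.
Qed.

Lemma circle_pt_sum i j : (i < n)%N -> (j < n)%N ->
  \sum_(l < n) circle_pt l ^+ i * ((circle_pt l)^-1) ^+ j = if i == j then n%:R else 0.
Proof.
move=> il jl; rewrite -(sum_prim_root w0_prim il jl).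
have [->|neq] := eqVneq i j; first by apply: eq_bigr => l _; rewrite !exprVn !divff ?expf_neq0// (prim_root_eq0 w0_prim) -lt0n.
transitivity (rho%:C%C ^+ i * (rho%:C%C ^-1) ^+ j * \sum_(l < n) (w0 ^+ l) ^+ i * ((w0 ^+ l)^-1) ^+ j).
  by rewrite mulr_sumr; apply: eq_bigr => l _; rewrite invfM !exprMn; ring.
by rewrite (sum_prim_root w0_prim)// (negPf neq) mulr0.
Qed.

(** The first [n] terms of the geometric series of [c / (c - w)] with [c = circle_pt j]: a truncated
    Cauchy kernel. *)
Definition kernel (w : C) (j : nat) : C :=
  \sum_(i < n) w ^+ i * ((circle_pt j)^-1) ^+ i.

(** All vertices have the same [n]-th power, so the truncation factor on the right does not depend
    on [j] and can be pulled out of the means. *)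
Lemma kernelE w j :
  (circle_pt j - w) * kernel w j = circle_pt j * (1 - w ^+ n / rho%:C%C ^+ n).
Proof.
have -> : kernel w j = \sum_(i < n) (w / circle_pt j) ^+ i.
  by apply: eq_bigr => i _; rewrite exprMn.
have -> : circle_pt j - w = - circle_pt j * (w / circle_pt j - 1).
  by field; exact: pt0.
rewrite -mulrA -subrX1 expr_div_n circle_ptX; ring.
Qed.

(** By orthogonality only the constant term survives. Thus the weights have mean 1, and constants
    are reproduced exactly. *)
Lemma sum_kernel w : \sum_(j < n) kernel w j = n%:R.
Proof.
rewrite exchange_big /= (bigD1 (Ordinal n_gt0))//= [X in _ + X]big1 => [|i i0].
  rewrite addr0 (eq_bigr (fun=> 1)) ?sumr_const ?card_ord// => j _.
  by rewrite !expr0 mulr1.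
rewrite -mulr_sumr.
have := circle_pt_sum n_gt0 (ltn_ord i); rewrite ifN; last by rewrite eq_sym.
under eq_bigr do rewrite expr0 mul1r.
by move=> ->; rewrite mulr0.
Qed.

(* The polynomial of degree < n interpolating G at the points circle_pt j. *)
Definition interp (G : C -> C) (w : C) : C :=
  n%:R^-1 * \sum_(j < n) G (circle_pt j) * kernel w j.

Definition interp_coef (G : C -> C) (i : nat) : C :=
  n%:R^-1 * \sum_(j < n) G (circle_pt j) * ((circle_pt j)^-1) ^+ i.

Lemma interpE G w : interp G w = \sum_(i < n) interp_coef G i * w ^+ i.
Proof.
rewrite /interp /interp_coef.
under eq_bigr do rewrite mulr_sumr.
rewrite exchange_big mulr_sumr; apply: eq_bigr => i _.
rewrite -mulrA mulr_suml; congr (_ * _); apply: eq_bigr => j _; ring.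
Qed.

Lemma cabs_mean (F : nat -> C) (B : R) : (forall j, (j < n)%N -> cabs (F j) <= B) ->
  cabs (n%:R^-1 * \sum_(j < n) F j) <= B.
Proof.
move=> H; have nR : 0 < n%:R :> R by rewrite ltr0n.
rewrite cabsM cabsV cabs_nat ler_pdivrMl//.
rewrite (le_trans (cabs_sum _ _ _))//.
apply: (@le_trans _ _ (\sum_(i < n) B)); first by apply: ler_sum => i _; exact: H.
by rewrite sumr_const card_ord mulr_natl.
Qed.

(** Cauchy's estimate for polynomials of degree less than [n]: orthogonality recovers the
    coefficient exactly as a mean over the [n] vertices. *)
Lemma coef_bound (c : nat -> C) (B : R) m : (m < n)%N ->
  (forall w, cabs w = rho -> cabs (\sum_(i < n) c i * w ^+ i) <= B) ->
  cabs (c m) <= B * rho^-1 ^+ m.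
Proof.
move=> mn H.
have -> : c m = n%:R^-1 *
    \sum_(j < n) (\sum_(i < n) c i * circle_pt j ^+ i) * ((circle_pt j)^-1) ^+ m.
  under eq_bigr do rewrite mulr_suml.
  rewrite exchange_big /=.
  rewrite (bigD1 (Ordinal mn))//= [X in _ + X]big1 ?addr0 => [|i im].
    under eq_bigr do rewrite -mulrA.
    by rewrite -mulr_sumr circle_pt_sum// eqxx mulrCA mulVf// mulr1.
  under eq_bigr do rewrite -mulrA.
  by rewrite -mulr_sumr circle_pt_sum// ifN ?mulr0.
apply: (@cabs_mean (fun j => (\sum_(i < n) c i * circle_pt j ^+ i) * ((circle_pt j)^-1) ^+ m)).
move=> j _; rewrite cabsM cabsX cabsV cabs_circle_pt ler_wpM2r//.
  by rewrite exprn_ge0// invr_ge0 ltW.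
by apply: H; exact: cabs_circle_pt.
Qed.

Lemma interp_coef_bound G (M : R) i : (forall z, cabs z = rho -> cabs (G z) <= M) ->
  cabs (interp_coef G i) <= M * rho^-1 ^+ i.
Proof.
move=> H; apply: (@cabs_mean (fun j => G (circle_pt j) * ((circle_pt j)^-1) ^+ i)) => j _.
rewrite cabsM cabsX cabsV cabs_circle_pt ler_wpM2r//.
  by rewrite exprn_ge0// invr_ge0 ltW.
by apply: H; exact: cabs_circle_pt.
Qed.

(* The circle of centre w + t (0 - w) and radius t * rho is approximated by the
   polygon with vertices [node t j]: for t = 0 it is the point w, for t = 1 it
   consists of the points circle_pt j. The weighted mean of G over the vertices
   hardly depends on t, because the increments of G along a closed polygon add
   up to 0. *)
Let node w (t : R) (j : nat) : C := w + t%:C%C * (circle_pt j - w).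

Variables (G g : C -> C) (e d : R).
Hypothesis e0 : 0 < e.
Hypothesis G_uniform : forall z1 z2, cabs z1 <= rho -> cabs (z2 - z1) < d ->
  cabs (G z1 - G z2 - g z1 * (z1 - z2)) <= e * cabs (z1 - z2).
Hypothesis small_mesh : rho * cabs (w0 - 1) < d.
Hypothesis n_gt1 : (1 < n)%N.

Let w0_neq1 : w0 != 1.
Proof.
apply: contraTneq n_gt1 => w1; rewrite -leqNgt.
have := prim_expr_order w0_prim; rewrite w1.
have := eq_prim_root_expr w0_prim 1 0; rewrite w1 !expr1n eqxx => /esym.
by rewrite mod0n -/(dvdn n 1) dvdn1 => /eqP ->.
Qed.

Let cabs_node w t j : cabs w <= rho -> 0 <= t <= 1 -> cabs (node w t j) <= rho.
Proof.
move=> hw /andP[t0 t1]; rewrite /node.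
have -> : w + t%:C%C * (circle_pt j - w) = (1 - t)%:C%C * w + t%:C%C * circle_pt j.
  by rewrite rmorphB rmorph1; ring.
rewrite (le_trans (cabsD _ _))// 2!cabsM !cabs_real cabs_circle_pt !ger0_norm ?subr_ge0//.
have := ler_wpM2l (_ : 0 <= 1 - t) hw; rewrite subr_ge0 => /(_ t1); lra.
Qed.

(** The sides of the polygon are [t * (w0 - 1) * circle_pt j], so up to this common factor the sum
    is a Riemann sum of [g] along a closed polygon. It differs from a vanishing sum of increments of
    [G] by at most [e] times the perimeter; dividing the factor out leaves a bound independent of
    [t]. *)
Let closed_sum w t : cabs w <= rho -> 0 < t <= 1 ->
  cabs (\sum_(j < n) g (node w t j) * circle_pt j) <= n%:R * (e * rho).
Proof.
move=> hw /andP[t0 t1]; have t01 : 0 <= t <= 1 by rewrite ltW.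
have w1 : 0 < cabs (w0 - 1) by rewrite cabs_gt0 subr_eq0.
have nodeB j : node w t j.+1 - node w t j = t%:C%C * (w0 - 1) * circle_pt j.
  by rewrite /node /circle_pt exprS; ring.
have cB j : cabs (node w t j.+1 - node w t j) = t * cabs (w0 - 1) * rho.
  by rewrite nodeB 2!cabsM cabs_real gtr0_norm// cabs_circle_pt.
have E : t%:C%C * (w0 - 1) * \sum_(j < n) g (node w t j) * circle_pt j =
  \sum_(j < n) (G (node w t j) - G (node w t j.+1)
                - g (node w t j) * (node w t j - node w t j.+1)).
  rewrite sumrB -(big_mkord xpredT (fun j => G (node w t j) - G (node w t j.+1))).
  under [X in _ = X - _]eq_bigr do rewrite -opprB.
  have En : node w t n = node w t 0 by rewrite /node /circle_pt (prim_expr_order w0_prim).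
  rewrite sumrN telescope_sumr// En.
  rewrite subrr oppr0 sub0r mulr_sumr -sumrN; apply: eq_bigr => j _.
  by rewrite -mulrN opprB -/(node w t j) -/(node w t j.+1) nodeB; ring.
have : cabs (t%:C%C * (w0 - 1) * \sum_(j < n) g (node w t j) * circle_pt j) <=
   n%:R * (e * (t * cabs (w0 - 1) * rho)).
  rewrite E (le_trans (cabs_sum _ _ _))//.
  have H (j : 'I_n) : true -> cabs (G (node w t j) - G (node w t j.+1)
     - g (node w t j) * (node w t j - node w t j.+1)) <= e * (t * cabs (w0 - 1) * rho).
    move=> _; rewrite -(cB j) [X in _ <= _ * X]cabsB.
    apply: G_uniform; first exact: cabs_node.
    rewrite cB (le_lt_trans _ small_mesh)// mulrC ler_pM2l//.
    by rewrite ler_piMl// ltW.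
  by rewrite (le_trans (ler_sum _ H))// sumr_const card_ord -[leLHS]mulr_natl.
rewrite 2!cabsM cabs_real gtr0_norm//.
rewrite [leRHS](_ : _ = t * cabs (w0 - 1) * (n%:R * (e * rho))); last by ring.
by rewrite ler_pM2l// mulr_gt0.
Qed.

(** The weighted mean [phi] is moved from [t = 0] to [t = 1] in [L] steps of length [h = 1 / L],
    each changing it by at most [4 * (e * rho) * h], so that the total does not depend on [L]. *)
Lemma interp_approx w : 0 < d -> cabs w <= rho -> cabs (interp G w - G w) <= 4 * (e * rho).
Proof.
move=> d0 hw.
have rd : 0 < 2 * rho / d by rewrite divr_gt0// mulr_gt0.
(* A node moves by [h * |circle_pt j - w| <= 2 * rho / L] in one step; this has to stay below
   [d]. *)
pose L := (Num.truncn (2 * rho / d)).+1.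
have L0 : 0 < L%:R :> R by rewrite ltr0n.
have hL : 2 * rho / L%:R < d.
  by rewrite ltr_pdivrMr// [ltRHS]mulrC -ltr_pdivrMr// truncnS_gt.
pose h : R := L%:R^-1.
have h0 : 0 < h by rewrite invr_gt0.
pose q := 1 - w ^+ n / rho%:C%C ^+ n.
have q2 : cabs q <= 2.
  rewrite (le_trans (cabsBD _ _))// cabs1 cabsM cabsV !cabsX cabs_real gtr0_norm//.
  have : (cabs w / rho) ^+ n <= 1.
    by rewrite exprn_ile1// ?divr_ge0 ?cabs_ge0 ?(ltW rho0)// ler_pdivrMr// mul1r.
  rewrite expr_div_n; lra.
pose phi (l : nat) := n%:R^-1 * \sum_(j < n) G (node w (l%:R * h) j) * kernel w j.
have step l : (l < L)%N -> cabs (phi l.+1 - phi l) <= 4 * (e * rho) * h.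
  move=> lL; set t := l.+1%:R * h.
  have t01 : 0 < t <= 1.
    by rewrite mulr_gt0 ?ltr0n//= ler_pdivrMr// mul1r ler_nat.
  have t01' : 0 <= t <= 1 by case/andP: t01 => /ltW ->.
  have Et j : node w (l%:R * h) j = node w t j - h%:C%C * (circle_pt j - w).
    by rewrite /node /t -natr1 mulrDl mul1r rmorphD; ring.
  pose err j := G (node w t j) - G (node w (l%:R * h) j)
                - g (node w t j) * (node w t j - node w (l%:R * h) j).
  have Herr j : cabs (err j) <= e * (h * cabs (circle_pt j - w)).
    have Ed : cabs (node w (l%:R * h) j - node w t j) = h * cabs (circle_pt j - w).
      by rewrite Et addrAC subrr sub0r cabsN cabsM cabs_real gtr0_norm.
    rewrite -Ed [X in _ <= e * X]cabsB; apply: G_uniform; first exact: cabs_node.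
    rewrite Ed (le_lt_trans _ hL)// mulrC ler_wpM2r ?(ltW h0)//.
    by rewrite (le_trans (cabsBD _ _))// cabs_circle_pt; lra.
  (* Errors of linearization, plus the linear part. In both, [kernelE] trades the factor
     [circle_pt j - w] for [circle_pt j * q]: it tames the kernel when [w] is close to the circle,
     and turns the linear part into the sum of [closed_sum]. As [|q| <= 2], each contributes
     [2 * (e * rho) * h]. *)
  have -> : phi l.+1 - phi l =
     n%:R^-1 * (\sum_(j < n) err j * kernel w j) +
     n%:R^-1 * (h%:C%C * q * \sum_(j < n) g (node w t j) * circle_pt j).
    rewrite /phi -mulrBr -mulrDr; congr (_ * _); rewrite mulr_sumr -sumrB -big_split/=.
    apply: eq_bigr => j _; rewrite /err -/t.
    rewrite [X in g _ * X](_ : _ = h%:C%C * (circle_pt j - w)); last by rewrite Et; ring.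
    have := kernelE w j; rewrite -/q => Ek.
    have -> : h%:C%C * q * (g (node w t j) * circle_pt j) =
      h%:C%C * g (node w t j) * (circle_pt j * q) by ring.
    by rewrite -Ek; ring.
  rewrite (le_trans (cabsD _ _))//.
  rewrite [leRHS](_ : _ = 2 * (e * rho) * h + 2 * (e * rho) * h); last by ring.
  apply: lerD.
    apply: (@cabs_mean (fun j => err j * kernel w j)) => j _; rewrite cabsM.
    rewrite (le_trans (ler_wpM2r (cabs_ge0 _) (Herr j)))//.
    rewrite -!mulrA -cabsM kernelE -/q cabsM cabs_circle_pt.
    rewrite [leRHS](_ : _ = e * (h * (rho * 2))); last by ring.
    by rewrite !ler_pM2l.
  have nR : 0 < n%:R :> R by rewrite ltr0n.
  rewrite cabsM cabsV cabs_nat ler_pdivrMl// !cabsM cabs_real gtr0_norm//.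
  rewrite [leRHS](_ : _ = (h * 2) * (n%:R * (e * rho))); last by ring.
  rewrite ler_pM ?cabs_ge0// ?closed_sum//.
    by rewrite mulr_ge0 ?cabs_ge0// ltW.
  by rewrite ler_pM2l.
have phiL : phi L = interp G w.
  rewrite /phi /interp /h divff ?gt_eqF//; congr (_ * _); apply: eq_bigr => j _.
  by rewrite /node rmorph1 mul1r addrC subrK.
have phi0 : phi 0%N = G w.
  rewrite /phi mul0r.
  under eq_bigr do rewrite /node rmorph0 mul0r addr0.
  by rewrite -mulr_sumr sum_kernel mulrCA mulVf ?mulr1.
rewrite -phiL -phi0 -(telescope_sumr phi)//.
rewrite big_mkord (le_trans (cabs_sum _ _ _))//.
apply: (@le_trans _ _ (\sum_(i < L) 4 * (e * rho) * h)).
  by apply: ler_sum => i _; exact: step.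
by rewrite sumr_const card_ord -[leLHS]mulr_natl mulrCA divff ?mulr1// gt_eqF.
Qed.

End DiscreteCauchy.

(** * Taylor expansion *)

Section Taylor.
Variable R : realType.
Local Notation C := R[i].

Lemma real_cauchy_limit (u : nat -> R) :
  (forall e, 0 < e -> exists N, forall m n, (N <= m)%N -> (N <= n)%N -> `|u m - u n| < e) ->
  exists l, forall e, 0 < e -> exists N, forall n, (N <= n)%N -> `|u n - l| < e.
Proof.
move=> H; have : cvg (u @ \oo).
  apply/cauchy_cvgP/cauchy_exP => e /H[N HN]; exists (u N); exists N => // n /= Nn.
  by rewrite -ball_normE /ball_ /=; exact: HN.
move=> /cvg_ex[l /cvgrPdist_lt cl]; exists l => e /cl[N _ HN]; exists N => n Nn.
by rewrite distrC; exact: HN.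
Qed.

Lemma cauchy_limit (u : nat -> C) :
  (forall e : R, 0 < e -> exists N, forall m n, (N <= m)%N -> (N <= n)%N -> cabs (u m - u n) < e) ->
  exists l, forall e : R, 0 < e -> exists N, forall n, (N <= n)%N -> cabs (u n - l) < e.
Proof.
move=> H.
have [a Ha] : exists l, forall e, 0 < e -> exists N, forall n, (N <= n)%N -> `|complex.Re (u n) - l| < e.
  apply: real_cauchy_limit => e /H[N HN]; exists N => m n Nm Nn.
  by rewrite -raddfB (le_lt_trans (ler_Re_cabs _))// HN.
have [b Hb] : exists l, forall e, 0 < e -> exists N, forall n, (N <= n)%N -> `|complex.Im (u n) - l| < e.
  apply: real_cauchy_limit => e /H[N HN]; exists N => m n Nm Nn.
  by rewrite -raddfB (le_lt_trans (ler_Im_cabs _))// HN.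
exists (Complex a b) => e e0; have e2 : 0 < e / 2 by rewrite divr_gt0.
have [N HN] := Ha _ e2; have [M HM] := Hb _ e2.
exists (maxn N M) => n; rewrite geq_max => /andP[/HN h1 /HM h2].
rewrite (le_lt_trans (cabs_le_ReIm _))// !raddfB /=; lra.
Qed.

Lemma sum_geometric_le (x : R) L N : 0 <= x <= 1 / 2 ->
  \sum_(L <= n < N) x ^+ n <= 2 * x ^+ L.
Proof.
move=> /andP[x0 x1].
have [LN|NL] := leqP L N; last by rewrite big_geq ?mulr_ge0 ?exprn_ge0// ltnW.
have xN n : 0 <= x ^+ n by rewrite exprn_ge0.
suff : (1 - x) * \sum_(L <= n < N) x ^+ n <= x ^+ L.
  set S := \sum_(_ <= _ < _) _ => h.
  have : 1 / 2 * S <= (1 - x) * S by rewrite ler_wpM2r ?sumr_ge0//; lra.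
  lra.
rewrite mulr_sumr.
under eq_bigr do rewrite mulrBl mul1r -exprS.
rewrite (eq_bigr (fun i => - x ^+ i.+1 - - x ^+ i)) => [|i _]; last by rewrite opprK addrC.
by rewrite (telescope_sumr (fun i => - x ^+ i))//; have := xN N; lra.
Qed.

(** The interpolating polynomials converge uniformly to [G] on the disc of radius [r]; Cauchy's
    estimate makes their coefficients converge and bounds them by [M / r ^ i]. Then [2 * M] bounds
    the tail, a geometric sum of ratio at most 1/2. The radius [3 * r] leaves the margin asked for
    by [sdiff_uniform]. *)
Lemma taylor (G g : C -> C) (r M : R) : 0 < r ->
  (forall z, cabs z < 3 * r -> sdiff G z (g z)) ->
  (forall z, cabs z <= r -> cabs (G z) <= M) ->
  exists a : nat -> C, forall w, cabs w <= r / 2 ->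
    forall L, cabs (G w - \sum_(n < L) a n * w ^+ n) <= 2 * M * (cabs w / r) ^+ L.
Proof.
move=> r0 HG HM.
have r3 : 2 * r < 3 * r by lra.
have approx e : 0 < e -> exists n0, forall n, (n0 <= n)%N -> (1 < n)%N /\
    forall w, cabs w <= r -> cabs (interp r n (zeta R n) G w - G w) <= e.
  move=> e0; have er : 0 < e / (4 * r) by rewrite divr_gt0// mulr_gt0.
  have [d d0 Hd] := sdiff_uniform r0 r3 HG er.
  have dr : 0 < d / r by rewrite divr_gt0.
  have [n0 Hn0] := zeta_near1 dr.
  exists (maxn 2 n0) => n; rewrite geq_max => /andP[n2 nn0]; split => // w wr.
  have n_gt0 : (0 < n)%N by apply: leq_trans n2.
  have -> : e = 4 * (e / (4 * r) * r) by field; rewrite gt_eqF.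
  apply: (@interp_approx _ _ r0 _ _ (zeta_prim R n_gt0) (cabs_zeta R n) G g _ d er Hd) => //.
  by rewrite mulrC -ltr_pdivlMr// Hn0.
(* Coefficients are padded with zeros so that polynomials of different degrees can be subtracted. *)
pose A n i := if (i < n)%N then interp_coef r n (zeta R n) G i else 0.
have interpA n : interp r n (zeta R n) G =1 fun w => \sum_(i < n) A n i * w ^+ i.
  by move=> w; rewrite interpE; apply: eq_bigr => i _; rewrite /A ltn_ord.
have M0 : 0 <= M by rewrite (le_trans (cabs_ge0 (G 0)))// HM// cabs0 ltW.
have AM n i : (0 < n)%N -> cabs (A n i) <= M * r^-1 ^+ i.
  move=> n0; rewrite /A; case: ifP => _.
    apply: (interp_coef_bound r0 (zeta_prim R n0) (cabs_zeta R n)) => z zr.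
    by apply: HM; rewrite zr.
  by rewrite cabs0 mulr_ge0 ?exprn_ge0// invr_ge0 ltW.
have Acauchy i e : 0 < e -> exists N, forall m n, (N <= m)%N -> (N <= n)%N ->
    cabs (A m i - A n i) < e.
  move=> e0; have ri : 0 < r ^+ i by rewrite exprn_gt0.
  have e3 : 0 < e * r ^+ i / 3 by rewrite !divr_gt0// mulr_gt0.
  have [n0 Hn0] := approx _ e3; exists (maxn i.+1 n0) => m n.
  rewrite !geq_max => /andP[im /Hn0[m1 Hm]] /andP[i_n /Hn0[n1 Hn]].
  have mn0 : (0 < maxn m n)%N by rewrite leq_max (ltn_trans _ m1).
  have wide k w : (k <= maxn m n)%N ->
      \sum_(j < k) A k j * w ^+ j = \sum_(j < maxn m n) A k j * w ^+ j.
    move=> kmn; rewrite (big_ord_widen _ (fun j => A k j * w ^+ j) kmn).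
    rewrite [RHS](bigID (fun j : 'I__ => (j < k)%N))/= [X in _ = _ + X]big1 ?addr0// => j /negPf jk.
    by rewrite /A jk mul0r.
  have : cabs (A m i - A n i) <= (e * r ^+ i / 3 + e * r ^+ i / 3) * r^-1 ^+ i.
    (* Both polynomials are close to [G] on the circle, hence to each other; the estimate is taken
       with [maxn m n] vertices, enough for the larger degree. *)
    apply: (@coef_bound _ _ r0 _ _ (zeta_prim R mn0) (cabs_zeta R _) (fun j => A m j - A n j)).
      by rewrite leq_max im.
    move=> w wr; under eq_bigr do rewrite mulrBl.
    rewrite sumrB -!wide ?leq_maxl ?leq_maxr// -!interpA.
    have wr' : cabs w <= r by rewrite wr.
    have := Hm _ wr'; have := Hn _ wr'.
    set x := interp _ _ _ _ _; set y := interp _ _ _ _ _ => hx hy.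
    have -> : y - x = (y - G w) - (x - G w) by ring.
    by rewrite (le_trans (cabsBD _ _))// lerD.
  move=> /le_lt_trans; apply; rewrite exprVn ltr_pdivrMr//.
  have : 0 < e * r ^+ i by rewrite mulr_gt0.
  lra.
pose a i := projT1 (cid (cauchy_limit (Acauchy i))).
have Aa i e : 0 < e -> exists N, forall n, (N <= n)%N -> cabs (A n i - a i) < e.
  by rewrite /a; case: cid => l /= Hl; exact: Hl.
exists a => w wr L.
have x01 : 0 <= cabs w / r <= 1 / 2.
  by rewrite divr_ge0 ?cabs_ge0 ?(ltW r0)//= ler_pdivrMr// mulrC mulrA mulr1.
have wr1 : cabs w <= r by lra.
apply/ler_addgt0Pr => e e0.
have e2 : 0 < e / 2 by rewrite divr_gt0.
have [n1 Hn1] := approx _ e2.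
have [n2 Hn2] : exists N, forall n, (N <= n)%N ->
    cabs (\sum_(i < L) (A n i - a i) * w ^+ i) <= e / 2.
  have : exists N, forall n, (N <= n)%N -> forall i, (i < L)%N ->
      cabs ((A n i - a i) * w ^+ i) <= e / 2 / L.+1%:R.
    elim: {1}L => [|l [N HN]]; first by exists 0%N.
    have Wl : 0 < cabs w ^+ l + 1 by rewrite ltr_wpDl// exprn_ge0// cabs_ge0.
    have el : 0 < e / 2 / L.+1%:R / (cabs w ^+ l + 1) by rewrite !divr_gt0// ltr0n.
    have [N' HN'] := Aa l _ el.
    exists (maxn N N') => n; rewrite geq_max => /andP[nN nN'] i.
    rewrite ltnS leq_eqVlt => /orP[/eqP ->|]; last exact: HN.
    have := HN' _ nN'; rewrite ltr_pdivlMr// => h; rewrite cabsM cabsX.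
    by apply/ltW/(le_lt_trans _ h); rewrite mulrDr mulr1 lerDl cabs_ge0.
  move=> [N HN]; exists N => n /HN Hn.
  rewrite (le_trans (cabs_sum _ _ _))//.
  apply: (@le_trans _ _ (\sum_(i < L) e / 2 / L.+1%:R)); first by apply: ler_sum => i _; exact: Hn.
  rewrite sumr_const card_ord -[leLHS]mulr_natr -mulrA ler_piMr ?(ltW e2)//.
  by rewrite mulrC ler_pdivrMr ?ltr0n// mul1r ler_nat.
pose n := maxn (maxn n1 n2) L.
have [n_gt1 Hn] := Hn1 n (leq_trans (leq_maxl _ _) (leq_maxl _ _)).
have := Hn2 n (leq_trans (leq_maxr _ _) (leq_maxl _ _)).
have := Hn _ wr1; rewrite interpA.
have Ln : (L <= n)%N by exact: leq_maxr.
have -> : \sum_(i < n) A n i * w ^+ i =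
    \sum_(i < L) A n i * w ^+ i + \sum_(L <= i < n) A n i * w ^+ i.
  by rewrite -!(big_mkord xpredT (fun i => A n i * w ^+ i)) (@big_cat_nat _ _ _ L 0 n).
have : cabs (\sum_(L <= i < n) A n i * w ^+ i) <= 2 * M * (cabs w / r) ^+ L.
  rewrite (le_trans (cabs_sum _ _ _))//.
  apply: (@le_trans _ _ (\sum_(L <= i < n) M * (cabs w / r) ^+ i)).
    apply: ler_sum => i _; rewrite cabsM cabsX exprMn mulrCA mulrA [leRHS]mulrC mulrA mulrC.
    rewrite [leRHS](_ : _ = cabs w ^+ i * (M * r^-1 ^+ i)); last by ring.
    rewrite mulrC ler_wpM2l ?exprn_ge0 ?cabs_ge0// AM// (ltn_trans _ n_gt1)//.
  rewrite -mulr_sumr [2 * M]mulrC -mulrA ler_wpM2l//.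
  exact: sum_geometric_le.
under [X in _ -> _ -> cabs X <= _ -> _]eq_bigr do rewrite mulrBl.
rewrite sumrB.
set S1 := \sum_(L <= _ < _) _; set S2 := \sum_(_ < _) A _ _ * _; set S3 := \sum_(_ < _) _.
move=> h1 h2 h3.
(* Tail of the interpolating polynomial, its distance from [G], and the distance of its first [L]
   coefficients from their limits; the last two together are at most [e]. *)
have -> : G w - S3 = S1 - (S2 + S1 - G w) + (S2 - S3) by ring.
have := cabsD (S1 - (S2 + S1 - G w)) (S2 - S3).
have := cabsBD S1 (S2 + S1 - G w); lra.
Qed.

End Taylor.

(** * Removable singularities, Laurent expansion and order *)

Section Laurent.
Variable R : realType.
Local Notation C := R[i].

(** The quadratic bound handles increments from 0, but strictness also compares two points near 0;
    for these a Lipschitz constant of order [|z1| + |z2|] is established, which tends to 0. *)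
Lemma sdiff_removable (H : C -> C) (r K : R) : 0 < r ->
  (forall z, z != 0 -> cabs z < r -> exists d, sdiff H z d) ->
  (forall z, cabs z < r -> cabs (H z) <= K * cabs z ^+ 2) -> sdiff H 0 0.
Proof.
move=> r0 hd hb e e0.
have K0 : 0 <= K.
  have := hb (r / 2)%:C%C; rewrite cabs_real gtr0_norm ?divr_gt0// => /(_ ltac:(lra)).
  move=> /(le_trans (cabs_ge0 _)); rewrite pmulr_lge0// exprn_gt0// divr_gt0//.
(* near z1 on the scale of |z1| by Taylor's formula, else trivially *)
suff [K' K'0 HK] : exists2 K' : R, 0 < K' & forall z1 z2, cabs z1 < r / 2 -> cabs z2 < r / 2 ->
    cabs (H z1 - H z2) <= K' * (cabs z1 + cabs z2) * cabs (z1 - z2).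
  exists (Num.min (r / 2) (e / (2 * K'))).
    by rewrite lt_min !divr_gt0// mulr_gt0.
  move=> z1 z2; rewrite !subr0 !lt_min => /andP[a1 a2] /andP[b1 b2].
  rewrite mul0r subr0 (le_trans (HK _ _ a1 b1))// ler_wpM2r ?cabs_ge0//.
  move: a2 b2; rewrite !ltr_pdivlMr ?mulr_gt0//; lra.
have main z1 z2 : cabs z1 < r / 2 -> z1 != 0 -> 8 * cabs (z1 - z2) < cabs z1 ->
    cabs (H z1 - H z2) <= 32 * K * cabs z1 * cabs (z1 - z2).
  move=> z1r z10 z12; have c1 : 0 < cabs z1 by rewrite cabs_gt0.
  (* The disc of radius [3 * s] about [z1] misses 0 and stays within [r], and the factor 8 in the
     hypothesis puts [z2] within [s / 2] of [z1], as [taylor] requires. With [L = 1] it bounds the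
     increment by [2 * (4 * K * |z1| ^ 2) / s] times [|z1 - z2|], hence the constant 32. *)
  pose s := cabs z1 / 4; have s0 : 0 < s by rewrite divr_gt0.
  have h3 w : cabs w < 3 * s -> z1 + w != 0 /\ cabs (z1 + w) < r.
    rewrite /s => hw; have := cabsD z1 w; split; last by lra.
    rewrite -cabs_gt0; have := cabs_sub_ge z1 (- w); rewrite cabsN opprK; lra.
  have /choice[g Hg] : forall w, exists gw, cabs w < 3 * s -> sdiff (fun x => H (z1 + x)) w gw.
    move=> w.
    have [hw|_] := ltP (cabs w) (3 * s); last by exists 0.
    by have [w1 /(hd _ w1)[d dd]] := h3 _ hw; exists d => _; exact: sdiff_shift.
  have hM w : cabs w <= s -> cabs (H (z1 + w)) <= K * (4 * cabs z1 ^+ 2).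
    move=> ws; have [_ hr] := h3 w ltac:(lra).
    rewrite (le_trans (hb _ hr))// ler_wpM2l// (_ : 4 * _ = (2 * cabs z1) ^+ 2); last by ring.
    rewrite ler_pXn2r ?nnegrE ?cabs_ge0 ?mulr_ge0 ?cabs_ge0//.
    have := cabsD z1 w; rewrite /s in ws; lra.
  have [a Ha] := taylor s0 Hg hM.
  have ws : cabs (z2 - z1) <= s / 2 by rewrite cabsB /s; lra.
  have h0 := Ha 0 ltac:(rewrite cabs0; lra) 1%N.
  have h1 := Ha _ ws 1%N.
  move: h0 h1; rewrite !big_ord1 !expr0 !expr1 !mulr1 cabs0 mul0r mulr0 addr0 subrKC.
  move=> h0; have /eqP : cabs (H z1 - a 0%N) = 0.
    by apply/eqP; rewrite eq_le cabs_ge0 andbT.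
  rewrite cabs_eq0 subr_eq0 => /eqP <-; rewrite cabsB [cabs (z2 - _)]cabsB => /le_trans; apply.
  by rewrite /s le_eqVlt; apply/orP; left; apply/eqP; field; rewrite gt_eqF.
have triv z1 z2 : cabs z1 < r / 2 -> cabs z2 < r / 2 -> cabs z1 <= 8 * cabs (z1 - z2) ->
    cabs z2 <= 8 * cabs (z1 - z2) ->
    cabs (H z1 - H z2) <= 8 * K * (cabs z1 + cabs z2) * cabs (z1 - z2).
  move=> z1r z2r h1 h2; rewrite (le_trans (cabsBD _ _))//.
  have := hb z1 ltac:(have := cabs_ge0 z1; lra); have := hb z2 ltac:(have := cabs_ge0 z2; lra).
  have q z : cabs z <= 8 * cabs (z1 - z2) -> K * cabs z ^+ 2 <= K * (cabs z * (8 * cabs (z1 - z2))).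
    by move=> h; rewrite ler_wpM2l// expr2 ler_wpM2l// cabs_ge0.
  have := q _ h1; have := q _ h2; lra.
exists (32 * K + 1) => [|z1 z2 z1r z2r]; first by lra.
have P0 : 0 <= cabs (z1 - z2) := cabs_ge0 _.
have P1 : 0 <= cabs z1 := cabs_ge0 _.
have P2 : 0 <= cabs z2 := cabs_ge0 _.
have Q1 : 0 <= cabs z1 * cabs (z1 - z2) by rewrite mulr_ge0.
have Q2 : 0 <= cabs z2 * cabs (z1 - z2) by rewrite mulr_ge0.
have Q3 : 0 <= K * (cabs z1 * cabs (z1 - z2)) by rewrite mulr_ge0.
have Q4 : 0 <= K * (cabs z2 * cabs (z1 - z2)) by rewrite mulr_ge0.
have [l1|g1] := ltP (8 * cabs (z1 - z2)) (cabs z1).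
  have := main _ _ z1r _ l1; rewrite -cabs_gt0 (le_lt_trans _ l1) ?mulr_ge0// => /(_ isT).
  lra.
have [l2|g2] := ltP (8 * cabs (z1 - z2)) (cabs z2).
  have := main _ z1 z2r; rewrite [cabs (z2 - _)]cabsB => /(_ _ l2).
  rewrite -cabs_gt0 (le_lt_trans _ l2) ?mulr_ge0// => /(_ isT).
  rewrite cabsB; lra.
have := triv _ _ z1r z2r g1 g2; lra.
Qed.

(** Two powers more than [m] make the product quadratically small at 0, which is the hypothesis of
    [sdiff_removable]; the extended function then has a Taylor expansion. Here [2 * s = r / 3] is
    the Taylor radius. *)
Lemma laurent (f : C -> C) (m : nat) (r K : R) : 0 < r ->
  (forall z, z != 0 -> cabs z < r -> exists d, sdiff f z d) ->
  (forall z, z != 0 -> cabs z < r -> cabs z ^+ m * cabs (f z) <= K) ->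
  exists (a : nat -> C) (s B : R), [/\ 0 < s, 0 <= B &
    forall z, z != 0 -> cabs z <= s -> forall L,
      cabs (z ^+ m.+2 * f z - \sum_(n < L) a n * z ^+ n) <= B * (cabs z / (2 * s)) ^+ L].
Proof.
move=> r0 hd hb.
pose H z := if z == 0 then 0 else z ^+ m.+2 * f z.
have H1 z : z != 0 -> cabs z < r -> exists d, sdiff H z d.
  move=> z0 zr; have [d hfd] := hd _ z0 zr; have [d' hp] := @sdiff_pow _ z m.+2.
  have cz : 0 < cabs z by rewrite cabs_gt0.
  eexists; apply: (@sdiff_eq_near _ (fun z => z ^+ m.+2 * f z) _ _ _ (cabs z) cz) (sdiffM hp hfd).
  move=> w wz; rewrite /H ifN//; apply: contraTneq wz => ->.
  by rewrite sub0r cabsN ltxx.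
have H2 z : cabs z < r -> cabs (H z) <= K * cabs z ^+ 2.
  rewrite /H; case: eqVneq => [->|z0] zr; first by rewrite cabs0 expr0n mulr0.
  rewrite cabsM cabsX (_ : m.+2 = 2 + m)%N// exprD -mulrA mulrC ler_wpM2r ?exprn_ge0 ?cabs_ge0//.
  exact: hb.
have H0 := sdiff_removable r0 H1 H2.
have /choice[g Hg] : forall w, exists gw, cabs w < r -> sdiff H w gw.
  move=> w.
  have [->|w0] := eqVneq w 0; first by exists 0.
  by have [hw|_] := ltP (cabs w) r; [have [d] := H1 _ w0 hw; exists d|exists 0].
have r3 : 0 < r / 3 by rewrite divr_gt0.
have r33 : 3 * (r / 3) = r by field.
have K0 : 0 <= K.
  have := hb (r / 2)%:C%C; rewrite cabs_real gtr0_norm ?divr_gt0// eq_complex /= eqxx andbT.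
  rewrite gt_eqF ?divr_gt0// => /(_ isT) /(_ ltac:(lra)); apply: le_trans.
  by rewrite mulr_ge0 ?cabs_ge0// exprn_ge0// divr_ge0// ltW.
have hM z : cabs z <= r / 3 -> cabs (H z) <= K * (r / 3) ^+ 2.
  move=> hz; rewrite (le_trans (H2 _ _))//; first by lra.
  by rewrite ler_wpM2l// ler_pXn2r ?nnegrE ?cabs_ge0// ltW.
rewrite -r33 in Hg; have [a Ha] := taylor r3 Hg hM.
exists a, (r / 3 / 2), (2 * (K * (r / 3) ^+ 2)); split.
- by rewrite divr_gt0.
- by rewrite mulr_ge0// mulr_ge0// exprn_ge0// ltW.
move=> z z0 hz L; have := Ha z hz L; rewrite /H ifN//.
by rewrite [2 * (r / 3 / 2)]mulrC divfK.
Qed.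

(** If all coefficients vanish, the remainder bound tends to 0 as [L] grows. Otherwise the first
    nonzero term dominates the remainder of the next order near 0, and the bound passes to [f]
    because [|z| ^ (m + 2) <= 1]. *)
Lemma order_dichotomy (f : C -> C) (m : nat) (r K : R) : 0 < r ->
  (forall z, z != 0 -> cabs z < r -> exists d, sdiff f z d) ->
  (forall z, z != 0 -> cabs z < r -> cabs z ^+ m * cabs (f z) <= K) ->
  (exists2 s : R, 0 < s & forall z, z != 0 -> cabs z < s -> f z = 0) \/
  (exists (s c : R) (n : nat), [/\ 0 < s, 0 < c &
     forall z, z != 0 -> cabs z < s -> c * cabs z ^+ n <= cabs (f z)]).
Proof.
move=> r0 hd hb; have [a [s [B [s0 B0 Ha]]]] := laurent r0 hd hb.
have [a0|/existsNP[n0 /eqP an0]] := pselect (forall n, a n = 0).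
  left; exists s => // z z0 zs.
  have zm : z ^+ m.+2 != 0 by rewrite expf_neq0.
  apply: (mulfI zm); apply/eqP; rewrite mulr0 -cabs_eq0 eq_le cabs_ge0 andbT.
  apply/ler_addgt0Pr => e e0; rewrite add0r.
  have x01 : `|cabs z / (2 * s)| < 1.
    rewrite ger0_norm ?divr_ge0 ?cabs_ge0 ?mulr_ge0 ?(ltW s0)//.
    by rewrite ltr_pdivrMr ?mulr_gt0//; lra.
  have eB : 0 < e / (B + 1) by rewrite divr_gt0//; lra.
  have /cvgrPdist_lt /(_ _ eB) [L _ HL] := cvg_expr x01.
  have := HL L (leqnn L); rewrite /= sub0r normrN => h.
  have := Ha z z0 (ltW zs) L; rewrite big1 ?subr0 => [h2|n _]; last by rewrite a0 mul0r.
  apply: (le_trans h2); have := ler_norm ((cabs z / (2 * s)) ^+ L) => h3.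
  have h4 : (cabs z / (2 * s)) ^+ L <= e / (B + 1) by rewrite (le_trans h3)// ltW.
  rewrite (le_trans (ler_wpM2l B0 h4))// mulrC mulrAC ler_pdivrMr; last by lra.
  by rewrite mulrDr mulr1 lerDl ltW.
right.
have [n an0' nmin] : exists2 n, a n != 0 & forall i, (i < n)%N -> a i = 0.
  have ex : exists n, a n != 0 by exists n0.
  case: (ex_minnP ex) => n an hn; exists n => // i i_n.
  by apply/eqP; apply: contraLR i_n => /hn; rewrite -leqNgt.
have c0 : 0 < cabs (a n) by rewrite cabs_gt0.
pose D := B / (2 * s) ^+ n.+1 + 1.
have D0 : 0 < D by rewrite ltr_wpDl// divr_ge0// exprn_ge0// mulr_ge0// ltW.
exists (Num.min (Num.min s 1) (cabs (a n) / 2 / D)), (cabs (a n) / 2), n; split.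
- by rewrite !lt_min s0 ltr01 !divr_gt0.
- by rewrite divr_gt0.
move=> z z0; rewrite !lt_min => /andP[/andP[zs z1] zD].
have cz : 0 < cabs z by rewrite cabs_gt0.
have := Ha z z0 (ltW zs) n.+1; rewrite big_ord_recr big1 /= ?add0r => [|i _]; last first.
  by rewrite nmin ?mul0r.
have -> : B * (cabs z / (2 * s)) ^+ n.+1 = B / (2 * s) ^+ n.+1 * cabs z * cabs z ^+ n.
  by rewrite expr_div_n [cabs z ^+ n.+1]exprS; ring.
move: zD; rewrite ltr_pdivlMr// => zD.
have cn : 0 < cabs z ^+ n by rewrite exprn_gt0.
have h1 : B / (2 * s) ^+ n.+1 * cabs z <= cabs (a n) / 2.
  have : B / (2 * s) ^+ n.+1 * cabs z <= D * cabs z by rewrite ler_wpM2r ?ltW// /D ltrDl.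
  lra.
have := ler_wpM2r (ltW cn) h1.
have := cabs_sub_ge (a n * z ^+ n) (z ^+ m.+2 * f z).
rewrite cabsB cabsM [cabs (_ * f z)]cabsM !cabsX.
have : cabs z ^+ m.+2 * cabs (f z) <= cabs (f z).
  by rewrite ler_piMl ?cabs_ge0// exprn_ile1// ltW.
lra.
Qed.

End Laurent.

(** * Cayley-Dickson algebras and their complexification *)

Section CayleyDickson.
Variable R : realType.
Implicit Type k : nat.
Local Notation "x ** y" := (cd_mul x y) (at level 40, left associativity).

Lemma cd_pairP k (x y : CD R k.+1) : x.1 = y.1 -> x.2 = y.2 -> x = y.
Proof. by case: x y => [? ?] [? ?] /= -> ->. Qed.

Lemma cd_conjD k (x y : CD R k) : cd_conj (x + y) = cd_conj x + cd_conj y.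
Proof.
elim: k x y => [//|k IH] x y; apply: cd_pairP => /=; first exact: IH.
by rewrite -opprD.
Qed.

Lemma cd_conjZ k (r : R) (x : CD R k) : cd_conj (r *: x) = r *: cd_conj x.
Proof.
elim: k x => [//|k IH] x; apply: cd_pairP => /=; first exact: IH.
by rewrite scalerN.
Qed.

Lemma cd_conjN k (x : CD R k) : cd_conj (- x) = - cd_conj x.
Proof. by rewrite -scaleN1r cd_conjZ scaleN1r. Qed.

Lemma cd_conjB k (x y : CD R k) : cd_conj (x - y) = cd_conj x - cd_conj y.
Proof. by rewrite cd_conjD cd_conjN. Qed.

Lemma cd_conjK k (x : CD R k) : cd_conj (cd_conj x) = x.
Proof.
elim: k x => [//|k IH] x; apply: cd_pairP => /=; first exact: IH.
by rewrite opprK.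
Qed.

(** The doubling formula reverses the order of factors in some terms, so each side of the law at one
    level uses both sides at the level below; hence the conjunction. The same applies to [cd_mulZ]
    and [cd_mul1]. *)
Lemma cd_mulD k (x y z : CD R k) : (x + y) ** z = x ** z + y ** z /\ z ** (x + y) = z ** x + z ** y.
Proof.
elim: k x y z => [|k IH] x y z; first by split; [exact: mulrDl|exact: mulrDr].
have IHl u v w := (IH u v w).1; have IHr u v w := (IH u v w).2.
split; apply: cd_pairP => /=.
- by rewrite IHl IHr opprD addrACA.
- by rewrite IHr IHl addrACA.
- by rewrite cd_conjD IHl IHr opprD addrACA.
- by rewrite cd_conjD IHl IHr addrACA.
Qed.

Lemma cd_mulDl k (x y z : CD R k) : (x + y) ** z = x ** z + y ** z.
Proof. exact: (cd_mulD x y z).1. Qed.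

Lemma cd_mulDr k (x y z : CD R k) : z ** (x + y) = z ** x + z ** y.
Proof. exact: (cd_mulD x y z).2. Qed.

Lemma cd_mulZ k (r : R) (x y : CD R k) : (r *: x) ** y = r *: (x ** y) /\ x ** (r *: y) = r *: (x ** y).
Proof.
elim: k x y => [|k IH] x y.
  by split; [exact: esym (mulrA _ _ _)|exact: mulrCA].
have IHl u v := (IH u v).1; have IHr u v := (IH u v).2.
split; apply: cd_pairP => /=.
- by rewrite IHl IHr scalerBr.
- by rewrite IHl IHr scalerDr.
- by rewrite cd_conjZ IHl IHr scalerBr.
- by rewrite cd_conjZ IHl IHr scalerDr.
Qed.

Lemma cd_mulZl k (r : R) (x y : CD R k) : (r *: x) ** y = r *: (x ** y).
Proof. exact: (cd_mulZ r x y).1. Qed.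

Lemma cd_mulZr k (r : R) (x y : CD R k) : x ** (r *: y) = r *: (x ** y).
Proof. exact: (cd_mulZ r x y).2. Qed.

Lemma cd_mulNl k (x y : CD R k) : (- x) ** y = - (x ** y).
Proof. by rewrite -scaleN1r cd_mulZl scaleN1r. Qed.

Lemma cd_mulNr k (x y : CD R k) : x ** (- y) = - (x ** y).
Proof. by rewrite -scaleN1r cd_mulZr scaleN1r. Qed.

Lemma cd_mulBr k (x y z : CD R k) : z ** (x - y) = z ** x - z ** y.
Proof. by rewrite cd_mulDr cd_mulNr. Qed.

Lemma cd_mul0l k (x : CD R k) : 0 ** x = 0.
Proof. by rewrite -(scale0r x) cd_mulZl !scale0r. Qed.

Lemma cd_mul0r k (x : CD R k) : x ** 0 = 0.
Proof. by rewrite -[X in x ** X](scale0r x) cd_mulZr scale0r. Qed.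

Lemma cd_conj0 k : cd_conj (0 : CD R k) = 0.
Proof. by rewrite -(scale0r (0 : CD R k)) cd_conjZ !scale0r. Qed.

Lemma cd_conj1 k : cd_conj (cd_one R k) = cd_one R k.
Proof. by elim: k => [//|k IH]; apply: cd_pairP; rewrite /= ?IH ?oppr0. Qed.

Lemma cd_conjM k (x y : CD R k) : cd_conj (x ** y) = cd_conj y ** cd_conj x.
Proof.
elim: k x y => [|k IH] x y; first exact: mulrC.
apply: cd_pairP => /=.
  by rewrite cd_conjB !IH cd_conjK cd_conjN cd_mulNl cd_mulNr opprK.
by rewrite cd_conjK cd_mulNl cd_mulNl opprD addrC.
Qed.

Lemma cd_mul1 k (x : CD R k) : cd_one R k ** x = x /\ x ** cd_one R k = x.
Proof.
elim: k x => [|k IH] x; first by split; rewrite /cd_mul /= ?mul1r ?mulr1.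
have IHl u := (IH u).1; have IHr u := (IH u).2.
by split; apply: cd_pairP;
  rewrite /= ?cd_mul0l ?cd_mul0r ?cd_conj0 ?cd_mul0l ?cd_conj1 ?IHl ?IHr ?addr0 ?subr0 ?add0r.
Qed.

Lemma cd_mul1l k (x : CD R k) : cd_one R k ** x = x.
Proof. exact: (cd_mul1 x).1. Qed.

Lemma cd_mul1r k (x : CD R k) : x ** cd_one R k = x.
Proof. exact: (cd_mul1 x).2. Qed.

Lemma cd_one_neq0 k : cd_one R k != 0.
Proof.
elim: k => [|k IH]; first exact: oner_neq0.
by apply: contra IH => /eqP /(congr1 fst) /= ->.
Qed.

Lemma cd_coord1D k (x y : CD R k) : cd_coord1 (x + y) = cd_coord1 x + cd_coord1 y.
Proof. by elim: k x y => [//|k IH] x y; exact: IH. Qed.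

Lemma cd_coord1Z k (r : R) (x : CD R k) : cd_coord1 (r *: x) = r * cd_coord1 x.
Proof. by elim: k x => [//|k IH] x; exact: IH. Qed.

Lemma cd_coord1_one k : cd_coord1 (cd_one R k) = 1.
Proof. by elim: k => [//|k IH]; exact: IH. Qed.

Lemma cd_coord1_conj k (x : CD R k) : cd_coord1 (cd_conj x) = cd_coord1 x.
Proof. by elim: k x => [//|k IH] x; exact: IH. Qed.

Lemma cd_traceE k (x : CD R k) : cd_trace x = (2 * cd_coord1 x) *: cd_one R k.
Proof.
rewrite /cd_trace; elim: k x => [|k IH] x.
  by rewrite /= /GRing.scale /= mulr1 mulr_natl.
by apply: cd_pairP; rewrite /= ?subrr ?scaler0// IH.
Qed.

Lemma cd_reE k (x : CD R k) : cd_re x = cd_coord1 x.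
Proof. by rewrite /cd_re cd_traceE cd_coord1Z cd_coord1_one mulr1 mulrC mulKf. Qed.

Lemma cd_conjE k (x : CD R k) : cd_conj x = (2 * cd_coord1 x) *: cd_one R k - x.
Proof. by rewrite -cd_traceE /cd_trace addrC addKr. Qed.

Lemma cd_sumsq_conj k (x : CD R k) : cd_sumsq (cd_conj x) = cd_sumsq x.
Proof.
have sN j (y : CD R j) : cd_sumsq (- y) = cd_sumsq y.
  by elim: j y => [|j IH] y /=; [exact: sqrrN|rewrite !IH].
by elim: k x => [//|k IH] x /=; rewrite IH sN.
Qed.

Lemma cd_mul_conjr k (x : CD R k) : x ** cd_conj x = cd_sumsq x *: cd_one R k.
Proof.
elim: k x => [|k IH] x; first by rewrite /= /GRing.scale /= mulr1 expr2.
apply: cd_pairP => /=.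
  rewrite cd_conjN cd_mulNl opprK IH -{2}(cd_conjK x.2) IH cd_sumsq_conj.
  by rewrite scalerDl.
by rewrite cd_conjK cd_mulNl addNr scaler0.
Qed.

Lemma cd_mul_conjl k (x : CD R k) : cd_conj x ** x = cd_sumsq x *: cd_one R k.
Proof. by rewrite -{2}(cd_conjK x) cd_mul_conjr cd_sumsq_conj. Qed.

Lemma cd_sumsq_ge0 k (x : CD R k) : 0 <= cd_sumsq x.
Proof. by elim: k x => [|k IH] x /=; [exact: sqr_ge0|rewrite addr_ge0]. Qed.

Lemma cd_sumsq_eq0 k (x : CD R k) : (cd_sumsq x == 0) = (x == 0).
Proof.
elim: k x => [|k IH] x /=; first by rewrite sqrf_eq0.
by rewrite paddr_eq0 ?cd_sumsq_ge0// !IH -xpair_eqE; case: x.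
Qed.

Lemma cd_sumsqZ k (r : R) (x : CD R k) : cd_sumsq (r *: x) = r ^+ 2 * cd_sumsq x.
Proof.
elim: k x => [|k IH] x /=; first by rewrite /GRing.scale /= exprMn.
by rewrite !IH mulrDr.
Qed.

Lemma cd_sumsqN k (x : CD R k) : cd_sumsq (- x) = cd_sumsq x.
Proof. by rewrite -scaleN1r cd_sumsqZ sqrrN expr1n mul1r. Qed.

Lemma cd_sumsq_one k : cd_sumsq (cd_one R k) = 1.
Proof.
elim: k => [|k IH] /=; first by rewrite expr1n.
by rewrite IH -[0](scale0r 0) cd_sumsqZ expr0n mul0r addr0.
Qed.

(* Bits of s beyond the first k are ignored, and missing ones are read as false. *)
Fixpoint cd_coord k (s : seq bool) : CD R k -> R :=
  match k with
  | 0 => fun x => x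
  | k'.+1 => fun x => cd_coord (behead s) (if head false s then x.2 else x.1)
  end.

Lemma cd_coordP k (x y : CD R k) : (forall s, cd_coord s x = cd_coord s y) -> x = y.
Proof.
elim: k x y => [|k IH] x y H; first exact: (H [::]).
by apply: cd_pairP; apply: IH => s; [exact: (H (false :: s))|exact: (H (true :: s))].
Qed.

Lemma cd_coordD k s (x y : CD R k) : cd_coord s (x + y) = cd_coord s x + cd_coord s y.
Proof. by elim: k s x y => [//|k IH] s x y /=; case: head; exact: IH. Qed.

Lemma cd_coordZ k s r (x : CD R k) : cd_coord s (r *: x) = r * cd_coord s x.
Proof. by elim: k s x => [//|k IH] s x /=; case: head; exact: IH. Qed.

Lemma cd_coordN k s (x : CD R k) : cd_coord s (- x) = - cd_coord s x.
Proof. by rewrite -scaleN1r cd_coordZ mulN1r. Qed.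

Lemma cd_coord0 k s : cd_coord s (0 : CD R k) = 0.
Proof. by rewrite -(scale0r (0 : CD R k)) cd_coordZ mul0r. Qed.

(** Expanding with these rules and passing to coordinates turns an identity between elements of a
    non-associative algebra into one between real numbers, with the coordinates of products as atoms
    for [ring] or [lra]. *)
Definition cd_linE := (cd_mulDl, cd_mulDr, cd_mulNl, cd_mulNr, cd_mulZl, cd_mulZr,
  cd_mul0l, cd_mul0r, cd_mul1l, cd_mul1r, cd_conjD, cd_conjN, cd_conjZ, cd_conj0, cd_conj1).

Definition cd_coordE := (cd_coordD, cd_coordN, cd_coordZ, cd_coord0).

Lemma cd_mulA k (x y z : CD R k) : (k <= 2)%N -> x ** (y ** z) = x ** y ** z.
Proof.
case: k x y z => [|[|[|k]]] // x y z _; first exact: mulrA.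
- apply: (@cd_pairP 0); rewrite /=; ring.
- apply: (@cd_pairP 1); apply: (@cd_pairP 0); rewrite /=; ring.
Qed.

(** The double of an associative algebra is alternative. In each component, [cd_conj a] is replaced
    by a real multiple of 1 minus [a], and the rest follows because the norm [cd_conj v ** v] is
    real, hence central. *)
Lemma cd_altl k (x y : CD R k) : (k <= 3)%N -> x ** (x ** y) = (x ** x) ** y.
Proof.
case: k x y => [|k] x y k3; first exact: mulrA.
have mA (u v w : CD R k) := cd_mulA u v w k3.
have central (u v : CD R k) : u ** cd_conj v ** v = cd_conj v ** v ** u.
  by rewrite -mA !cd_mul_conjl !cd_linE.
have alt1 (a b c d : CD R k) : a ** (a ** c - cd_conj d ** b) -
    cd_conj (d ** a + b ** cd_conj c) ** b =
    (a ** a - cd_conj b ** b) ** c - cd_conj d ** (b ** a + b ** cd_conj a).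
  rewrite !cd_linE !cd_conjM !cd_conjK !mA [cd_conj a]cd_conjE.
  apply: cd_coordP => s; have := congr1 (cd_coord s) (central c b).
  rewrite !cd_linE !cd_coordE; lra.
have alt2 (a b c d : CD R k) : (d ** a + b ** cd_conj c) ** a +
    b ** cd_conj (a ** c - cd_conj d ** b) =
    d ** (a ** a - cd_conj b ** b) + (b ** a + b ** cd_conj a) ** cd_conj c.
  rewrite !cd_linE !cd_conjM !cd_conjK !mA [cd_conj a]cd_conjE.
  apply: cd_coordP => s; have := congr1 (cd_coord s) (central d b).
  rewrite -mA cd_mul_conjl -cd_mul_conjr !cd_linE !cd_coordE; lra.
by apply: cd_pairP; [exact: alt1|exact: alt2].
Qed.

(** Mirror image of [cd_altl] under the anti-automorphism [cd_conj]. *)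
Lemma cd_altr k (x y : CD R k) : (k <= 3)%N -> (y ** x) ** x = y ** (x ** x).
Proof.
move=> k3; rewrite -[LHS]cd_conjK [cd_conj (y ** x ** x)]cd_conjM [cd_conj (y ** x)]cd_conjM.
by rewrite cd_altl// -!cd_conjM cd_conjK.
Qed.

(** Polarization. The linearized laws treat the cross terms between real and imaginary parts when
    alternativity is lifted to the complexification. *)
Lemma cd_altl_lin k (x y z : CD R k) : (k <= 3)%N ->
  x ** (y ** z) + y ** (x ** z) = (x ** y) ** z + (y ** x) ** z.
Proof.
move=> k3; have := cd_altl (x + y) z k3; rewrite !cd_linE !cd_altl// => H.
apply: cd_coordP => s; have := congr1 (cd_coord s) H; rewrite !cd_coordE; lra.
Qed.

Lemma cd_altr_lin k (x y z : CD R k) : (k <= 3)%N ->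
  (z ** x) ** y + (z ** y) ** x = z ** (x ** y) + z ** (y ** x).
Proof.
move=> k3; have := cd_altr (x + y) z k3; rewrite !cd_linE !cd_altr// => H.
apply: cd_coordP => s; have := congr1 (cd_coord s) H; rewrite !cd_coordE; lra.
Qed.

(** In the linearized left law at [x, y, x], the right law cancels [y ** (x ** x)] against
    [(y ** x) ** x]. *)
Lemma cd_flex k (x y : CD R k) : (k <= 3)%N -> (x ** y) ** x = x ** (y ** x).
Proof.
move=> k3; have H := cd_altl_lin x y x k3.
apply: cd_coordP => s.
have := congr1 (cd_coord s) H; have := congr1 (cd_coord s) (cd_altr x y k3).
rewrite !cd_coordE; lra.
Qed.

Lemma cd_flex_lin k (x y z : CD R k) : (k <= 3)%N ->
  (x ** y) ** z + (z ** y) ** x = x ** (y ** z) + z ** (y ** x).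
Proof.
move=> k3; have := cd_flex (x + z) y k3; rewrite !cd_linE !cd_flex// => H.
apply: cd_coordP => s; have := congr1 (cd_coord s) H; rewrite !cd_coordE; lra.
Qed.

Lemma cd_sumsqD k (x y : CD R k) :
  cd_sumsq (x + y) = cd_sumsq x + cd_sumsq y + 2 * cd_coord1 (x ** cd_conj y).
Proof.
have := congr1 (@cd_coord1 R k) (cd_mul_conjr (x + y)).
rewrite !cd_linE !cd_mul_conjr !(cd_coord1D, cd_coord1Z, cd_coord1_one).
have -> : cd_coord1 (y ** cd_conj x) = cd_coord1 (x ** cd_conj y).
  by rewrite -cd_coord1_conj cd_conjM cd_conjK.
lra.
Qed.

(** Polarization of the equality of [x ** cd_conj x] and [cd_conj x ** x]; it makes the two
    one-sided norms on the complexification coincide. *)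
Lemma cd_conj_polar k (x y : CD R k) :
  x ** cd_conj y + y ** cd_conj x = cd_conj x ** y + cd_conj y ** x.
Proof.
have := cd_mul_conjr (x + y); rewrite -cd_mul_conjl !cd_linE !cd_mul_conjr !cd_mul_conjl => H.
apply: cd_coordP => s; have := congr1 (cd_coord s) H; rewrite !cd_coordE; lra.
Qed.

End CayleyDickson.

(* Pairs (x, y) stand for the elements x + iy of the complexification of CD R k,
   where the values of stem functions live. *)
Section Complexification.
Variables (R : realType) (k : nat).
Local Notation A := (CD R k).
Local Notation "x ** y" := (cd_mul x y) (at level 40, left associativity).
Implicit Types (X Y Z : (A * A)%type) (c d : R[i]) (J : A).

Definition zmul X Y : A * A := (X.1 ** Y.1 - X.2 ** Y.2, X.1 ** Y.2 + X.2 ** Y.1).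
Definition zconj X : A * A := (cd_conj X.1, cd_conj X.2).
Definition zscale c X : A * A :=
  (complex.Re c *: X.1 - complex.Im c *: X.2, complex.Re c *: X.2 + complex.Im c *: X.1).
Definition zscalar c : A * A := (complex.Re c *: cd_one R k, complex.Im c *: cd_one R k).
(** The complex-bilinear extension of the quadratic form [cd_sumsq]; unlike it, this form has
    nontrivial zeros. *)
Definition znorm X : R[i] :=
  Complex (cd_sumsq X.1 - cd_sumsq X.2) (2 * cd_coord1 (X.1 ** cd_conj X.2)).
(** Substitution of [J] for the imaginary unit i of the complexification. *)
Definition zeval J X : A := X.1 + J ** X.2.

Lemma zpairP X Y : (forall s, cd_coord s X.1 = cd_coord s Y.1) ->
  (forall s, cd_coord s X.2 = cd_coord s Y.2) -> X = Y.
Proof. by case: X Y => [x x'] [y y'] /= /cd_coordP -> /cd_coordP ->. Qed.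

Lemma zmulDl X Y Z : zmul (X + Y) Z = zmul X Z + zmul Y Z.
Proof. by apply: zpairP => s /=; rewrite !cd_linE !cd_coordE; ring. Qed.

Lemma zmulDr X Y Z : zmul X (Y + Z) = zmul X Y + zmul X Z.
Proof. by apply: zpairP => s /=; rewrite !cd_linE !cd_coordE; ring. Qed.

Lemma zmulZl (r : R) X Y : zmul (r *: X) Y = r *: zmul X Y.
Proof. by apply: zpairP => s /=; rewrite !cd_linE !cd_coordE; ring. Qed.

Lemma zmulZr (r : R) X Y : zmul X (r *: Y) = r *: zmul X Y.
Proof. by apply: zpairP => s /=; rewrite !cd_linE !cd_coordE; ring. Qed.

Lemma zmul_scaler c X Y : zmul X (zscale c Y) = zscale c (zmul X Y).
Proof. by apply: zpairP => s /=; rewrite !cd_linE !cd_coordE; ring. Qed.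

Lemma zmul_scalel c X Y : zmul (zscale c X) Y = zscale c (zmul X Y).
Proof. by apply: zpairP => s /=; rewrite !cd_linE !cd_coordE; ring. Qed.

Lemma zscaleA c d X : zscale c (zscale d X) = zscale (c * d) X.
Proof.
by case: c d => [a b] [a' b']; apply: zpairP => s /=; rewrite !cd_coordE; ring.
Qed.

Lemma zscale1 X : zscale 1 X = X.
Proof. by apply: zpairP => s /=; rewrite !cd_coordE; ring. Qed.

Lemma zscale_scalar c d : zscale c (zscalar d) = zscalar (c * d).
Proof.
by case: c d => [a b] [a' b']; apply: zpairP => s /=; rewrite !cd_coordE; ring.
Qed.

Lemma zmul1l X : zmul (cd_one R k, 0) X = X.
Proof. by apply: zpairP => s /=; rewrite !cd_linE !cd_coordE; ring. Qed.

Lemma zmul1r X : zmul X (cd_one R k, 0) = X.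
Proof. by apply: zpairP => s /=; rewrite !cd_linE !cd_coordE; ring. Qed.

Lemma zconjM X Y : zconj (zmul X Y) = zmul (zconj Y) (zconj X).
Proof.
by apply: zpairP => s /=; rewrite !cd_linE !cd_conjM !cd_coordE; ring.
Qed.

Lemma zconjD X Y : zconj (X + Y) = zconj X + zconj Y.
Proof. by apply: zpairP => s /=; rewrite !cd_linE. Qed.

Lemma zconjZ (r : R) X : zconj (r *: X) = r *: zconj X.
Proof. by apply: zpairP => s /=; rewrite !cd_linE. Qed.

Lemma zconjK X : zconj (zconj X) = X.
Proof. by apply: zpairP => s /=; rewrite cd_conjK. Qed.

(** The imaginary part of the product is the trace of [X.1 ** cd_conj X.2], hence a real multiple of
    1. *)
Lemma zmul_conjr X : zmul X (zconj X) = zscalar (znorm X).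
Proof.
apply: zpairP => s /=; first by rewrite !cd_mul_conjr -scalerBl.
have := cd_traceE (X.1 ** cd_conj X.2).
by rewrite /cd_trace cd_conjM cd_conjK => ->.
Qed.

Lemma zmul_conjl X : zmul (zconj X) X = zscalar (znorm X).
Proof.
rewrite -zmul_conjr; apply: zpairP => s /=; first by rewrite !cd_mul_conjr !cd_mul_conjl.
by rewrite cd_conj_polar.
Qed.

Definition zassoc X Y Z := zmul (zmul X Y) Z - zmul X (zmul Y Z).

Lemma zassoc_altl X Y : (k <= 3)%N -> zassoc X X Y = 0.
Proof.
move=> k3; apply: zpairP => s /=; rewrite !cd_linE !cd_altl//;
  [have := congr1 (cd_coord s) (cd_altl_lin X.1 X.2 Y.2 k3)
  |have := congr1 (cd_coord s) (cd_altl_lin X.1 X.2 Y.1 k3)];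
  rewrite !cd_coordE; lra.
Qed.

Lemma zassoc_altr X Y : (k <= 3)%N -> zassoc Y X X = 0.
Proof.
move=> k3; apply: zpairP => s /=; rewrite !cd_linE !cd_altr//;
  [have := congr1 (cd_coord s) (cd_altr_lin X.1 X.2 Y.2 k3)
  |have := congr1 (cd_coord s) (cd_altr_lin X.1 X.2 Y.1 k3)];
  rewrite !cd_coordE; lra.
Qed.

Lemma zassoc_flex X Y : (k <= 3)%N -> zassoc X Y X = 0.
Proof.
move=> k3; apply: zpairP => s /=; rewrite !cd_linE !cd_flex//;
  [have := congr1 (cd_coord s) (cd_flex_lin X.1 Y.2 X.2 k3)
  |have := congr1 (cd_coord s) (cd_flex_lin X.1 Y.1 X.2 k3)];
  rewrite !cd_coordE; lra.
Qed.

End Complexification.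

(** * Imaginary units and slices *)

Section ImaginaryUnits.
Variables (R : realType) (k : nat).
Local Notation A := (CD R k).
Local Notation "x ** y" := (cd_mul x y) (at level 40, left associativity).
Implicit Types (a b : R) (x y J : A).

Lemma enormE x : enorm x ^+ 2 = cd_sumsq x.
Proof. by rewrite sqr_sqrtr// cd_sumsq_ge0. Qed.

Lemma enorm_ge0 x : 0 <= enorm x.
Proof. exact: sqrtr_ge0. Qed.

Lemma enorm_eq0 x : (enorm x == 0) = (x == 0).
Proof. by rewrite -sqrf_eq0 enormE cd_sumsq_eq0. Qed.

(** Comparing [J ** J = -1] with the norm of [J] shows that [(2 * cd_coord1 J) *: J] is a real
    multiple of 1. A nonzero real part would make [J] itself real, with a nonnegative square. *)
Lemma imag_unitP J : imag_unit J <-> cd_coord1 J = 0 /\ cd_sumsq J = 1.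
Proof.
rewrite /imag_unit /=; split => [JJ|[J0 J1]]; last first.
  have := cd_mul_conjr J; rewrite J1 scale1r cd_conjE J0 mulr0 scale0r sub0r cd_mulNr.
  by move=> <-; rewrite opprK.
have E : (2 * cd_coord1 J) *: J = (cd_sumsq J - 1) *: cd_one R k.
  have := cd_mul_conjr J; rewrite cd_conjE cd_mulBr cd_mulZr cd_mul1r JJ opprK scalerBl scale1r.
  by move=> <-; rewrite addrK.
have J0 : cd_coord1 J = 0.
  apply/eqP; case: eqVneq => // J0; exfalso.
  have c2 : 2 * cd_coord1 J != 0 by rewrite mulf_neq0// pnatr_eq0.
  pose r := (2 * cd_coord1 J)^-1 * (cd_sumsq J - 1).
  have EJ : J = r *: cd_one R k by rewrite -scalerA -E scalerA mulVf// scale1r.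
  have := congr1 (@cd_coord1 R k) JJ; rewrite EJ cd_mulZl cd_mulZr cd_mul1l -scaleN1r.
  rewrite !cd_coord1Z cd_coord1_one; have := sqr_ge0 r; rewrite expr2; lra.
split=> //; move: E; rewrite J0 mulr0 scale0r => /esym/eqP.
by rewrite scaler_eq0 (negPf (cd_one_neq0 R k)) orbF subr_eq0 => /eqP.
Qed.

Lemma imag_unitN J : imag_unit J -> imag_unit (- J).
Proof. by rewrite /imag_unit /= cd_mulNl cd_mulNr opprK. Qed.

Lemma cd_coord1_slice a b J : imag_unit J -> cd_coord1 (slice_pt a b J) = a.
Proof.
by move=> /imag_unitP[J0 _]; rewrite cd_coord1D !cd_coord1Z cd_coord1_one J0 mulr0 addr0 mulr1.
Qed.

Lemma cd_re_slice a b J : imag_unit J -> cd_re (slice_pt a b J) = a.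
Proof. by move=> Ju; rewrite cd_reE cd_coord1_slice. Qed.

Lemma cd_im_slice a b J : imag_unit J -> cd_im (slice_pt a b J) = b *: J.
Proof. by move=> Ju; rewrite /cd_im cd_re_slice// addrAC subrr add0r. Qed.

Lemma enorm_unitZ b J : imag_unit J -> enorm (b *: J) = `|b|.
Proof. by move=> /imag_unitP[_ J1]; rewrite /enorm cd_sumsqZ J1 mulr1 sqrtr_sqr. Qed.

Lemma enorm_slice a b J : imag_unit J -> enorm (slice_pt a b J) = cabs (Complex a b).
Proof.
move=> /imag_unitP[J0 J1]; rewrite /enorm /cabs /= cd_sumsqD !cd_sumsqZ J1 cd_sumsq_one.
rewrite cd_conjZ cd_mulZl cd_mulZr cd_mul1l !cd_coord1Z cd_coord1_conj J0 !mulr0 !mulr1 addr0.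
by [].
Qed.

Lemma slice_ptB a b a' b' J :
  slice_pt a b J - slice_pt a' b' J = slice_pt (a - a') (b - b') J.
Proof. by rewrite /slice_pt /cd_real opprD addrACA -!scalerBl. Qed.

Lemma slice_ptN a b J : slice_pt a b (- J) = slice_pt a (- b) J.
Proof. by rewrite /slice_pt scalerN scaleNr. Qed.

Lemma exists_imag_unit : (0 < k)%N -> exists J, imag_unit J.
Proof.
case: k => [//|j] _; exists ((0, cd_one R j) : CD R j.+1).
apply: cd_pairP => /=; rewrite ?cd_linE ?add0r ?addr0 ?cd_mul0l//.
by rewrite ?cd_linE ?oppr0.
Qed.

Lemma slice_decomposition x : (0 < k)%N -> exists2 J, imag_unit J &
  x = slice_pt (cd_re x) (enorm (cd_im x)) J /\
  cd_im x = enorm (cd_im x) *: J.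
Proof.
move=> k0; suff [J Ju E] : exists2 J, imag_unit J & cd_im x = enorm (cd_im x) *: J.
  by exists J => //; split => //; rewrite /slice_pt -E /cd_im addrC subrK.
have [e0|e0] := eqVneq (enorm (cd_im x)) 0.
  have [J Ju] := exists_imag_unit k0; exists J => //.
  by rewrite e0 scale0r; apply/eqP; rewrite -enorm_eq0 e0.
exists ((enorm (cd_im x))^-1 *: cd_im x); last by rewrite scalerA divff// scale1r.
apply/imag_unitP; rewrite cd_coord1Z cd_sumsqZ -enormE; split; last first.
  by rewrite -exprMn mulVf// expr1n.
rewrite /cd_im cd_reE cd_coord1D -scaleN1r !cd_coord1Z cd_coord1_one mulr1 mulN1r subrr.
by rewrite mulr0.
Qed.

Lemma slice_pt_inj a b a' b' J J' : imag_unit J -> imag_unit J' ->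
  slice_pt a b J = slice_pt a' b' J' -> a = a' /\ b *: J = b' *: J'.
Proof.
move=> Ju Ju' E; split; first by rewrite -(cd_re_slice a b Ju) E cd_re_slice.
by rewrite -(cd_im_slice a b Ju) E cd_im_slice.
Qed.

(* Left multiplication by J makes A a complex vector space. *)
Definition cact J (c : R[i]) x : A := complex.Re c *: x + complex.Im c *: (J ** x).

Lemma imag_unit_mulK J x : (k <= 3)%N -> imag_unit J -> J ** (J ** x) = - x.
Proof. by move=> k3 Ju; rewrite cd_altl// Ju cd_mulNl cd_mul1l. Qed.

Lemma cactM J c d x : (k <= 3)%N -> imag_unit J -> cact J c (cact J d x) = cact J (c * d) x.
Proof.
move=> k3 Ju; case: c d => [a b] [a' b']; rewrite /cact /= !cd_linE imag_unit_mulK//.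
by apply: cd_coordP => s; rewrite !cd_coordE; ring.
Qed.

Lemma cact1 J x : cact J 1 x = x.
Proof. by rewrite /cact /= scale1r scale0r addr0. Qed.

Lemma cact_eval J c X : (k <= 3)%N -> imag_unit J -> cact J c (zeval J X) = zeval J (zscale c X).
Proof.
move=> k3 Ju; rewrite /cact /zeval /zscale /= !cd_linE imag_unit_mulK//.
by apply: cd_coordP => s; rewrite !cd_coordE; ring.
Qed.

Lemma slice_ptE (c : R[i]) J : slice_pt (complex.Re c) (complex.Im c) J = cact J c (cd_one R k).
Proof. by rewrite /cact cd_mul1r. Qed.

End ImaginaryUnits.

(** * Stem functions *)

Section Coordinates.
Variables (R : realType) (k : nat).
Local Notation A := (CD R k).

Lemma cd_coord_continuous j s : continuous (@cd_coord R j s).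
Proof.
elim: j s => [|j IH] s x; first exact: cvg_id.
by move=> /=; case: head; apply: (continuous_comp _ (IH _ _)); [exact: cvg_snd|exact: cvg_fst].
Qed.

Lemma cvg_coord (T : Type) (F : set_system T) {FF : Filter F} j (u : T -> CD R j) l :
  (forall s, size s = j -> cd_coord s (u x) @[x --> F] --> cd_coord s l) -> u x @[x --> F] --> l.
Proof.
elim: j u l => [|j IH] u l H; first exact: (H [::] erefl).
rewrite (_ : u = fun x => ((u x).1, (u x).2)); last by apply/funext => x; case: (u x).
rewrite (_ : nbhs l = nbhs (l.1, l.2)); last by case: (l).
apply: cvg_pair.
  by apply: IH => s sj; apply: (H (false :: s)); rewrite /= sj.
by apply: IH => s sj; apply: (H (true :: s)); rewrite /= sj.
Qed.

Fixpoint cd_of_coord j (v : seq bool -> R) : CD R j :=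
  match j with
  | 0 => v [::]
  | j'.+1 => (cd_of_coord j' (fun s => v (false :: s)), cd_of_coord j' (fun s => v (true :: s)))
  end.

Lemma cd_of_coordK j v s : size s = j -> cd_coord s (cd_of_coord j v) = v s.
Proof.
elim: j v s => [|j IH] v [|b s] //= [sj].
by case: b; rewrite IH.
Qed.

Lemma cd_coord_sizeP j (x y : CD R j) :
  (forall s, size s = j -> cd_coord s x = cd_coord s y) -> x = y.
Proof.
elim: j x y => [|j IH] x y H; first exact: (H [::]).
apply: cd_pairP; apply: IH => s sj; first by apply: (H (false :: s)); rewrite /= sj.
by apply: (H (true :: s)); rewrite /= sj.
Qed.

Lemma derive_cvg (V W : normedModType R) (f : V -> W) z v l :
  (h^-1 *: (f (h *: v + z) - f z)) @[h --> 0^'] --> l -> derivable f z v /\ 'D_v f z = l.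
Proof. by move=> H; split; [exact: cvgP H|exact: cvg_lim H]. Qed.

Lemma derivable_coord (V : normedModType R) (f : V -> A) z v s : derivable f z v ->
  derivable (fun x => cd_coord s (f x)) z v /\
  'D_v (fun x => cd_coord s (f x)) z = cd_coord s ('D_v f z).
Proof.
move=> df; apply: derive_cvg.
have -> : (fun h : R => h^-1 *: (cd_coord s (f (h *: v + z)) - cd_coord s (f z))) =
   cd_coord s \o (fun h : R => h^-1 *: (f (h *: v + z) - f z)).
  by apply/funext => h /=; rewrite cd_coordZ cd_coordD cd_coordN.
by apply: continuous_cvg => //; exact: cd_coord_continuous.
Qed.

Lemma derivable_of_coord (V : normedModType R) (f : V -> A) z v (df : seq bool -> R) :
  (forall s, derivable (fun x => cd_coord s (f x)) z v /\
     'D_v (fun x => cd_coord s (f x)) z = df s) ->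
  derivable f z v /\ 'D_v f z = cd_of_coord k df.
Proof.
move=> H; apply: derive_cvg; apply: cvg_coord => s sk; rewrite cd_of_coordK//.
have [h1 <-] := H s.
have -> : (fun h : R => cd_coord s (h^-1 *: (f (h *: v + z) - f z))) =
   (fun h : R => h^-1 *: (cd_coord s (f (h *: v + z)) - cd_coord s (f z))).
  by apply/funext => h /=; rewrite cd_coordZ cd_coordD cd_coordN.
exact: h1.
Qed.

End Coordinates.

(** * Partial derivatives and the Cauchy-Riemann equations *)

Section PlaneCalculus.
Variable R : realType.
Local Notation C := R[i].
Implicit Types (f g : R * R -> R) (z : R * R).

Definition plane (w : C) : R * R := (complex.Re w, complex.Im w).

Lemma plane_ball z (P : set (R * R)) : nbhs z P -> exists2 r : R, 0 < r &
  forall a b, `|a - z.1| < r -> `|b - z.2| < r -> P (a, b).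
Proof.
move=> /nbhs_ballP[r /= r0 H]; exists r => // a b ha hb; apply: H.
by split; rewrite -ball_normE /ball_ /= distrC.
Qed.

Lemma plane_surj z : exists w : C, z = plane w.
Proof. by case: z => a b; exists (Complex a b). Qed.

Lemma nbhs_plane (w : C) (P : set (R * R)) :
  nbhs (plane w) P <-> exists2 r : R, 0 < r & forall w', cabs (w' - w) < r -> P (plane w').
Proof.
split => [/plane_ball[r r0 H]|[r r0 H]].
  exists r => // w' w'r; apply: H; rewrite -raddfB; apply: le_lt_trans w'r.
    exact: ler_Re_cabs.
  exact: ler_Im_cabs.
apply/nbhs_ballP; exists (r / 2) => /=; first by rewrite divr_gt0.
move=> z; have [w' ->] := plane_surj z => -[]; rewrite -!ball_normE /ball_ /=.
rewrite distrC => h1; rewrite distrC => h2; apply: H.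
by rewrite (le_lt_trans (cabs_le_ReIm _))// !raddfB /=; lra.
Qed.

Lemma open_plane (D : set (R * R)) (w : C) : open D -> D (plane w) ->
  exists2 r : R, 0 < r & forall w', cabs (w' - w) < r -> D (plane w').
Proof. by move=> oD Dw; apply/nbhs_plane/open_nbhs_nbhs. Qed.

Lemma mvt_between (h dh : R -> R) (x y c r : R) : `|x - c| < r -> `|y - c| < r ->
  (forall t : R, `|t - c| < r -> is_derive t 1 h (dh t)) ->
  exists2 t : R, `|t - c| < r & h x - h y = dh t * (x - y).
Proof.
wlog yx : x y / y <= x => [wlg|] hx hy dd.
  have [yx|/ltW xy] := leP y x; first exact: wlg.
  have [t tr E] := wlg _ _ xy hy hx dd; exists t => //.
  by rewrite -opprB E -mulrN opprB.
have seg t : y <= t <= x -> `|t - c| < r.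
  by move: hx hy; rewrite !ltr_norml => /andP[? ?] /andP[? ?] /andP[? ?]; apply/andP; split; lra.
have [||t] := @MVT_segment R h dh y x yx.
- by move=> t; rewrite in_itv /= => /andP[/ltW ? /ltW ?]; apply: dd; apply: seg; apply/andP.
- apply: derivable_within_continuous => t; rewrite in_itv /= => ht.
  exact: (@ex_derive _ _ _ _ _ _ _ (dd t (seg _ ht))).
by rewrite in_itv /= => /seg tr E; exists t.
Qed.

Lemma is_derive_axis1 f a b : derivable f (a, b) (1, 0) ->
  is_derive a 1 (fun t => f (t, b)) ('D_(1, 0) f (a, b)).
Proof.
move=> df; suff [h1 h2] : derivable (fun t => f (t, b)) a 1 /\
    'D_1 (fun t => f (t, b)) a = 'D_(1, 0) f (a, b) by apply: DeriveDef.
apply: derive_cvg.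
rewrite (_ : (fun e : R => _) = fun e : R => e^-1 *: (f (e *: (1, 0) + (a, b)) - f (a, b)))//.
apply/funext => e; congr (_ *: (f _ - _)).
by rewrite [RHS](_ : _ = (e * 1 + a, e * 0 + b))// mulr0 add0r.
Qed.

Lemma is_derive_axis2 f a b : derivable f (a, b) (0, 1) ->
  is_derive b 1 (fun t => f (a, t)) ('D_(0, 1) f (a, b)).
Proof.
move=> df; suff [h1 h2] : derivable (fun t => f (a, t)) b 1 /\
    'D_1 (fun t => f (a, t)) b = 'D_(0, 1) f (a, b) by apply: DeriveDef.
apply: derive_cvg.
rewrite (_ : (fun e : R => _) = fun e : R => e^-1 *: (f (e *: (0, 1) + (a, b)) - f (a, b)))//.
apply/funext => e; congr (_ *: (f _ - _)).
by rewrite [RHS](_ : _ = (e * 0 + a, e * 1 + b))// mulr0 add0r.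
Qed.

(** The increment is split into a horizontal and a vertical one and the mean value theorem is
    applied to each; square neighbourhoods contain both segments. *)
Lemma C1_increment f z (D : set (R * R)) : open D -> D z ->
  (forall x, D x -> derivable f x (1, 0)) -> (forall x, D x -> derivable f x (0, 1)) ->
  {for z, continuous (fun x => 'D_(1, 0) f x)} -> {for z, continuous (fun x => 'D_(0, 1) f x)} ->
  forall e : R, 0 < e -> exists2 r : R, 0 < r & forall a b a' b',
    `|a - z.1| < r -> `|b - z.2| < r -> `|a' - z.1| < r -> `|b' - z.2| < r ->
    `|f (a, b) - f (a', b') - ('D_(1, 0) f z * (a - a') + 'D_(0, 1) f z * (b - b'))|
      <= e * (`|a - a'| + `|b - b'|).
Proof.
move=> oD Dz d1 d2 c1 c2 e e0.
have near1 : nbhs z (fun x => `|'D_(1, 0) f z - 'D_(1, 0) f x| < e).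
  by move/cvgrPdist_lt : c1 => /(_ _ e0).
have near2 : nbhs z (fun x => `|'D_(0, 1) f z - 'D_(0, 1) f x| < e).
  by move/cvgrPdist_lt : c2 => /(_ _ e0).
have nearD : nbhs z D by exact: open_nbhs_nbhs.
have [r r0 Hr] := plane_ball (filterI nearD (filterI near1 near2)).
exists r => // a b a' b' ha hb ha' hb'.
have [t tr Et] : exists2 t : R, `|t - z.1| < r &
    f (a, b) - f (a', b) = 'D_(1, 0) f (t, b) * (a - a').
  apply: (@mvt_between (fun t => f (t, b)) (fun t => 'D_(1, 0) f (t, b)) _ _ _ _ ha ha') => t tr.
  by apply: is_derive_axis1; apply: d1; have [] := Hr _ _ tr hb.
have [s sr Es] : exists2 s : R, `|s - z.2| < r &
    f (a', b) - f (a', b') = 'D_(0, 1) f (a', s) * (b - b').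
  apply: (@mvt_between (fun t => f (a', t)) (fun t => 'D_(0, 1) f (a', t)) _ _ _ _ hb hb') => t' tr'.
  by apply: is_derive_axis2; apply: d2; have [] := Hr _ _ ha' tr'.
have [_ [/ltW n1 _]] := Hr _ _ tr hb; have [_ [_ /ltW n2]] := Hr _ _ ha' sr.
have -> : f (a, b) - f (a', b') - ('D_(1, 0) f z * (a - a') + 'D_(0, 1) f z * (b - b')) =
   - (('D_(1, 0) f z - 'D_(1, 0) f (t, b)) * (a - a') +
      ('D_(0, 1) f z - 'D_(0, 1) f (a', s)) * (b - b')).
  have -> : f (a, b) - f (a', b') = (f (a, b) - f (a', b)) + (f (a', b) - f (a', b')) by ring.
  by rewrite Et Es; ring.
rewrite normrN (le_trans (ler_normD _ _))// !normrM mulrDr.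
by rewrite lerD// ler_wpM2r.
Qed.

Lemma sdiff_of_partials f g (D : set (R * R)) w : open D -> D (plane w) ->
  (forall x, D x -> derivable f x (1, 0)) -> (forall x, D x -> derivable f x (0, 1)) ->
  (forall x, D x -> derivable g x (1, 0)) -> (forall x, D x -> derivable g x (0, 1)) ->
  {for plane w, continuous (fun x => 'D_(1, 0) f x)} ->
  {for plane w, continuous (fun x => 'D_(0, 1) f x)} ->
  {for plane w, continuous (fun x => 'D_(1, 0) g x)} ->
  {for plane w, continuous (fun x => 'D_(0, 1) g x)} ->
  'D_(1, 0) f (plane w) = 'D_(0, 1) g (plane w) ->
  'D_(0, 1) f (plane w) = - 'D_(1, 0) g (plane w) ->
  sdiff (fun c => Complex (f (plane c)) (g (plane c))) w
    (Complex ('D_(1, 0) f (plane w)) ('D_(1, 0) g (plane w))).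
Proof.
move=> oD Dw f1 f2 g1 g2 cf1 cf2 cg1 cg2 cr1 cr2 e e0.
have e4 : 0 < e / 4 by rewrite divr_gt0.
have [r r0 Hr] := C1_increment oD Dw f1 f2 cf1 cf2 e4.
have [s s0 Hs] := C1_increment oD Dw g1 g2 cg1 cg2 e4.
exists (Num.min r s) => [|[a b] [a' b']]; first by rewrite lt_min r0.
rewrite !lt_min => /andP[h1 h2] /andP[h1' h2'].
have Rr (x y : C) d : cabs (x - y) < d -> `|complex.Re x - complex.Re y| < d.
  by move=> h; rewrite -raddfB (le_lt_trans (ler_Re_cabs _)).
have Ir (x y : C) d : cabs (x - y) < d -> `|complex.Im x - complex.Im y| < d.
  by move=> h; rewrite -raddfB (le_lt_trans (ler_Im_cabs _)).
have := Hr _ _ _ _ (Rr _ _ _ h1) (Ir _ _ _ h1) (Rr _ _ _ h1') (Ir _ _ _ h1').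
have := Hs _ _ _ _ (Rr _ _ _ h2) (Ir _ _ _ h2) (Rr _ _ _ h2') (Ir _ _ _ h2').
rewrite /= cr2 -cr1.
set fa := 'D_(1, 0) f _; set ga := 'D_(1, 0) g _ => Hg Hf.
suff : cabs (Complex (f (a, b)) (g (a, b)) - Complex (f (a', b')) (g (a', b'))
   - Complex fa ga * (Complex a b - Complex a' b')) <= e * cabs (Complex a b - Complex a' b') by [].
have xa : `|a - a'| <= cabs (Complex a b - Complex a' b').
  exact: (ler_Re_cabs (Complex a b - Complex a' b')).
have xb : `|b - b'| <= cabs (Complex a b - Complex a' b').
  exact: (ler_Im_cabs (Complex a b - Complex a' b')).
have -> : Complex (f (a, b)) (g (a, b)) - Complex (f (a', b')) (g (a', b'))
     - Complex fa ga * (Complex a b - Complex a' b') =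
  Complex (f (a, b) - f (a', b') - (fa * (a - a') + - ga * (b - b')))
          (g (a, b) - g (a', b') - (ga * (a - a') + fa * (b - b'))).
  by apply/eqP; rewrite eq_complex /=; apply/andP; split; apply/eqP; ring.
rewrite (le_trans (cabs_le_ReIm _))//=.
move: xa xb; set x := cabs _ => xa xb.
have : e / 4 * (`|a - a'| + `|b - b'|) <= e / 4 * (x + x).
  by rewrite ler_wpM2l ?(ltW e4)// lerD.
lra.
Qed.

(** The strict estimate is applied to the increment [h * v] with real [h]; [cabs v + 1] instead of
    [cabs v] allows [v = 0]. *)
Lemma partials_of_sdiff f g w d (v : C) :
  sdiff (fun c => Complex (f (plane c)) (g (plane c))) w d ->
  (derivable f (plane w) (plane v) /\ 'D_(plane v) f (plane w) = complex.Re (d * v)) /\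
  (derivable g (plane w) (plane v) /\ 'D_(plane v) g (plane w) = complex.Im (d * v)).
Proof.
move=> Hd.
suff H : forall e, 0 < e -> \forall h \near (0 : R)^',
    `|complex.Re (d * v) - h^-1 * (f (h *: plane v + plane w) - f (plane w))| <= e /\
    `|complex.Im (d * v) - h^-1 * (g (h *: plane v + plane w) - g (plane w))| <= e.
  split; apply: derive_cvg; apply/cvgrPdist_le => e /H; apply: filterS => h [] //.
move=> e e0.
have v0 : 0 < cabs v + 1 by have := cabs_ge0 v; lra.
have ev : 0 < e / (cabs v + 1) by rewrite divr_gt0.
have [r r0 Hr] := Hd _ ev.
have rv : 0 < r / (cabs v + 1) by rewrite divr_gt0.
have nr : \forall h \near (0 : R)^', `|h| < r / (cabs v + 1) by exact: dnbhs0_lt.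
have n0 : \forall h \near (0 : R)^', h != 0 by exact: nbhs_dnbhs_neq.
apply: filterS2 nr n0 => h hr h0.
pose x := h%:C%C * v.
have cx : cabs x = `|h| * cabs v by rewrite cabsM cabs_real.
have xr : cabs (w + x - w) < r.
  rewrite addrC addKr cx; move: hr; rewrite ltr_pdivlMr//; apply: le_lt_trans.
  by rewrite ler_wpM2l// lerDl.
have w0 : cabs (w - w) < r by rewrite cabsBB.
have := Hr _ _ xr w0; rewrite {3 4}[w + x]addrC addrK cx.
have -> : plane (w + x) = h *: plane v + plane w.
  rewrite /x; case: (v) (w) => [v1 v2] [w1 w2].
  by rewrite [RHS](_ : _ = (h * v1 + w1, h * v2 + w2))//; congr pair => /=; ring.
set F := f (_ + _); set G := g (_ + _) => Hx.
have hn : 0 < `|h| by rewrite normr_gt0.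
have bnd : cabs (d * v - h^-1%:C%C * (Complex F G - Complex (f (plane w)) (g (plane w)))) <= e.
  have hV : h^-1%:C%C * h%:C%C = 1 by rewrite -rmorphM mulVf// rmorph1.
  set X := Complex F G - _ in Hx *; rewrite (_ : _ - _ = - (h^-1%:C%C * (X - d * x))); last first.
    by rewrite -[d * v]mul1r -hV /x; ring.
  rewrite cabsN cabsM cabs_real normfV ler_pdivrMl// (le_trans Hx)//.
  by rewrite mulrCA ler_pM2l// mulrAC ler_pdivrMr// ler_pM2l// lerDl.
split.
  apply: le_trans bnd; apply: le_trans (ler_Re_cabs _); rewrite raddfB /=.
  by rewrite !mul0r subr0.
apply: le_trans bnd; apply: le_trans (ler_Im_cabs _); rewrite raddfB /=.
by rewrite !mul0r addr0.
Qed.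

End PlaneCalculus.

(** * Functions with values in the complexification *)

Section StemHolomorphy.
Variables (R : realType) (k : nat).
Local Notation A := (CD R k).
Local Notation C := R[i].

Definition zcoord j s (X : CD R j * CD R j) : C := Complex (cd_coord s X.1) (cd_coord s X.2).

Lemma zcoordD j s (X Y : CD R j * CD R j) : zcoord s (X + Y) = zcoord s X + zcoord s Y.
Proof. by rewrite /zcoord /= !cd_coordD. Qed.

Lemma zcoordZ j s (r : R) (X : CD R j * CD R j) : zcoord s (r *: X) = r%:C%C * zcoord s X.
Proof.
by apply/eqP; rewrite /zcoord eq_complex /= !cd_coordZ !mul0r subr0 addr0 !eqxx.
Qed.

Lemma zcoordN j s (X : CD R j * CD R j) : zcoord s (- X) = - zcoord s X.
Proof. by rewrite /zcoord /= !cd_coordN. Qed.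

Lemma zcoord_scale j s c (X : CD R j * CD R j) : zcoord s (zscale c X) = c * zcoord s X.
Proof.
by case: c => a b; apply/eqP; rewrite /zcoord eq_complex /= !cd_coordE !eqxx.
Qed.

Lemma cd_coord_conj j s : exists c : R, `|c| = 1 /\
  forall x : CD R j, cd_coord s (cd_conj x) = c * cd_coord s x.
Proof.
elim: j s => [|j IH] s; first by exists 1; rewrite normr1; split => // x; rewrite mul1r.
have [c [c1 Hc]] := IH (behead s).
exists (if head false s then -1 else c); split; first by case: head; rewrite ?normrN1.
by move=> x /=; case: head; rewrite ?cd_coordN ?mulN1r.
Qed.

Lemma cd_coord_one j s : exists c : R, `|c| <= 1 /\ cd_coord s (cd_one R j) = c.
Proof.
elim: j s => [|j IH] s; first by exists 1; rewrite normr1.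
have [c [c1 Hc]] := IH (behead s).
exists (if head false s then 0 else c); split; first by case: head; rewrite ?normr0.
by move=> /=; case: head; rewrite ?cd_coord0.
Qed.

(** Complexification commutes with Cayley-Dickson doubling. This allows induction on [j] for
    products, starting from the product of R[i]. *)
Lemma zmulS j (X Y : CD R j.+1 * CD R j.+1) :
  let X1 := (X.1.1, X.2.1) in let X2 := (X.1.2, X.2.2) in
  let Y1 := (Y.1.1, Y.2.1) in let Y2 := (Y.1.2, Y.2.2) in
  let P := zmul X1 Y1 - zmul (zconj Y2) X2 in let Q := zmul Y2 X1 + zmul X2 (zconj Y1) in
  zmul X Y = ((P.1, Q.1), (P.2, Q.2)).
Proof.
move: X Y => [[a b] [c d]] [[a' b'] [c' d']] /=.
by congr pair; apply: cd_pairP; apply: cd_coordP => s /=; rewrite !cd_coordE; ring.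
Qed.

Definition zbounded j (K : R) (X : CD R j * CD R j) := forall s, cabs (zcoord s X) <= K.

Lemma zboundedD j K L (X Y : CD R j * CD R j) : zbounded K X -> zbounded L Y ->
  zbounded (K + L) (X + Y).
Proof. by move=> hX hY s; rewrite zcoordD (le_trans (cabsD _ _))// lerD. Qed.

Lemma zbounded_conj j K (X : CD R j * CD R j) : zbounded K X -> zbounded K (zconj X).
Proof.
move=> h s; have [c [c1 Hc]] := cd_coord_conj j s.
rewrite /zcoord /= !Hc (_ : Complex _ _ = c%:C%C * zcoord s X) ?cabsM ?cabs_real ?c1 ?mul1r//.
by apply/eqP; rewrite /zcoord eq_complex /= !mul0r subr0 addr0 !eqxx.
Qed.

(** Each doubling writes a coordinate as a sum of two products, whence the factor [2 ^+ j]. *)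
Lemma zbounded_mul j K L (X Y : CD R j * CD R j) : zbounded K X -> zbounded L Y ->
  zbounded (2 ^+ j * (K * L)) (zmul X Y).
Proof.
elim: j K L X Y => [|j IH] K L X Y hX hY s.
  rewrite (_ : zcoord s _ = zcoord s X * zcoord s Y).
    by rewrite cabsM expr0 mul1r ler_pM ?cabs_ge0.
  by apply/eqP; rewrite eq_complex /= !eqxx.
have h1 (Z : CD R j.+1 * CD R j.+1) M : zbounded M Z -> zbounded M (Z.1.1, Z.2.1).
  by move=> h s'; have := h (false :: s').
have h2 (Z : CD R j.+1 * CD R j.+1) M : zbounded M Z -> zbounded M (Z.1.2, Z.2.2).
  by move=> h s'; have := h (true :: s').
have X1 := h1 _ _ hX; have X2 := h2 _ _ hX; have Y1 := h1 _ _ hY; have Y2 := h2 _ _ hY.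
rewrite zmulS exprS -mulrA mulr_natl mulr2n /zcoord /=.
case: head => /=.
  apply: (le_trans _ (lerD (lexx _) (lexx _))).
  have := zboundedD (IH _ _ _ _ Y2 X1) (IH _ _ _ _ X2 (zbounded_conj Y1)).
  by rewrite [L * K]mulrC => /(_ (behead s)).
have N (Z : CD R j * CD R j) M : zbounded M Z -> zbounded M (- Z).
  by move=> h s'; rewrite zcoordN cabsN.
have := zboundedD (IH _ _ _ _ X1 Y1) (N _ _ (IH _ _ _ _ (zbounded_conj Y2) X2)).
by rewrite [L * K]mulrC => /(_ (behead s)).
Qed.

Definition zhol j (P : C -> CD R j * CD R j) (w : C) :=
  forall s, exists d, sdiff (fun c => zcoord s (P c)) w d.

Lemma zhol_eq_near j (P Q : C -> CD R j * CD R j) w (r : R) : 0 < r ->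
  (forall c, cabs (c - w) < r -> P c = Q c) -> zhol P w -> zhol Q w.
Proof.
move=> r0 PQ h s; have [d hd] := h s; exists d.
by apply: (sdiff_eq_near r0 _ hd) => c /PQ ->.
Qed.

Lemma zhol_cst j (X : CD R j * CD R j) w : zhol (fun=> X) w.
Proof. by move=> s; exists 0; exact: sdiff_cst. Qed.

Lemma zholD j (P Q : C -> CD R j * CD R j) w : zhol P w -> zhol Q w -> zhol (fun c => P c + Q c) w.
Proof.
move=> hP hQ s; have [d hd] := hP s; have [d' hd'] := hQ s; exists (d + d').
apply: (sdiff_eq_near (@ltr01 R) _ (sdiffD hd hd')) => c _.
by rewrite zcoordD.
Qed.

Lemma zhol_scale j f (P : C -> CD R j * CD R j) w d : sdiff f w d -> zhol P w ->
  zhol (fun c => zscale (f c) (P c)) w.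
Proof.
move=> hf hP s; have [d' hd] := hP s; eexists.
apply: (sdiff_eq_near (@ltr01 R) _ (sdiffM hf hd)) => c _.
by rewrite zcoord_scale.
Qed.

Lemma zholZ j (r : R) (P : C -> CD R j * CD R j) w : zhol P w -> zhol (fun c => r *: P c) w.
Proof.
move=> hP s; have [d' hd] := hP s; eexists.
apply: (sdiff_eq_near (@ltr01 R) _ (sdiffM (@sdiff_cst _ r%:C%C w) hd)) => c _.
by rewrite zcoordZ.
Qed.

Lemma zhol_conj j (P : C -> CD R j * CD R j) w : zhol P w -> zhol (fun c => zconj (P c)) w.
Proof.
move=> hP s; have [c [_ Hc]] := cd_coord_conj j s; have [d' hd] := hP s; eexists.
apply: (sdiff_eq_near (@ltr01 R) _ (sdiffM (@sdiff_cst _ c%:C%C w) hd)) => c' _.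
by apply/eqP; rewrite eq_complex /= !Hc !mul0r subr0 addr0 !eqxx.
Qed.

Lemma zhol_mul j (P Q : C -> CD R j * CD R j) w : zhol P w -> zhol Q w ->
  zhol (fun c => zmul (P c) (Q c)) w.
Proof.
elim: j P Q => [|j IH] P Q hP hQ s.
  have [d hd] := hP s; have [d' hd'] := hQ s; eexists.
  apply: (sdiff_eq_near (@ltr01 R) _ (sdiffM hd hd')) => c _.
  by apply/eqP; rewrite eq_complex /= !eqxx.
have h1 (Z : C -> CD R j.+1 * CD R j.+1) : zhol Z w -> zhol (fun c => ((Z c).1.1, (Z c).2.1)) w.
  by move=> h s'; have := h (false :: s').
have h2 (Z : C -> CD R j.+1 * CD R j.+1) : zhol Z w -> zhol (fun c => ((Z c).1.2, (Z c).2.2)) w.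
  by move=> h s'; have := h (true :: s').
have P1 := h1 _ hP; have P2 := h2 _ hP; have Q1 := h1 _ hQ; have Q2 := h2 _ hQ.
have [H1|H1] := boolP (head false s).
  have [d hd] := zholD (IH _ _ Q2 P1) (IH _ _ P2 (zhol_conj Q1)) (behead s); exists d.
  by apply: (sdiff_eq_near (@ltr01 R) _ hd) => c _; rewrite zmulS /zcoord /= H1.
have [d hd] := zholD (IH _ _ P1 Q1) (zholZ (-1) (IH _ _ (zhol_conj Q2) P2)) (behead s); exists d.
apply: (sdiff_eq_near (@ltr01 R) _ hd) => c _; rewrite scaleN1r zmulS /zcoord /=.
by rewrite (negPf H1).
Qed.

Definition zval (F : (R * R -> A) * (R * R -> A)) (w : C) : A * A := (F.1 (plane w), F.2 (plane w)).

Lemma stem_zhol (D : set (R * R)) F : open D -> C1_on D F.1 -> C1_on D F.2 ->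
  (forall z, D z -> 'D_(1, 0) F.1 z = 'D_(0, 1) F.2 z /\ 'D_(0, 1) F.1 z = - 'D_(1, 0) F.2 z) ->
  forall w, D (plane w) -> zhol (zval F) w.
Proof.
move=> oD h1 h2 cr w Dw s; eexists.
have dd (G : R * R -> A) v z : derivable G z v -> derivable (fun x => cd_coord s (G x)) z v.
  by move=> /derivable_coord-/(_ s)[].
have D'E (G : R * R -> A) v z : derivable G z v ->
    'D_v (fun x => cd_coord s (G x)) z = cd_coord s ('D_v G z).
  by move=> /derivable_coord-/(_ s)[].
have cc (G : R * R -> A) v : (forall z, D z -> derivable G z v) ->
    {for plane w, continuous ('D_v G)} ->
    {for plane w, continuous ('D_v (fun x => cd_coord s (G x)))}.
  move=> dG cG.
  have near : \forall z \near plane w, cd_coord s ('D_v G z) = 'D_v (fun x => cd_coord s (G x)) z.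
    by apply: filterS (open_nbhs_nbhs (conj oD Dw)) => z /dG /D'E.
  rewrite /prop_for /continuous_at (D'E _ _ _ (dG _ Dw)).
  apply: cvg_trans (continuous_comp cG (@cd_coord_continuous R k s _)).
  exact: near_eq_cvg.
apply: (@sdiff_of_partials R (fun x => cd_coord s (F.1 x)) (fun x => cd_coord s (F.2 x)) D w oD Dw).
- by move=> x /h1[d1 _ _ _]; exact: dd.
- by move=> x /h1[_ d1 _ _]; exact: dd.
- by move=> x /h2[d1 _ _ _]; exact: dd.
- by move=> x /h2[_ d1 _ _]; exact: dd.
- by apply: cc; [move=> z /h1[]|have [] := h1 _ Dw].
- by apply: cc; [move=> z /h1[]|have [] := h1 _ Dw].
- by apply: cc; [move=> z /h2[]|have [] := h2 _ Dw].
- by apply: cc; [move=> z /h2[]|have [] := h2 _ Dw].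
- have [e1 _] := cr _ Dw; have [d1 _ _ _] := h1 _ Dw; have [_ d2 _ _] := h2 _ Dw.
  by rewrite !D'E// e1.
- have [_ e1] := cr _ Dw; have [_ d1 _ _] := h1 _ Dw; have [d2 _ _ _] := h2 _ Dw.
  by rewrite !D'E// e1 cd_coordN.
Qed.

(** Strict differentiability at all points of an open set makes the complex derivative continuous,
    hence also the partial derivatives, which are its real and imaginary parts up to a constant
    factor. *)
Lemma zhol_stem (D : set (R * R)) F : open D ->
  (forall w, D (plane w) -> zhol (zval F) w) ->
  [/\ C1_on D F.1, C1_on D F.2 &
  (forall z, D z -> 'D_(1, 0) F.1 z = 'D_(0, 1) F.2 z /\ 'D_(0, 1) F.1 z = - 'D_(1, 0) F.2 z)].
Proof.
move=> oD H.
have /choice[d Hd] : forall ws : C * seq bool, exists d, D (plane ws.1) ->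
    sdiff (fun c => zcoord ws.2 (zval F c)) ws.1 d.
  move=> [w s] /=; have [Dw|nD] := pselect (D (plane w)); last by exists 0.
  by have [d hd] := H w Dw s; exists d.
have part w v s (Dw : D (plane w)) := @partials_of_sdiff R (fun x => cd_coord s (F.1 x))
  (fun x => cd_coord s (F.2 x)) w (d (w, s)) v (Hd (w, s) Dw).
have part1 w v (Dw : D (plane w)) := derivable_of_coord (fun s => (part w v s Dw).1).
have part2 w v (Dw : D (plane w)) := derivable_of_coord (fun s => (part w v s Dw).2).
have p10 : (1, 0) = plane (1 : C) by [].
have p01 : (0, 1) = plane (Complex 0 1 : C) by [].
(* The four partial derivatives are treated at once: in coordinates each is [L (d * c)] with [L] the
   real or imaginary part and [c] equal to 1 or i. *)
have cont (G : R * R -> A) (v : R * R) (q : C -> seq bool -> R) (c : C) (L : C -> R) :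
    (forall w, D (plane w) -> 'D_v G (plane w) = cd_of_coord k (q w)) ->
    (forall w s, q w s = L (d (w, s) * c)) -> (forall x y, `|L x - L y| <= cabs (x - y)) ->
    forall w, D (plane w) -> {for plane w, continuous ('D_v G)}.
  move=> DG qL HL w Dw; rewrite /prop_for /continuous_at (DG _ Dw).
  apply: cvg_coord => s sk; rewrite cd_of_coordK// qL.
  apply/cvgrPdist_le => e e0.
  have [r r0 inD] := open_plane oD Dw.
  have c0 : 0 < cabs c + 1 by have := cabs_ge0 c; lra.
  have ec : 0 < e / (cabs c + 1) by rewrite divr_gt0.
  have [t t0 Ht] := @sdiff_deriv_continuous R (fun c => zcoord s (zval F c)) (fun w' => d (w', s)) w r
    r0 (fun w' h => Hd (w', s) (inD w' h)) _ ec.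
  suff : nbhs (plane w) (fun z => `|L (d (w, s) * c) - cd_coord s ('D_v G z)| <= e) by [].
  apply/nbhs_plane; exists (Num.min r t) => [|w' hw']; first by rewrite lt_min r0.
  move: hw'; rewrite lt_min => /andP[w'r w't].
  rewrite (DG _ (inD _ w'r)) cd_of_coordK// qL (le_trans (HL _ _))// -mulrBl cabsM cabsB.
  have := ler_wpM2r (cabs_ge0 c) (Ht _ w't) => /le_trans; apply.
  by rewrite mulrAC ler_pdivrMr// ler_pM2l// lerDl.
have LRe (x y : C) : `|complex.Re x - complex.Re y| <= cabs (x - y).
  by rewrite -raddfB ler_Re_cabs.
have LIm (x y : C) : `|complex.Im x - complex.Im y| <= cabs (x - y).
  by rewrite -raddfB ler_Im_cabs.
split.
- move=> z; have [w ->] := plane_surj z => Dw; rewrite p10 p01; split.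
  + exact: (part1 w _ Dw).1.
  + exact: (part1 w _ Dw).1.
  + apply: (cont _ _ (fun w s => complex.Re (d (w, s) * 1)) 1 (@complex.Re R)) => // w' Dw'.
    exact: (part1 _ _ Dw').2.
  + apply: (cont _ _ (fun w s => complex.Re (d (w, s) * Complex 0 1)) (Complex 0 1) (@complex.Re R)) => // w' Dw'.
    exact: (part1 _ _ Dw').2.
- move=> z; have [w ->] := plane_surj z => Dw; rewrite p10 p01; split.
  + exact: (part2 w _ Dw).1.
  + exact: (part2 w _ Dw).1.
  + apply: (cont _ _ (fun w s => complex.Im (d (w, s) * 1)) 1 (@complex.Im R)) => // w' Dw'.
    exact: (part2 _ _ Dw').2.
  + apply: (cont _ _ (fun w s => complex.Im (d (w, s) * Complex 0 1)) (Complex 0 1) (@complex.Im R)) => // w' Dw'.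
    exact: (part2 _ _ Dw').2.
- move=> z; have [w ->] := plane_surj z => Dw; rewrite p10 p01.
  rewrite !(part1 w _ Dw).2 !(part2 w _ Dw).2; split; apply: cd_coord_sizeP => s sk.
    by rewrite !cd_of_coordK//; case: (d _) => x y /=; ring.
  by rewrite cd_coordN !cd_of_coordK//; case: (d _) => x y /=; ring.
Qed.

End StemHolomorphy.

(** * Circular sets and stem functions of a complex variable *)

Section SliceStems.
Variables (R : realType) (k : nat).
Hypothesis hk : (1 <= k <= 3)%N.
Local Notation A := (CD R k).
Local Notation C := R[i].
Implicit Types (Om : set A) (w : C) (J : A) (X Y : A * A) (P Q : C -> A * A) (f g : pfun R k).

Let k_gt0 : (0 < k)%N. Proof. by case/andP: hk. Qed.
Let k_le3 : (k <= 3)%N. Proof. by case/andP: hk. Qed.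

Definition spt J w : A := slice_pt (complex.Re w) (complex.Im w) J.

(* The set D with Om = Omega_D, as a set of complex numbers. *)
Definition csh Om : set C := [set w | exists2 J, imag_unit J & Om (spt J w)].

Definition copen (U : set C) := forall w, U w ->
  exists2 r : R, 0 < r & forall w', cabs (w' - w) < r -> U w'.

Lemma spt_conj J w : spt J (conjc w) = spt (- J) w.
Proof. by case: w => a b; rewrite /spt slice_ptN. Qed.

Lemma spt_cases J J' w w' : imag_unit J -> imag_unit J' -> spt J w = spt J' w' ->
  w = w' \/ w = conjc w'.
Proof.
move=> Ju Ju' /(slice_pt_inj Ju Ju')[]; case: w w' => [a b] [a' b'] /= -> E.
have : `|b| = `|b'| by rewrite -(enorm_unitZ b Ju) E (enorm_unitZ b' Ju').
move=> /eqP; rewrite eqr_norm2 => /orP[]/eqP->; first by left.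
by right.
Qed.

Lemma circularizationE (D : set (R * R)) J w : conj_invariant D -> imag_unit J ->
  circularization D (spt J w) <-> D (plane w).
Proof.
move=> [_ cD] Ju; split => [[a [b [J' [Ju' Dab E]]]]|Dw]; last first.
  by exists (complex.Re w), (complex.Im w), J.
have [-> //|->] := @spt_cases _ _ _ (Complex a b) Ju Ju' E.
exact: (cD (a, b)).
Qed.

Lemma csh_circularization (D : set (R * R)) w : conj_invariant D ->
  csh (circularization D) w <-> D (plane w).
Proof.
move=> cD; split => [[J Ju] /(circularizationE w cD Ju)//|Dw].
by have [J Ju] := exists_imag_unit R k_gt0; exists J => //; apply/circularizationE.
Qed.

Lemma circular_spt Om J w : circular Om -> imag_unit J -> Om (spt J w) <-> csh Om w.
Proof.
move=> [D cD ->] Ju; rewrite csh_circularization//; exact: circularizationE.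
Qed.

Lemma csh_conj Om w : csh Om w -> csh Om (conjc w).
Proof.
move=> [J Ju h]; exists (- J); first exact: imag_unitN.
by rewrite spt_conj opprK.
Qed.

Lemma spt_surj (x : A) : exists J w, imag_unit J /\ x = spt J w.
Proof.
have [J Ju [E _]] := slice_decomposition x k_gt0.
by exists J, (Complex (cd_re x) (enorm (cd_im x))).
Qed.

(** Circularity without reference to a plane set, which is recovered as [csh Om]. *)
Lemma circularP Om : circular Om <->
  (exists x, Om x) /\ forall J J' w, imag_unit J -> imag_unit J' -> Om (spt J w) -> Om (spt J' w).
Proof.
split=> [cOm|[[x Ox] H]].
  split; last first.
    by move=> J J' w Ju Ju' /(circular_spt w cOm Ju) /(circular_spt w cOm Ju').
  case: cOm => D [[z Dz] cD] ->; have [J Ju] := exists_imag_unit R k_gt0.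
  by exists (slice_pt z.1 z.2 J), z.1, z.2, J; case: z Dz.
exists [set z | csh Om (Complex z.1 z.2)].
  split; last by move=> [a b]; exact: csh_conj.
  by have [J [w [Ju E]]] := spt_surj x; exists (plane w); exists J => //; case: w E => a b /= <-.
apply/seteqP; split => y.
  have [J [w [Ju ->]]] := spt_surj y => Oy; exists (complex.Re w), (complex.Im w), J.
  by split => //; exists J => //; case: w Oy.
move=> [a [b [J [Ju [J' Ju' h] ->]]]]; exact: (H _ _ _ Ju' Ju h).
Qed.

Lemma circularI Om Om' : circular Om -> circular Om' -> (exists w, csh Om w /\ csh Om' w) ->
  circular (Om `&` Om').
Proof.
move=> cO cO' [w [h h']]; have [J Ju] := exists_imag_unit R k_gt0; apply/circularP; split.
  by exists (spt J w); split; apply/circular_spt.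
move=> J1 J2 w' u1 u2 [/circular_spt H1 /circular_spt H2].
by split; apply/circular_spt => //; [exact: H1|exact: H2].
Qed.

Lemma cshI Om Om' w : circular Om -> circular Om' ->
  csh (Om `&` Om') w <-> csh Om w /\ csh Om' w.
Proof.
move=> cO cO'; split => [[J Ju [h h']]|[h h']]; first by split; exists J.
have [J Ju] := exists_imag_unit R k_gt0; exists J => //.
by split; apply/circular_spt.
Qed.

Lemma csh_subset Om Om' w : Om `<=` Om' -> csh Om w -> csh Om' w.
Proof. by move=> sub [J Ju /sub h]; exists J. Qed.

Lemma spt_continuous J : continuous (fun z : R * R => slice_pt z.1 z.2 J : A).
Proof.
move=> z; rewrite /slice_pt /cd_real; apply: cvgD; apply: cvgZr_tmp => //.
  exact: cvg_fst.
exact: cvg_snd.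
Qed.

Lemma copen_csh Om : open Om -> copen (csh Om).
Proof.
move=> oO w [J Ju h].
have oD : open ((fun z : R * R => slice_pt z.1 z.2 J : A) @^-1` Om).
  by apply: open_comp => // z _; exact: spt_continuous.
have [r r0 Hr] := @open_plane _ _ w oD h.
by exists r => // w' /Hr; exists J.
Qed.

(** Membership in [Om] depends only on Re x + i |Im x|, a continuous function of x. *)
Lemma open_circular Om : circular Om -> copen (csh Om) -> open Om.
Proof.
move=> cO oU; rewrite openE => x Ox.
have [J Ju [Ex _]] := slice_decomposition x k_gt0.
pose q (y : A) := Complex (cd_re y) (enorm (cd_im y)).
have qP y : Om y <-> csh Om (q y).
  have [J' Ju' [Ey _]] := slice_decomposition y k_gt0.
  by rewrite -(circular_spt (q y) cO Ju') /spt /= -Ey.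
have [r r0 Hr] := oU _ ((qP x).1 Ox).
have c1 j : continuous (@cd_coord1 R j).
  elim: j => [|j IH] y /=; first exact: cvg_id.
  by apply: (continuous_comp _ (IH _)); exact: cvg_fst.
have c2 j : continuous (@cd_sumsq R j).
  elim: j => [|j IH] y /=; first exact: exprn_continuous.
  by apply: cvgD; apply: (continuous_comp _ (IH _)); [exact: cvg_fst|exact: cvg_snd].
have c_re : {for x, continuous (@cd_re R k)}.
  rewrite (_ : cd_re = @cd_coord1 R k); last by apply/funext => y; rewrite cd_reE.
  exact: c1.
have c_im : {for x, continuous (fun y : A => enorm (cd_im y))}.
  apply: (@continuous_comp _ _ _ (fun y : A => cd_sumsq (cd_im y)) Num.sqrt); last exact: sqrt_continuous.
  apply: (@continuous_comp _ _ _ (@cd_im R k) (@cd_sumsq R k)); last exact: c2.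
  by apply: cvgB; [exact: cvg_id|apply: cvgZr_tmp].
have r2 : 0 < r / 2 by rewrite divr_gt0.
move/cvgrPdist_lt : c_re => /(_ _ r2) n1; move/cvgrPdist_lt : c_im => /(_ _ r2) n2.
apply: filterS2 n1 n2 => y h1 h2; apply/qP/Hr; rewrite cabsB.
by apply: le_lt_trans (cabs_le_ReIm _) _; rewrite [ltRHS]splitr; exact: ltrD h1 h2.
Qed.

(** The automorphism sending i to -i, to be distinguished from the anti-automorphism [zconj], which
    fixes i. It expresses the parity of stem functions. *)
Definition zbar X : A * A := (X.1, - X.2).

Lemma zbarM X Y : zmul (zbar X) (zbar Y) = zbar (zmul X Y).
Proof. by apply: zpairP => s /=; rewrite !cd_linE !cd_coordE; ring. Qed.

Lemma zbarD X Y : zbar (X + Y) = zbar X + zbar Y.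
Proof. by rewrite /zbar /= opprD. Qed.

Lemma zbarZ (r : R) X : zbar (r *: X) = r *: zbar X.
Proof. by rewrite /zbar /= -scalerN. Qed.

Lemma zbar_conj X : zbar (zconj X) = zconj (zbar X).
Proof. by rewrite /zbar /zconj /= cd_conjN. Qed.

(** Half the sum of the two evaluations is the first component, half the difference is [J ** X.2],
    and left multiplication by [J] is invertible. *)
Lemma zeval_inj J X Y : imag_unit J -> zeval J X = zeval J Y -> zeval (- J) X = zeval (- J) Y ->
  X = Y.
Proof.
move=> Ju; case: X Y => [x x'] [y y']; rewrite /zeval /= !cd_mulNl => h1 h2.
have E1 : x = y.
  apply: cd_coordP => s; have := congr1 (cd_coord s) h1; have := congr1 (cd_coord s) h2.
  by rewrite !cd_coordE; lra.
congr pair => //; move: h1; rewrite E1 => /addrI /(congr1 (cd_mul J)).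
by rewrite !imag_unit_mulK// => /oppr_inj.
Qed.

(** Restates [regular_stem] for a stem function of a complex variable, known up to its values on
    [csh (dom f)]. Being a relation, it accepts explicit stems such as products in place of the one
    chosen by [stem]. *)
Definition is_stem f P :=
  [/\ circular (dom f), copen (csh (dom f)),
      forall w, csh (dom f) w -> zhol P w,
      forall w, csh (dom f) w -> P (conjc w) = zbar (P w)
    & forall J w, imag_unit J -> csh (dom f) w -> fn f (spt J w) = zeval J (P w)].

Lemma copen_plane (D : set (R * R)) : open D <-> copen (fun w => D (plane w)).
Proof.
split=> [oD w /(open_plane oD)//|oD]; rewrite openE => z.
have [w -> Dw] := plane_surj z; apply/nbhs_plane; exact: oD.
Qed.

Lemma regular_stemP f F : regular_stem (dom f) (fn f) F <-> is_stem f (zval F).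
Proof.
split.
  move=> [D [[cD oD E] [h1 h2 par val CR]]].
  have cO : circular (dom f) by exists D.
  have shE w : csh (dom f) w <-> D (plane w) by rewrite E; exact: csh_circularization.
  split=> //.
  - by move=> w /shE /(open_plane oD)[r r0 Hr]; exists r => // w' /Hr /shE.
  - by move=> w /shE; exact: stem_zhol h1 h2 CR _.
  - by move=> [a b] /shE /= /par [e1 e2]; rewrite /zval /= -[plane _]/(plane_conj (plane (Complex a b))) e1 e2.
  - by move=> J w Ju /shE Dw; exact: val.
move=> [cO oU hol par val]; have := cO; move=> [D cD E].
have shE w : csh (dom f) w <-> D (plane w) by rewrite E; exact: csh_circularization.
have oD : open D.
  by apply/copen_plane => w /shE /oU[r r0 Hr]; exists r => // w' /Hr /shE.
have [h1 h2 CR] := zhol_stem oD (fun w Dw => hol w ((shE w).2 Dw)).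
exists D; split => //; split => //.
- by move=> [a b] /(shE (Complex a b)) /par [e1 e2]; split.
- by move=> a b J /(shE (Complex a b)) Dw Ju; exact: val J (Complex a b) Ju Dw.
Qed.

Lemma is_stem_eq f P Q : (forall w, csh (dom f) w -> P w = Q w) -> is_stem f P -> is_stem f Q.
Proof.
move=> PQ [h1 h2 h3 h4 h5]; split => //.
- move=> w Uw; have [r r0 Hr] := h2 _ Uw.
  by apply: (zhol_eq_near r0 _ (h3 _ Uw)) => c /Hr /PQ.
- by move=> w Uw; rewrite -!PQ ?h4//; exact: csh_conj.
- by move=> J w Ju Uw; rewrite h5// PQ.
Qed.

Lemma is_stem_regular f P : is_stem f P -> slice_regular (dom f) (fn f).
Proof.
move=> sP; exists (fun z => (P (Complex z.1 z.2)).1, fun z => (P (Complex z.1 z.2)).2).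
apply/regular_stemP; apply: is_stem_eq sP => -[a b] _; rewrite /zval /=.
by case: (P _).
Qed.

Lemma stem_is_stem f : slice_regular (dom f) (fn f) -> is_stem f (zval (stem f)).
Proof.
by move=> [F HF]; apply/regular_stemP; rewrite /stem; case: xgetP => [G _ //|/(_ F)].
Qed.

Lemma is_stem_uniq f g P Q w : is_stem f P -> is_stem g Q -> csh (dom f) w -> csh (dom g) w ->
  (forall J, imag_unit J -> fn f (spt J w) = fn g (spt J w)) -> P w = Q w.
Proof.
move=> [_ _ _ _ vf] [_ _ _ _ vg] Uw Vw fg; have [J Ju] := exists_imag_unit R k_gt0.
have Ju' := imag_unitN Ju.
by apply: (zeval_inj Ju); rewrite -vf// -vg// fg.
Qed.

Lemma stemE f P w : is_stem f P -> csh (dom f) w -> zval (stem f) w = P w.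
Proof.
move=> sP Uw; apply: (is_stem_uniq (stem_is_stem (is_stem_regular sP)) sP Uw Uw) => //.
Qed.

(** [induced] reads the stem only in the closed upper half plane; for [Im w < 0] it uses the
    conjugate point and the unit [- J], and parity cancels the two changes. On the real axis parity
    forces the second component to vanish. *)
Lemma induced_spt F (H : C -> A * A) w J : imag_unit J ->
  zval F w = H w -> zval F (conjc w) = H (conjc w) -> H (conjc w) = zbar (H w) ->
  Defs.induced F (spt J w) = zeval J (H w).
Proof.
move=> Ju; case: w => a b E1 E2 par; rewrite /Defs.induced /= /spt.
rewrite !cd_re_slice// !cd_im_slice// !enorm_unitZ//.
have [b0|b0|b0] := ltgtP b 0.
- rewrite (ltr0_norm b0) scalerA invrN mulNr mulVf ?lt_eqF// scaleN1r.
  move: E2; rewrite par /zval /plane /= => -[-> ->].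
  by rewrite /zeval cd_mulNl cd_mulNr opprK.
- rewrite (gtr0_norm b0) scalerA mulVf ?gt_eqF// scale1r.
  by move: E1; rewrite /zval /plane /= => <-.
- rewrite b0 normr0 scale0r scaler0 cd_mul0l addr0.
  move: E1 par; rewrite b0 /zval /plane /= oppr0 => <-; rewrite /zbar /= => -[] E.
  have -> : F.2 (a, 0) = 0.
    by apply: cd_coordP => s; have := congr1 (cd_coord s) E; rewrite !cd_coordE; lra.
  by rewrite /zeval /= cd_mul0r addr0.
Qed.

(** A common point is assumed because circular sets are nonempty. *)
Lemma is_stem_mul f g P Q : is_stem f P -> is_stem g Q ->
  (exists w, csh (dom f) w /\ csh (dom g) w) -> is_stem (pmul f g) (fun w => zmul (P w) (Q w)).
Proof.
move=> sP sQ ne; have [cf of_ hf pf vf] := sP; have [cg og hg pg vg] := sQ.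
have shE w : csh (dom (pmul f g)) w <-> csh (dom f) w /\ csh (dom g) w by exact: cshI.
split.
- exact: circularI.
- move=> w /shE[/of_[r r0 Hr] /og[s s0 Hs]]; exists (Num.min r s); first by rewrite lt_min r0.
  by move=> w'; rewrite lt_min => /andP[/Hr h1 /Hs h2]; apply/shE.
- by move=> w /shE[/hf h1 /hg h2]; exact: zhol_mul.
- by move=> w /shE[/pf -> /pg ->]; rewrite zbarM.
- move=> J w Ju /shE[Uw Vw].
  apply: (@induced_spt _ (fun w => zmul (P w) (Q w)))=> //; last by rewrite pf// pg// zbarM.
    by rewrite -(stemE sP Uw) -(stemE sQ Vw).
  by rewrite -(stemE sP (csh_conj Uw)) -(stemE sQ (csh_conj Vw)).
Qed.

Lemma is_stem_conj f P : is_stem f P -> is_stem (pconj f) (fun w => zconj (P w)).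
Proof.
move=> sP; have [cf of_ hf pf vf] := sP; split => //.
- by move=> w /hf; exact: zhol_conj.
- by move=> w /pf ->; rewrite zbar_conj.
- move=> J w Ju Uw; apply: (@induced_spt _ (fun w => zconj (P w))) => //.
  + by rewrite -(stemE sP Uw).
  + by rewrite -(stemE sP (csh_conj Uw)).
  + by rewrite pf// zbar_conj.
Qed.

Lemma is_stem_add f g P Q : is_stem f P -> is_stem g Q ->
  (exists w, csh (dom f) w /\ csh (dom g) w) -> is_stem (padd f g) (fun w => P w + Q w).
Proof.
move=> sP sQ ne; have [cf of_ hf pf vf] := sP; have [cg og hg pg vg] := sQ.
have shE w : csh (dom (padd f g)) w <-> csh (dom f) w /\ csh (dom g) w by exact: cshI.
split.
- exact: circularI.
- move=> w /shE[/of_[r r0 Hr] /og[s s0 Hs]]; exists (Num.min r s); first by rewrite lt_min r0.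
  by move=> w'; rewrite lt_min => /andP[/Hr h1 /Hs h2]; apply/shE.
- by move=> w /shE[/hf h1 /hg h2]; exact: zholD.
- by move=> w /shE[/pf -> /pg ->]; rewrite zbarD.
- move=> J w Ju /shE[Uw Vw] /=; rewrite vf// vg// /zeval /= cd_mulDr addrACA//.
Qed.

Lemma is_stem_scale r f P : is_stem f P -> is_stem (pscale r f) (fun w => r *: P w).
Proof.
move=> [cf of_ hf pf vf]; split => //.
- by move=> w /hf; exact: zholZ.
- by move=> w /pf ->; rewrite zbarZ.
- by move=> J w Ju Uw /=; rewrite vf// /zeval /= cd_mulZr scalerDr.
Qed.

Lemma is_stem_cst Om a : circular Om -> copen (csh Om) -> is_stem (pcst Om a) (fun=> (a, 0)).
Proof.
move=> cO oO; split => //.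
- by move=> w _; exact: zhol_cst.
- by move=> w _; rewrite /zbar /= oppr0.
- by move=> J w Ju _; rewrite /zeval /= cd_mul0r addr0.
Qed.

End SliceStems.

(** * Poles and growth *)

Section LaurentTerms.
Variables (R : realType) (k : nat).
Hypothesis hk : (1 <= k <= 3)%N.
Local Notation A := (CD R k).
Local Notation C := R[i].
Local Notation "x ** y" := (cd_mul x y) (at level 40, left associativity).
Local Notation one := (cd_one R k).
Implicit Types (w c d : C) (J x y : A) (P Q : C -> A * A) (f g : pfun R k).

Let k_gt0 : (0 < k)%N. Proof. by case/andP: hk. Qed.
Let k_le3 : (k <= 3)%N. Proof. by case/andP: hk. Qed.

Lemma cactD J c x y : cact J c (x + y) = cact J c x + cact J c y.
Proof. by rewrite /cact cd_mulDr; apply: cd_coordP => s; rewrite !cd_coordE; ring. Qed.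

Lemma cactN J c x : cact J c (- x) = - cact J c x.
Proof. by rewrite /cact cd_mulNr; apply: cd_coordP => s; rewrite !cd_coordE; ring. Qed.

Lemma cactB J c x y : cact J c (x - y) = cact J c x - cact J c y.
Proof. by rewrite cactD cactN. Qed.

Lemma cact_addl J c d x : cact J (c + d) x = cact J c x + cact J d x.
Proof.
by case: c d => [a b] [a' b']; rewrite /cact /=; apply: cd_coordP => s; rewrite !cd_coordE; ring.
Qed.

Lemma cact_mulr J c x : imag_unit J -> cact J c one ** x = cact J c x.
Proof. by move=> Ju; rewrite /cact cd_mul1r !cd_linE. Qed.

(* The elements of the complexification of C_J. *)
Definition jpair J c d : A * A := (cact J c one, cact J d one).

Lemma jpair_mul J c d c' d' : imag_unit J ->
  zmul (jpair J c d) (jpair J c' d') = jpair J (c * c' - d * d') (c * d' + d * c').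
Proof.
move=> Ju; rewrite /zmul /jpair /= !cact_mulr// !cactM//.
by rewrite !cact_addl -cactN; congr pair; congr (_ + _); rewrite /cact /=;
  apply: cd_coordP => s; rewrite ?cd_linE !cd_coordE; ring.
Qed.

Lemma jpair_scale J e c d : imag_unit J ->
  zscale e (jpair J c d) =
  jpair J ((complex.Re e)%:C%C * c - (complex.Im e)%:C%C * d)
          ((complex.Re e)%:C%C * d + (complex.Im e)%:C%C * c).
Proof.
move=> Ju; case: e c d => [e1 e2] [c1 c2] [d1 d2]; rewrite /jpair /zscale /cact /=.
by congr pair; apply: cd_coordP => s; rewrite !cd_coordE; ring.
Qed.

(** Sending i to [J] maps the complexification of C_J multiplicatively to C_J, and [c + 'i%C * d] is
    the image of the pair. *)
Lemma jpair_eval J c d x : imag_unit J ->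
  zeval J (zmul (jpair J c d) (x, 0)) = cact J (c + 'i%C * d) x.
Proof.
move=> Ju; rewrite /zeval /zmul /jpair /= !cd_mul0r subr0 add0r !cact_mulr//.
case: c d => [c1 c2] [d1 d2]; rewrite /cact /= !cd_linE imag_unit_mulK//.
by apply: cd_coordP => s; rewrite !cd_coordE; ring.
Qed.

Definition lin_stem y w : A * A := zscalar k w - (y, 0).

Lemma zhol_scalar w : zhol (fun w : C => zscalar k w) w.
Proof.
move=> s; have [c [_ Hc]] := @cd_coord_one R k s.
exists (1 * c%:C%C + 0 * w)%R.
have := sdiffM (@sdiff_id R w) (@sdiff_cst R c%:C%C w).
rewrite (_ : w * 0 + 1 * c%:C%C = 1 * c%:C%C + 0 * w); last by ring.
apply: (sdiff_eq_near (@ltr01 R)) => -[a b] _.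
by apply/eqP; rewrite eq_complex /= !cd_coordZ Hc !mulr0 subr0 add0r !eqxx.
Qed.

Lemma zhol_lin y w : zhol (lin_stem y) w.
Proof. by apply: zholD; [exact: zhol_scalar|exact: zhol_cst]. Qed.

Lemma lin_stem_conj y w : lin_stem y (conjc w) = zbar (lin_stem y w).
Proof.
by case: w => a b; rewrite /lin_stem /zbar /zscalar /=; congr pair; rewrite /= ?subr0 ?scaleNr.
Qed.

Lemma zeval_lin J y w : imag_unit J -> zeval J (lin_stem y w) = spt J w - y.
Proof.
by move=> Ju; rewrite /zeval /= subr0 cd_mulZr cd_mul1r addrAC.
Qed.

Lemma lin_stem_jpair J w0 w : imag_unit J ->
  lin_stem (spt J w0) w = jpair J ((complex.Re w)%:C%C - w0) (complex.Im w)%:C%C.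
Proof.
move=> Ju; case: w w0 => [a b] [a0 b0]; rewrite /lin_stem /spt /slice_pt /cd_real /jpair /cact /=.
by congr pair; apply: cd_coordP => s; rewrite /= ?cd_mul1r !cd_coordE; ring.
Qed.

Lemma spt_conjE J w : imag_unit J -> cd_conj (spt J w) = spt J (conjc w).
Proof.
move=> Ju; case: w => a b; rewrite /spt /slice_pt /cd_real /= cd_conjD !cd_conjZ cd_conj1.
have [J0 _] := (imag_unitP J).1 Ju.
by rewrite cd_conjE J0 mulr0 scale0r sub0r scalerN scaleNr.
Qed.

Lemma csh_setT w : csh (setT : set A) w.
Proof. by have [J Ju] := exists_imag_unit R k_gt0; exists J. Qed.

Lemma copen_setT : copen (csh (setT : set A)).
Proof. by move=> w _; exists 1 => // w' _; exact: csh_setT. Qed.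

Lemma circular_setT : circular (setT : set A).
Proof. by apply/(circularP hk); split => //; exists 0. Qed.

Lemma is_stem_lin y : is_stem (PFun setT (fun x => x - y)) (lin_stem y).
Proof.
split=> //; first exact: circular_setT.
- exact: copen_setT.
- by move=> w _; exact: zhol_lin.
- by move=> w _; exact: lin_stem_conj.
- by move=> J w Ju _; rewrite zeval_lin.
Qed.

Lemma dom_ppow f n : dom (ppow f n) = dom f.
Proof. by elim: n => [//|n IH]; rewrite /ppow iterS /= -/(ppow f n) IH setIid. Qed.

Lemma is_stem_pow f P n : (exists w, csh (dom f) w) -> is_stem f P ->
  is_stem (ppow f n) (fun w => iter n (zmul (P w)) (one, 0)).
Proof.
move=> [w0 Uw0] sP; elim: n => [|n IH].
  by apply: is_stem_cst; have [] := sP.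
rewrite /ppow iterS -/(ppow f n) /=; apply: (is_stem_mul hk sP IH).
by exists w0; rewrite dom_ppow.
Qed.

Lemma sphere_ofE J w0 I w : imag_unit J -> imag_unit I ->
  sphere_of (spt J w0) (spt I w) <-> w = w0 \/ w = conjc w0.
Proof.
move=> Ju Iu; split.
  move=> [a [b [J' [I' [J'u I'u E1 E2]]]]].
  have := @spt_cases R k _ _ _ (Complex a b) Ju J'u E1.
  have := @spt_cases R k _ _ _ (Complex a b) Iu I'u E2.
  move=> [->|->] [->|->]; rewrite ?conjcK; by [left|right].
move=> [->|->].
  by exists (complex.Re w0), (complex.Im w0), J, I.
exists (complex.Re w0), (complex.Im w0), J, (- I); split => //; first exact: imag_unitN.
by rewrite (spt_conj I w0).
Qed.

Definition delta_fun w0 w : C := (w - w0) * (w - conjc w0).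

(** The polynomial has real coefficients, so on every slice it is given by the same complex
    polynomial, with roots [w0] and its conjugate. *)
Lemma DeltaE J w0 I w : imag_unit J -> imag_unit I ->
  Delta (spt J w0) (spt I w) = cact I (delta_fun w0 w) one.
Proof.
move=> Ju Iu; rewrite /Delta cd_traceE (cd_coord1_slice _ _ Ju) /cd_n spt_conjE//.
rewrite /delta_fun /spt !slice_ptE !cact_mulr// !cactM//.
case: w w0 => [a b] [a0 b0]; rewrite /cact /= !cd_linE.
by apply: cd_coordP => s; rewrite !cd_coordE; ring.
Qed.

Lemma cd_inv_cact I c : imag_unit I -> cd_inv (cact I c one) = cact I c^-1 one.
Proof.
move=> Iu; have [I0 I1] := (imag_unitP I).1 Iu.
have := @spt_conjE I c Iu; rewrite /spt !slice_ptE /cd_inv => ->.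
have -> : cd_sumsq (cact I c one) = complex.Re c ^+ 2 + complex.Im c ^+ 2.
  rewrite -slice_ptE -enormE enorm_slice// cabs_sqr//.
case: c => a b; rewrite /cact /=; apply: cd_coordP => s; rewrite !cd_linE !cd_coordE.
by rewrite mulrDr; congr (_ + _); rewrite mulrA [_^-1 * _]mulrC ?mulNr.
Qed.

Lemma csh_sphereC J w0 w : imag_unit J ->
  csh (~` sphere_of (spt J w0)) w <-> w != w0 /\ w != conjc w0.
Proof.
move=> Ju; split=> [[I Iu nS]|[n1 n2]].
  by split; apply/eqP => E; apply: nS; apply/sphere_ofE => //; [left|right].
have [I Iu] := exists_imag_unit R k_gt0; exists I => // /sphere_ofE-/(_ Ju Iu)[]; exact/eqP.
Qed.

Lemma is_stem_inv J w0 : imag_unit J ->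
  is_stem (PFun (~` sphere_of (spt J w0))
             (fun x => cd_inv (Delta (spt J w0) x) ** (x - cd_conj (spt J w0))))
    (fun w => zscale (delta_fun w0 w)^-1 (lin_stem (cd_conj (spt J w0)) w)).
Proof.
move=> Ju; have shE := csh_sphereC w0 _ Ju.
have d0 w : csh (~` sphere_of (spt J w0)) w -> delta_fun w0 w != 0.
  by move=> /shE[n1 n2]; rewrite mulf_neq0// subr_eq0.
split => //=.
- apply/(circularP hk); split.
    (* The shift exceeds [2 * |w0|], an upper bound for the distance between [w0] and its conjugate;
       so this point avoids the sphere. *)
    have [I Iu] := exists_imag_unit R k_gt0; exists (spt I (w0 + (1 + cabs w0)%:C%C * 2)).
    move=> /sphere_ofE-/(_ Ju Iu).
    have c0 := cabs_ge0 w0.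
    have h0 : 0 < cabs ((1 + cabs w0)%:C%C * 2) by rewrite cabs_gt0 mulf_neq0 ?pnatr_eq0// eq_complex /= eqxx andbT gt_eqF//; lra.
    move=> [E|E]; have := congr1 (fun c => c - w0) E; rewrite addrC addKr => E'.
      by move: h0; rewrite E' subrr cabs0 ltxx.
    have := congr1 (@cabs R) E'; rewrite cabsM cabs_nat cabs_real ger0_norm; last by lra.
    have := cabsBD (conjc w0) w0.
    have -> : cabs (conjc w0) = cabs w0 by case: (w0) => a b; rewrite /cabs /= sqrrN.
    lra.
  move=> I I' w Iu Iu' nS /sphere_ofE-/(_ Ju Iu') E; apply: nS.
  exact/sphere_ofE.
- move=> w /shE[n1 n2].
  have c1 : 0 < cabs (w - w0) by rewrite cabs_gt0 subr_eq0.
  have c2 : 0 < cabs (w - conjc w0) by rewrite cabs_gt0 subr_eq0.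
  exists (Num.min (cabs (w - w0)) (cabs (w - conjc w0))); first by rewrite lt_min c1.
  by move=> w'; rewrite lt_min => /andP[h1 h2]; apply/shE; split;
    [apply: contraTneq h1 => ->|apply: contraTneq h2 => ->]; rewrite cabsB ltxx.
- move=> w Uw.
  have hd : sdiff (delta_fun w0) w ((w - w0) * (1 + 0) + (1 + 0) * (w - conjc w0)).
    apply: (@sdiffM R (fun w => w - w0) (fun w => w - conjc w0)).
      exact: sdiffD (sdiff_id w) (sdiff_cst (- w0) w).
    exact: sdiffD (sdiff_id w) (sdiff_cst (- conjc w0) w).
  by apply: (zhol_scale (sdiffV hd (d0 _ Uw))); exact: zhol_lin.
- move=> w Uw; rewrite lin_stem_conj.
  have -> : delta_fun w0 (conjc w) = conjc (delta_fun w0 w).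
    by rewrite /delta_fun; case: w w0 {shE d0 Uw} => [a b] [a0 b0]; apply/eqP;
       rewrite eq_complex /=; apply/andP; split; apply/eqP; ring.
  rewrite -conjc_inv; case: (_^-1) => e1 e2; apply: zpairP => s; rewrite /zbar /=;
    by rewrite !cd_coordE; ring.
- move=> I w Iu Uw; rewrite DeltaE// cd_inv_cact// cact_mulr//.
  by rewrite -cact_eval// zeval_lin.
Qed.

Definition zpow w (n : int) : C := match n with Posz m => w ^+ m | Negz m => w^-1 ^+ m.+1 end.

(** All factors but the last lie in the commutative and associative complexification of C_J, so
    slice powers evaluate to ordinary powers. *)
Lemma iter_jpair J c d n x : imag_unit J ->
  zeval J (zmul (iter n (zmul (jpair J c d)) (one, 0)) (x, 0)) = cact J ((c + 'i%C * d) ^+ n) x.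
Proof.
move=> Ju.
have [c' [d' [E1 E2]]] : exists c' d', iter n (zmul (jpair J c d)) (one, 0) = jpair J c' d' /\
    c' + 'i%C * d' = (c + 'i%C * d) ^+ n.
  elim: n => [|n [c' [d' [E1 E2]]]].
    exists 1, 0; rewrite mulr0 addr0 expr0; split => //.
    by rewrite /jpair cact1 /cact /= !scale0r addr0.
  exists (c * c' - d * d'), (c * d' + d * c'); rewrite iterS E1 jpair_mul// exprS -E2; split => //.
  have i2 : 'i%C * 'i%C = -1 :> C by rewrite -expr2 sqr_i.
  rewrite [RHS](_ : _ = c * c' + 'i%C * 'i%C * (d * d') + 'i%C * (c * d' + d * c')); last by ring.
  by rewrite i2 mulN1r.
by rewrite E1 jpair_eval// E2.
Qed.

Lemma complex_ReIm w : (complex.Re w)%:C%C + 'i%C * (complex.Im w)%:C%C = w.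
Proof. by rewrite -complexE. Qed.

Lemma inv_stem_jpair J w0 w : imag_unit J -> w != w0 -> w != conjc w0 ->
  exists c d, zscale (delta_fun w0 w)^-1 (lin_stem (cd_conj (spt J w0)) w) = jpair J c d /\
    c + 'i%C * d = (w - w0)^-1.
Proof.
move=> Ju n1 n2; rewrite spt_conjE// lin_stem_jpair// jpair_scale//.
set e := (delta_fun w0 w)^-1; do 2!eexists; split; first by [].
rewrite [LHS](_ : _ = ((complex.Re e)%:C%C + 'i%C * (complex.Im e)%:C%C) *
   (((complex.Re w)%:C%C + 'i%C * (complex.Im w)%:C%C) - conjc w0)
   - ('i%C * 'i%C + 1) * ((complex.Im e)%:C%C * (complex.Im w)%:C%C)); last by ring.
have i2 : 'i%C * 'i%C = -1 :> C by rewrite -expr2 sqr_i.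
rewrite i2 addNr mul0r subr0 !complex_ReIm /e /delta_fun; field.
by rewrite !subr_eq0 n1 n2.
Qed.

(** On the slice through the centre, a slice Laurent term is an ordinary Laurent term in [w - w0]
    acting on [a n]. The conjugate of [w0] is excluded because negative powers are undefined on the
    whole sphere. *)
Lemma laurent_termE J w0 w (a : int -> A) n : imag_unit J ->
  w != w0 -> w != conjc w0 ->
  laurent_term (spt J w0) a n (spt J w) = cact J (zpow (w - w0) n) (a n).
Proof.
move=> Ju n1 n2; rewrite /laurent_term.
have sc := is_stem_cst (a n) circular_setT copen_setT.
have key f P m : is_stem f P -> csh (dom f) w ->
    fn (pmul (ppow f m) (pcst setT (a n))) (spt J w) =
    zeval J (zmul (iter m (zmul (P w)) (one, 0)) (a n, 0)).
  move=> sP Uw.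
  have ne : exists w, csh (dom f) w by exists w.
  have U1 : csh (dom (ppow f m)) w by rewrite dom_ppow.
  have ne' : exists w, csh (dom (ppow f m)) w /\ csh (dom (pcst setT (a n))) w.
    by exists w; split => //; exact: csh_setT.
  have [_ _ _ _ v] := is_stem_mul hk (is_stem_pow m ne sP) sc ne'.
  rewrite v//; apply/cshI => //; last by split => //; exact: csh_setT.
    by have [] := is_stem_pow m ne sP.
  exact: circular_setT.
case: n sc key => m sc key.
  rewrite (key _ _ m (is_stem_lin (spt J w0)) (csh_setT w)) lin_stem_jpair// iter_jpair//.
  by rewrite addrAC complex_ReIm.
have Uw : csh (~` sphere_of (spt J w0)) w by apply/csh_sphereC.
have [c [d [E1 E2]]] := inv_stem_jpair Ju n1 n2.
by rewrite (key _ _ m.+1 (is_stem_inv w0 Ju) Uw) E1 (iter_jpair c d m.+1 _ Ju) E2.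
Qed.

End LaurentTerms.

Section CayleyDicksonNorm.
Variable R : realType.
Local Notation "x ** y" := (cd_mul x y) (at level 40, left associativity).

Lemma cd_norm_pair k (x : CD R k.+1) : `|x| = Num.max `|x.1| `|x.2|.
Proof. by []. Qed.

Lemma cd_coord_norm k s (x : CD R k) : `|cd_coord s x| <= `|x|.
Proof.
elim: k s x => [//|k IH] s x; rewrite cd_norm_pair le_max /=.
by case: head; rewrite IH ?orbT.
Qed.

Lemma cd_norm_le k (x : CD R k) K : (forall s, `|cd_coord s x| <= K) -> `|x| <= K.
Proof.
elim: k x => [|k IH] x H; first exact: (H [::]).
by rewrite cd_norm_pair ge_max !IH// => s; [exact: (H (true :: s))|exact: (H (false :: s))].
Qed.

Lemma cd_norm_conj k (x : CD R k) : `|cd_conj x| = `|x|.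
Proof.
by elim: k x => [//|k IH] x; rewrite !cd_norm_pair /= IH normrN.
Qed.

Lemma cd_norm_mul k (x y : CD R k) : `|x ** y| <= 2 ^+ k * (`|x| * `|y|).
Proof.
elim: k x y => [|k IH] x y; first by rewrite expr0 mul1r normrM.
have px (z : CD R k.+1) : `|z.1| <= `|z| /\ `|z.2| <= `|z|.
  by rewrite cd_norm_pair !le_max !lexx orbT.
have [[x1 x2] [y1 y2]] := (px x, px y).
have half (u v : CD R k) : `|u| <= `|x| -> `|v| <= `|y| -> `|u ** v| <= 2 ^+ k * (`|x| * `|y|) /\
    `|v ** u| <= 2 ^+ k * (`|x| * `|y|).
  move=> hu hv; split; first by rewrite (le_trans (IH _ _))// ler_wpM2l ?exprn_ge0// ler_pM.
  by rewrite (le_trans (IH _ _))// ler_wpM2l ?exprn_ge0// mulrC ler_pM.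
rewrite exprS -mulrA mulr_natl mulr2n cd_norm_pair ge_max /=; apply/andP; split.
  rewrite (le_trans (ler_normB _ _))// lerD//.
    exact: (half x.1 y.1 x1 y1).1.
  by apply: (half x.2 (cd_conj y.2) x2 _).2; rewrite cd_norm_conj.
rewrite (le_trans (ler_normD _ _))// lerD//.
  exact: (half x.1 y.2 x1 y2).2.
by apply: (half x.2 (cd_conj y.1) x2 _).1; rewrite cd_norm_conj.
Qed.

(** The maximum norm is not multiplicative; this constant bounds the action of [J] on it. *)
Definition act_const k (J : CD R k) : R := 1 + 2 ^+ k * `|J|.

Lemma act_const_ge1 k (J : CD R k) : 1 <= act_const J.
Proof. by rewrite lerDl mulr_ge0// exprn_ge0. Qed.

Lemma cact_norm k (J x : CD R k) c : `|cact J c x| <= cabs c * (act_const J * `|x|).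
Proof.
rewrite (le_trans (ler_normD _ _))// !normrZ /act_const mulrDl mul1r mulrDr lerD//.
  by rewrite ler_wpM2r// ler_Re_cabs.
by rewrite ler_pM// ?ler_Im_cabs// -mulrA cd_norm_mul.
Qed.

Lemma zeval_norm k (J : CD R k) X : `|zeval J X| <= act_const J * (`|X.1| + `|X.2|).
Proof.
rewrite (le_trans (ler_normD _ _))// mulrDr lerD//.
  by rewrite ler_peMl// act_const_ge1.
rewrite (le_trans (cd_norm_mul _ _))// mulrA ler_wpM2r// /act_const lerDr//.
Qed.

End CayleyDicksonNorm.

(** * From poles to growth of the stem function *)

Section Growth.
Variables (R : realType) (k : nat).
Hypothesis hk : (1 <= k <= 3)%N.
Local Notation A := (CD R k).
Local Notation C := R[i].
Local Notation "x ** y" := (cd_mul x y) (at level 40, left associativity).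
Implicit Types (w c d : C) (J x y : A) (P Q : C -> A * A) (f g : pfun R k) (U V : set C).

Let k_gt0 : (0 < k)%N. Proof. by case/andP: hk. Qed.
Let k_le3 : (k <= 3)%N. Proof. by case/andP: hk. Qed.

(* In terms of the stem function P, w0 is at most a pole. *)
Definition growth j (P : C -> CD R j * CD R j) U w0 := exists (r : R) (m : nat) (K : R), 0 < r /\
  forall h, h != 0 -> cabs h < r ->
    U (w0 + h) /\ zbounded K (zscale (h ^+ m) (P (w0 + h))).

Lemma zhol_bounded j (P : C -> CD R j * CD R j) w0 : zhol P w0 ->
  exists (r K : R), 0 < r /\ forall w, cabs (w - w0) < r -> zbounded K (P w).
Proof.
elim: j P => [|j IH] P hP.
  have [d hd] := hP [::]; have [M [r [M0 r0 H]]] := sdiff_bounded hd.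
  by exists r, M; split => // w wr s; have := H _ wr.
have h1 : zhol (fun c => ((P c).1.1, (P c).2.1)) w0 by move=> s; have := hP (false :: s).
have h2 : zhol (fun c => ((P c).1.2, (P c).2.2)) w0 by move=> s; have := hP (true :: s).
have [r [K [r0 H]]] := IH _ h1; have [r' [K' [r0' H']]] := IH _ h2.
exists (Num.min r r'), (Num.max K K'); split; first by rewrite lt_min r0.
move=> w; rewrite lt_min => /andP[wr wr'] s; rewrite /zcoord /= le_max.
by case: head; [rewrite (H' _ wr' (behead s)) orbT|rewrite (H _ wr (behead s))].
Qed.

Lemma growth_regular P U w0 : copen U -> U w0 -> zhol P w0 -> growth P U w0.
Proof.
move=> oU Uw0 /zhol_bounded[r [K [r0 HK]]]; have [s s0 Hs] := oU _ Uw0.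
exists (Num.min r s), 0%N, K; split; first by rewrite lt_min r0.
move=> h h0; rewrite lt_min => /andP[hr hs].
have E : w0 + h - w0 = h by rewrite addrC addKr.
by split; [apply: Hs; rewrite E|rewrite expr0 zscale1; apply: HK; rewrite E].
Qed.

Lemma spt_sub J w w0 : spt J w - spt J w0 = spt J (w - w0).
Proof. by rewrite /spt slice_ptB; case: w w0 => [a b] [a' b']. Qed.

Lemma tau_sigma_spt J w w0 : imag_unit J ->
  tau (spt J w) (spt J w0) = cabs (w - w0) /\ Defs.sigma (spt J w) (spt J w0) = cabs (w - w0).
Proof.
move=> Ju; have cs : common_slice (spt J w) (spt J w0).
  by exists J => //; split; [exists (complex.Re w), (complex.Im w)|exists (complex.Re w0), (complex.Im w0)].
rewrite /tau /Defs.sigma; case: asboolP => // _; rewrite spt_sub /spt enorm_slice//.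
by case: (w - w0).
Qed.

Lemma Sigma0_spt J w0 h r : imag_unit J -> h != 0 -> cabs h < r ->
  Sigma0 (spt J w0) r (spt J (w0 + h)).
Proof.
move=> Ju h0 hr; have [E1 E2] := tau_sigma_spt (w0 + h) w0 Ju.
by rewrite /Sigma0 /= E1 E2 [w0 + h]addrC addrK cabs_gt0.
Qed.

Lemma series_bounded (V : normedModType R) (u : nat -> V) : cvg (series u @ \oo) ->
  exists2 M : R, 0 <= M & forall n, `|u n| <= M.
Proof.
move=> /cvg_series_cvg_0 u0.
have /cvg_seq_bounded/pinfty_ex_gt0[M M0 /= HM] : cvgn u by apply/cvg_ex; exists 0.
by exists M; [exact: ltW|move=> n; exact: HM].
Qed.

Lemma norm_limit_le (V : normedModType R) (u : nat -> V) l (c B : R) : u @ \oo --> l ->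
  (forall n, c * `|u n| <= B) -> c * `|l| <= B.
Proof.
move=> ul H; apply: (@cvgr_to_le nat \oo _ R (fun n => c * `|u n|)).
  by apply: cvgM; [exact: cvg_cst|exact: cvg_norm].
by exists 0%N.
Qed.

(** Provides the two exclusions of [laurent_termE] near the centre, real or not. *)
Lemma avoid_conj w0 : exists2 r : R, 0 < r & forall h, h != 0 -> cabs h < r ->
  w0 + h != w0 /\ w0 + h != conjc w0.
Proof.
have E h : h != 0 -> w0 + h != w0 by rewrite -[w0 + h == w0]subr_eq0 [w0 + h]addrC addrK.
have [e0|e0] := eqVneq (conjc w0) w0.
  by exists 1 => // h h0 _; rewrite e0 E.
exists (cabs (conjc w0 - w0)); first by rewrite cabs_gt0 subr_eq0.
move=> h h0 hr; split; first exact: E.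
by apply: contraTneq hr => <-; rewrite [w0 + h]addrC addrK ltxx.
Qed.

(** As in Abel's lemma, convergence at one point at distance [rho] bounds [a n] by [M / rho ^ n], so
    the regular part stays bounded for [|h| < rho / 2]. The principal part has at most [m] terms,
    each bounded after multiplication by [|h| ^ m]. *)
Lemma pole_growth f w0 J : imag_unit J -> pole f (spt J w0) -> circular (dom f) ->
  exists (r : R) (m : nat) (K : R), 0 < r /\ forall h, h != 0 -> cabs h < r ->
    csh (dom f) (w0 + h) /\ cabs h ^+ m * `|fn f (spt J (w0 + h))| <= K.
Proof.
move=> Ju [r [r0 Sub [a La [m am]]]] cf.
have [r' r'0 av] := avoid_conj w0.
pose rho := Num.min (Num.min r r') 1 / 2.
have rho0 : 0 < rho by rewrite divr_gt0// !lt_min r0 r'0 ltr01.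
have [rr rr' r1] : [/\ rho < r, rho < r' & rho <= 1].
  have h1 : 2 * rho <= r by rewrite /rho mulrC divfK// !ge_min lexx.
  have h2 : 2 * rho <= r' by rewrite /rho mulrC divfK// !ge_min lexx orbT.
  have h3 : 2 * rho <= 1 by rewrite /rho mulrC divfK// !ge_min lexx !orbT.
  by split; lra.
have U h : h != 0 -> cabs h < r -> csh (dom f) (w0 + h).
  by move=> h0 hr; apply/(circular_spt hk _ cf Ju)/Sub/Sigma0_spt.
have term h n : h != 0 -> cabs h < r' ->
    laurent_term (spt J w0) a n (spt J (w0 + h)) = cact J (zpow h n) (a n).
  move=> h0 hr; have [n1 n2] := av _ h0 hr.
  by rewrite (laurent_termE hk)// [w0 + h]addrC addrK.
have rhoC : cabs rho%:C%C = rho by rewrite cabs_real gtr0_norm.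
have rhoC0 : rho%:C%C != 0 by rewrite -cabs_gt0 rhoC.
have rhor : cabs rho%:C%C < r by rewrite rhoC.
have [s1 [_ [cs1 _ _]]] := La _ (Sigma0_spt w0 Ju rhoC0 rhor).
have [M M0 HM] := series_bounded (cvgP _ cs1).
have aM n : `|a (Posz n)| <= M / rho ^+ n.
  have := HM n; rewrite term ?rhoC//= => h.
  rewrite ler_pdivlMr ?exprn_gt0// mulrC (le_trans _ h)// -rmorphXn /cact /= scale0r addr0.
  by rewrite normrZ ger0_norm// exprn_ge0// ltW.
pose N := \sum_(i < m) act_const J * `|a (Negz i)|.
have cJ := act_const_ge1 J.
have cJ0 : 0 <= act_const J by rewrite (le_trans _ cJ).
exists (rho / 2), m, (2 * (act_const J * M) + N); split; first by rewrite divr_gt0.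
move=> h h0 hrho; have ch := cabs_ge0 h.
have hr : cabs h < r by lra.
have hr' : cabs h < r' by lra.
have h1 : cabs h <= 1 by lra.
split; first exact: U.
have [t1 [t2 [ct1 ct2 ->]]] := La _ (Sigma0_spt w0 Ju h0 hr).
have T1 : `|t1| <= 2 * (act_const J * M).
  have x01 : 0 <= cabs h / rho <= 1 / 2.
    by rewrite divr_ge0 ?(ltW rho0)//= ler_pdivrMr//; lra.
  have bnd n : `|series (fun m => laurent_term (spt J w0) a (Posz m) (spt J (w0 + h))) n| <=
      2 * (act_const J * M).
    rewrite /series /= (le_trans (ler_norm_sum _ _ _))//.
    apply: (@le_trans _ _ (\sum_(0 <= i < n) act_const J * M * (cabs h / rho) ^+ i)).
      apply: ler_sum => i _; rewrite term// (le_trans (cact_norm _ _ _))//= cabsX.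
      rewrite mulrC -!mulrA ler_wpM2l// expr_div_n.
      have := ler_wpM2r (exprn_ge0 i ch) (aM i); rewrite mulrAC => /le_trans; apply.
      by rewrite mulrA.
    rewrite -mulr_sumr mulrC ler_wpM2r ?mulr_ge0//.
    by have := sum_geometric_le 0 n x01; rewrite expr0 mulr1.
  rewrite -[X in X <= _]mul1r; apply: (norm_limit_le ct1) => n; rewrite mul1r; exact: bnd.
have T2 : cabs h ^+ m * `|t2| <= N.
  have bnd n : cabs h ^+ m * `|series (fun m => laurent_term (spt J w0) a (Negz m) (spt J (w0 + h))) n| <= N.
    have zer i : (m <= i)%N -> a (Negz i) = 0.
      by move=> mi; apply: am; rewrite NegzE ltrN2 ltz_nat.
    have -> : series (fun m => laurent_term (spt J w0) a (Negz m) (spt J (w0 + h))) n =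
        \sum_(0 <= i < n | (i < m)%N) cact J (zpow h (Negz i)) (a (Negz i)).
      rewrite /series /= [RHS]big_mkcond /=; apply: eq_bigr => i _; rewrite term//.
      by case: ltnP => // /zer ->; rewrite /cact cd_mul0r !scaler0 addr0.
    apply: (@le_trans _ _ (\sum_(0 <= i < n | (i < m)%N) act_const J * `|a (Negz i)|)).
      rewrite (le_trans (ler_wpM2l (exprn_ge0 m ch) (ler_norm_sum _ _ _)))// mulr_sumr.
      apply: ler_sum => i im; rewrite (le_trans (ler_wpM2l (exprn_ge0 m ch) (cact_norm _ _ _)))//.
      rewrite [leLHS]mulrA ler_piMl ?mulr_ge0//= cabsX cabsV -(subnKC im) exprD mulrAC.
      have hx : 0 < cabs h by rewrite cabs_gt0.
      by rewrite exprVn divff ?mul1r ?exprn_ile1// expf_neq0// gt_eqF.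
    rewrite /N -[X in _ <= X](big_mkord xpredT (fun i => act_const J * `|a (Negz i)|)).
    have tp i : 0 <= act_const J * `|a (Negz i)| by rewrite mulr_ge0.
    have [nm|mn] := leqP n m.
      rewrite (@big_cat_nat _ _ _ n 0 m)//=.
      rewrite [X in X <= _](_ : _ = \sum_(0 <= i < n) act_const J * `|a (Negz i)|).
        by rewrite lerDl sumr_ge0.
      by rewrite big_mkcond; apply: eq_big_nat => i /andP[_ i_n]; rewrite (leq_trans i_n nm).
    rewrite (@big_cat_nat _ _ _ m 0 n) ?(ltnW mn)//= [X in _ + X]big1_seq ?addr0.
      rewrite [X in X <= _]big_mkcond; apply: ler_sum => i _; by case: ifP.
    by move=> i /andP[im]; rewrite mem_index_iota leqNgt im.
  exact: (norm_limit_le ct2).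
have hm1 : cabs h ^+ m <= 1 by rewrite exprn_ile1.
have hm0 : 0 <= cabs h ^+ m by rewrite exprn_ge0.
rewrite (le_trans (ler_wpM2l hm0 (ler_normD _ _)))// mulrDr lerD//.
by rewrite (le_trans _ T1)// ler_piMl.
Qed.

Lemma zbounded_scale j c (K : R) (X : CD R j * CD R j) : zbounded K X -> zbounded (cabs c * K) (zscale c X).
Proof. by move=> h s; rewrite zcoord_scale cabsM ler_wpM2l ?cabs_ge0. Qed.

(** A pole only controls [f] on the slice half given by one unit; the two components of the stem are
    recovered from the values at [J] and [- J] together. *)
Lemma growth_of_values f P w0 J : is_stem f P -> imag_unit J ->
  (forall I, I = J \/ I = - J -> exists (r : R) (m : nat) (K : R), 0 < r /\
    forall h, h != 0 -> cabs h < r ->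
      csh (dom f) (w0 + h) /\ cabs h ^+ m * `|fn f (spt I (w0 + h))| <= K) ->
  growth P (csh (dom f)) w0.
Proof.
move=> [_ _ _ _ vf] Ju H; have Ju' := imag_unitN Ju.
have [r [m [K [r0 HK]]]] := H J (or_introl erefl).
have [r' [m' [K' [r'0 HK']]]] := H (- J) (or_intror erefl).
have cJ := act_const_ge1 J; have cJ0 : 0 <= act_const J by rewrite (le_trans _ cJ).
exists (Num.min (Num.min r r') 1), (m + m')%N, (2 * (act_const J * (K + K'))); split.
  by rewrite !lt_min r0 r'0 ltr01.
move=> h h0; rewrite !lt_min => /andP[/andP[hr hr'] h1].
have [Uh B1] := HK _ h0 hr; have [_ B2] := HK' _ h0 hr'; split=> //.
have hm n : 0 <= cabs h ^+ n by rewrite exprn_ge0 ?cabs_ge0.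
have hm1 n : cabs h ^+ n <= 1 by rewrite exprn_ile1 ?cabs_ge0// ltW.
have X1 : cabs h ^+ (m + m') * `|zeval J (P (w0 + h))| <= K.
  by rewrite -vf// exprD mulrAC (le_trans _ B1)// ler_piMr// mulr_ge0.
have X2 : cabs h ^+ (m + m') * `|zeval (- J) (P (w0 + h))| <= K'.
  by rewrite -vf// exprD -mulrA (le_trans _ B2)// ler_piMl// mulr_ge0.
case: (P _) X1 X2 => p q X1 X2.
have Ep : p = 2^-1 *: (zeval J (p, q) + zeval (- J) (p, q)).
  by apply: cd_coordP => s; rewrite /zeval /= cd_mulNl !cd_coordE; field.
have Eq : q = - (J ** (2^-1 *: (zeval J (p, q) - zeval (- J) (p, q)))).
  rewrite (_ : 2^-1 *: _ = J ** q) ?imag_unit_mulK ?opprK//.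
  by apply: cd_coordP => s; rewrite /zeval /= cd_mulNl !cd_coordE; field.
have half (x y : A) (c L L' : R) : 0 <= c -> c * `|x| <= L -> c * `|y| <= L' ->
    c * `|2^-1 *: (x + y)| <= L + L'.
  move=> c0 hx hy; rewrite normrZ ger0_norm ?invr_ge0// mulrCA.
  have := ler_wpM2l c0 (ler_normD x y); rewrite mulrDr => h2.
  have := mulr_ge0 c0 (normr_ge0 (x + y)); lra.
have N1 : cabs h ^+ (m + m') * `|p| <= K + K' by rewrite Ep; exact: half.
have N2 : cabs h ^+ (m + m') * `|q| <= act_const J * (K + K').
  rewrite Eq normrN; have X2' : cabs h ^+ (m + m') * `|- zeval (- J) (p, q)| <= K' by rewrite normrN.
  have := half _ _ _ _ _ (hm _) X1 X2'; set u := 2^-1 *: _ => Hu.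
  have hu : `|J ** u| <= act_const J * `|u|.
    by rewrite (le_trans (cd_norm_mul _ _))// mulrA ler_wpM2r// /act_const lerDr.
  by rewrite (le_trans (ler_wpM2l (hm _) hu))// mulrCA ler_wpM2l.
have KK0 : 0 <= K + K' by rewrite (le_trans _ N1)// mulr_ge0.
move=> s; rewrite zcoord_scale cabsM cabsX.
have := cabs_le_ReIm (zcoord s (p, q)) => /(ler_wpM2l (hm (m + m')%N)) /le_trans; apply.
rewrite /= mulrDr mulr_natl mulr2n; apply: lerD.
  rewrite (le_trans (ler_wpM2l (hm _) (cd_coord_norm _ _)))// (le_trans N1)//.
  by rewrite ler_peMl.
by rewrite (le_trans (ler_wpM2l (hm _) (cd_coord_norm _ _))).
Qed.

(** The plane point [w0] stands for a whole sphere. If one of the two points [spt J w0],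
    [spt (- J) w0] is removable, the extension lives on a circular set and its stem is regular at
    [w0]; otherwise both are poles and [growth_of_values] applies. *)
Lemma semiregular_growth (Om : set A) f P : circular Om -> semiregular Om f -> is_stem f P ->
  forall w0, csh Om w0 -> growth P (csh (dom f)) w0.
Proof.
move=> cOm [[cf of_ sub] _ sing] sP w0 Ow0.
have [_ oU hol par vf] := sP.
have [Uw0|nU] := pselect (csh (dom f) w0); first exact: growth_regular (hol _ Uw0).
have yU I : imag_unit I -> Om (spt I w0) /\ ~ dom f (spt I w0).
  by move=> Iu; split; [exact/(circular_spt hk _ cOm Iu)|move=> /(circular_spt hk _ cf Iu)].
have [J Ju] := exists_imag_unit R k_gt0; have Ju' := imag_unitN Ju.
have rem I : imag_unit I -> removable f (spt I w0) -> growth P (csh (dom f)) w0.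
  move=> Iu [[r r0 Sr] [g [[cg og /stem_is_stem-/(_ hk) sQ] sub' gy gf]]].
  have Gw0 : csh (dom g) w0 by exists I.
  have [_ oG holG _ vg] := sQ.
  have [s [m [K [s0 HK]]]] := growth_regular oG Gw0 (holG _ Gw0).
  exists (Num.min r s), m, K; split; first by rewrite lt_min r0.
  move=> h h0; rewrite lt_min => /andP[hr hs].
  have Uh : csh (dom f) (w0 + h) by exists I => //; apply: Sr; exact: Sigma0_spt.
  have [Gh Bh] := HK _ h0 hs; split=> //.
  rewrite (is_stem_uniq hk sP sQ Uh Gh)// => I' I'u.
  by rewrite gf//; exact/(circular_spt hk _ cf I'u).
have [y1 n1] := yU _ Ju; have [y2 n2] := yU _ Ju'.
case: (sing _ y1 n1) => [p1|]; last exact: rem.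
case: (sing _ y2 n2) => [p2|]; last exact: rem.
apply: (growth_of_values sP Ju) => I [->|->]; exact: pole_growth.
Qed.

End Growth.

(** * Laurent expansion of stem functions *)

Section VectorLaurent.
Variable R : realType.
Local Notation C := R[i].

Lemma zcoord_sum j s (I : Type) (q : seq I) (F : I -> CD R j * CD R j) :
  zcoord s (\sum_(i <- q) F i) = \sum_(i <- q) zcoord s (F i).
Proof.
apply: (big_morph (@zcoord R j s)); first by move=> X Y; exact: zcoordD.
by rewrite /zcoord /= !cd_coord0.
Qed.

Definition remainder j (M : nat) (c : nat -> CD R j * CD R j) (X : CD R j * CD R j) (h : C) L :=
  zscale (h ^+ M) X - \sum_(n < L) zscale (h ^+ n) (c n).

Lemma zcoord_remainder j s M c (X : CD R j * CD R j) h L :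
  zcoord s (remainder M c X h L) = h ^+ M * zcoord s X - \sum_(n < L) h ^+ n * zcoord s (c n).
Proof.
rewrite zcoordD zcoordN zcoord_scale zcoord_sum; congr (_ - _).
by apply: eq_bigr => i _; rewrite zcoord_scale.
Qed.

Lemma vector_laurent j (Q : C -> CD R j * CD R j) m (r K : R) : 0 < r ->
  (forall h, h != 0 -> cabs h < r -> zhol Q h) ->
  (forall h, h != 0 -> cabs h < r -> zbounded K (zscale (h ^+ m) (Q h))) ->
  exists (c : nat -> CD R j * CD R j) (rho B : R), [/\ 0 < rho, 0 <= B &
    forall h, h != 0 -> cabs h <= rho -> forall L,
      zbounded (B * (1 / 2) ^+ L) (remainder m.+2 c (Q h) h L)].
Proof.
elim: j Q => [|j IH] Q r0 hQ bQ.
  have [||a [rho [B [rho0 B0 Ha]]]] := @laurent R (fun h => zcoord [::] (Q h)) m r K r0.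
  - by move=> h h0 hr; exact: hQ.
  - by move=> h h0 hr; have := bQ _ h0 hr [::]; rewrite zcoord_scale cabsM cabsX.
  exists (fun n => (complex.Re (a n), complex.Im (a n))), rho, B; split => //.
  move=> h h0 hrho L s; rewrite zcoord_remainder.
  have -> : \sum_(n < L) h ^+ n * zcoord s (complex.Re (a n) : CD R 0, complex.Im (a n) : CD R 0) =
      \sum_(n < L) a n * h ^+ n.
    by apply: eq_bigr => i _; rewrite mulrC; congr (_ * _); rewrite /zcoord /=; case: (a i).
  rewrite (le_trans (Ha _ h0 hrho L))// ler_wpM2l// lerXn2r ?nnegrE//.
  - by rewrite divr_ge0 ?cabs_ge0 ?mulr_ge0 ?(ltW rho0).
  - by rewrite ler_pdivrMr ?mulr_gt0//; lra.
pose Q1 h := ((Q h).1.1, (Q h).2.1); pose Q2 h := ((Q h).1.2, (Q h).2.2).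
have [||c1 [rho1 [B1 [rho10 B10 H1]]]] := IH Q1 r0.
- by move=> h h0 hr s; exact: (hQ h h0 hr (false :: s)).
- by move=> h h0 hr s; exact: (bQ h h0 hr (false :: s)).
have [||c2 [rho2 [B2 [rho20 B20 H2]]]] := IH Q2 r0.
- by move=> h h0 hr s; exact: (hQ h h0 hr (true :: s)).
- by move=> h h0 hr s; exact: (bQ h h0 hr (true :: s)).
exists (fun n => (((c1 n).1, (c2 n).1), ((c1 n).2, (c2 n).2))), (Num.min rho1 rho2), (B1 + B2); split.
- by rewrite lt_min rho10.
- exact: addr_ge0.
move=> h h0; rewrite le_min => /andP[r1 r2] L s.
have e0 : 0 <= (1 / 2 : R) ^+ L by rewrite exprn_ge0.
rewrite zcoord_remainder mulrDl /zcoord /=; case: head.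
  have := H2 _ h0 r2 L (behead s); rewrite zcoord_remainder => /le_trans; apply.
  by rewrite lerDr mulr_ge0.
have := H1 _ h0 r1 L (behead s); rewrite zcoord_remainder => /le_trans; apply.
by rewrite lerDl mulr_ge0.
Qed.

Lemma zcoord_bar j s (X : CD R j * CD R j) : zcoord s (X.1, - X.2) = conjc (zcoord s X).
Proof. by rewrite /zcoord /= cd_coordN. Qed.

(** By parity the conjugate coefficients give an expansion as well, with the remainder taken at the
    conjugate point. The average of both has coefficients in A x 0, and its remainder is the mean of
    two terms bounded by [E]. *)
Lemma real_laurent j (Q : C -> CD R j * CD R j) M c h L (E : R) :
  Q (conjc h) = ((Q h).1, - (Q h).2) ->
  zbounded E (remainder M c (Q h) h L) -> zbounded E (remainder M c (Q (conjc h)) (conjc h) L) ->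
  zbounded E (remainder M (fun n => ((c n).1, 0)) (Q h) h L).
Proof.
move=> par b1 b2 s; have := b1 s; have := b2 s; rewrite !zcoord_remainder par zcoord_bar.
set q := zcoord s (Q h); set a := fun n => zcoord s (c n).
have -> : \sum_(n < L) h ^+ n * zcoord s ((c n).1, 0) =
    2^-1 * (\sum_(n < L) h ^+ n * a n + conjc (\sum_(n < L) (conjc h) ^+ n * a n)).
  rewrite rmorph_sum -big_split mulr_sumr /=; apply: eq_bigr => n _.
  rewrite rmorphM rmorphXn /= conjcK -mulrDr mulrCA; congr (_ * _).
  rewrite /a /zcoord /= cd_coord0.
  have -> : forall x y : R, Complex x y + Complex x (- y) = 2 * Complex x 0.
    by move=> x y; apply/eqP; rewrite eq_complex /=; apply/andP; split; apply/eqP; ring.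
  by rewrite mulKf// pnatr_eq0.
have cconj (z : C) : cabs (conjc z) = cabs z by case: z => x y; rewrite /cabs /= sqrrN.
set S1 := \sum_(n < L) h ^+ n * a n; set S2 := \sum_(n < L) (conjc h) ^+ n * a n => h2 h1.
have -> : h ^+ M * q - 2^-1 * (S1 + conjc S2) =
    2^-1 * ((h ^+ M * q - S1) + conjc (conjc h ^+ M * conjc q - S2)).
  have -> : conjc (conjc h ^+ M * conjc q - S2) = h ^+ M * q - conjc S2.
    suff cE (x y z : R[i]) : conjc (conjc x ^+ M * conjc y - z) = x ^+ M * y - conjc z by exact: cE.
    by rewrite rmorphB rmorphM rmorphXn /= !conjcK.
  have t2 : 2^-1 + 2^-1 = 1 :> R[i] by rewrite -mulr2n -[LHS]mulr_natr mulVf// pnatr_eq0.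
  have mid (t x y z : R[i]) : t + t = 1 -> x - t * (y + z) = t * ((x - y) + (x - z)).
    move=> t1; transitivity ((t + t) * x - t * (y + z)); first by rewrite t1 mul1r.
    ring.
  exact: mid t2.
rewrite cabsM cabsV cabs_nat.
have := cabsD (h ^+ M * q - S1) (conjc (conjc h ^+ M * conjc q - S2)).
rewrite cconj; lra.
Qed.

End VectorLaurent.

(** * From growth of the stem function to poles *)

Section GrowthPole.
Variables (R : realType) (k : nat).
Hypothesis hk : (1 <= k <= 3)%N.
Local Notation A := (CD R k).
Local Notation C := R[i].
Implicit Types (w c d : C) (I J x y : A) (P Q : C -> A * A) (f g : pfun R k) (U V : set C).

Let k_le3 : (k <= 3)%N. Proof. by case/andP: hk. Qed.

Lemma spt_real I J w0 : complex.Im w0 = 0 -> spt I w0 = spt J w0.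
Proof. by rewrite /spt /slice_pt => ->; rewrite !scale0r. Qed.

Lemma spt_unit_inj I J w0 : complex.Im w0 <> 0 -> imag_unit I -> imag_unit J ->
  spt I w0 = spt J w0 -> I = J.
Proof.
move=> /eqP i0 Iu Ju /(slice_pt_inj Iu Ju)[_ E].
by rewrite -[I]scale1r -(mulVf i0) -scalerA E scalerA mulVf// scale1r.
Qed.

(** A point on no common slice with a nonreal centre has [sigma] at least [|Im w0|], so a small
    [Sigma0] stays in the slice of the centre. A real centre lies on every slice, and any unit
    fitting [x] serves. *)
Lemma Sigma0_slice J w0 r x : imag_unit J -> Sigma0 (spt J w0) r x ->
  (complex.Im w0 <> 0 -> r <= `|complex.Im w0|) ->
  exists I h, [/\ imag_unit I, spt I w0 = spt J w0, x = spt I (w0 + h), h != 0 & cabs h < r].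
Proof.
move=> Ju Sx rI.
have fin I w : imag_unit I -> spt I w0 = spt J w0 -> x = spt I w ->
   exists I h, [/\ imag_unit I, spt I w0 = spt J w0, x = spt I (w0 + h), h != 0 & cabs h < r].
  move=> Iu E Ex; exists I, (w - w0); rewrite subrKC; split => //.
    move: Sx => [+ _]; rewrite -E Ex; have [-> _] := tau_sigma_spt w w0 Iu.
    by rewrite cabs_gt0.
  by move: Sx => [_]; rewrite -E Ex; have [_ ->] := tau_sigma_spt w w0 Iu.
have [i0|/eqP i0] := pselect (complex.Im w0 = 0).
  have [I [w [Iu Ex]]] := spt_surj hk x.
  by apply: (fin I w Iu _ Ex); exact: spt_real.
have [cs|ncs] := pselect (common_slice x (spt J w0)).
  case: cs => I Iu [[a [b Ex]] [a' [b' Ey]]].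
  have [_ Eb] := slice_pt_inj Ju Iu Ey.
  have b'0 : b' != 0.
    apply: contra i0 => /eqP b'0; move: Eb; rewrite b'0 scale0r => /eqP.
    rewrite scaler_eq0 => /orP[//|/eqP J0].
    by have [_] := (imag_unitP J).1 Ju; rewrite J0 -(scale0r (0 : A)) cd_sumsqZ expr0n mul0r => /eqP; rewrite eq_sym oner_eq0.
  apply: (fin J (Complex a (b / b' * complex.Im w0)) Ju erefl).
  by rewrite Ex /spt /slice_pt /= -scalerA Eb scalerA divfK.
exfalso; move: Sx => [_]; rewrite /Defs.sigma; case: asboolP => // _.
have := rI (elimN eqP i0); rewrite {2}/spt cd_im_slice// enorm_unitZ//.
set b := `|_| => rb; apply/negP; rewrite -leNgt (le_trans rb)//.
have b0 : 0 <= b by exact: normr_ge0.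
rewrite -[b in b <= _](ger0_norm b0) -sqrtr_sqr ler_wsqrtr//.
have := enorm_ge0 (cd_im x); set u := enorm _ => u0.
rewrite sqrrD; have := sqr_ge0 (cd_re x - cd_re (spt J w0)); have := sqr_ge0 u.
have := mulr_ge0 u0 b0; rewrite !expr2; lra.
Qed.

(** The Laurent coefficients of the stem, evaluated at [J], are the coefficients sought;
    multiplication by powers of [h] becomes the action of C_J. *)
Lemma growth_pole f P J w0 : is_stem f P -> imag_unit J -> growth P (csh (dom f)) w0 ->
  pole f (spt J w0).
Proof.
move=> sP Ju [r [m [K [r0 HK]]]]; have [cf oU hol par vf] := sP.
pose Q h := P (w0 + h).
have [||c0 [rho [B [rho0 B0 Hc0]]]] := @vector_laurent R k Q m r K r0.
- move=> h h0 hr s; have [Uh _] := HK _ h0 hr; have [d hd] := hol _ Uh s.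
  by exists d; exact: sdiff_shift hd.
- by move=> h h0 hr; have [] := HK _ h0 hr.
have [r' r'0 av] := avoid_conj w0.
pose beta := if complex.Im w0 == 0 then 1 else `|complex.Im w0|.
have beta0 : 0 < beta by rewrite /beta; case: eqVneq => // ?; rewrite normr_gt0.
pose q := Num.min (Num.min r rho) (Num.min r' beta).
have q0 : 0 < q by rewrite !lt_min r0 rho0 r'0.
have qle h : cabs h < q -> [/\ cabs h < r, cabs h <= rho & cabs h < r'].
  by rewrite !lt_min => /andP[/andP[? /ltW ?] /andP[? _]].
have qb : complex.Im w0 <> 0 -> q <= `|complex.Im w0|.
  by move=> /eqP /negPf i0; rewrite /q /beta i0 !ge_min lexx !orbT.
(* at a real centre the coefficients can be taken real, hence independent of
   the imaginary unit *)
have [c [ca Hc]] : exists c : nat -> A * A,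
    (forall I n, imag_unit I -> spt I w0 = spt J w0 -> zeval I (c n) = zeval J (c n)) /\
    forall h, h != 0 -> cabs h < q -> forall L, zbounded (B * (1 / 2) ^+ L) (remainder m.+2 c (Q h) h L).
  have [i0|i0] := pselect (complex.Im w0 = 0); last first.
    exists c0; split; first by move=> I n Iu /(spt_unit_inj i0 Iu Ju) ->.
    by move=> h h0 /qle[_ hr _] L; exact: Hc0.
  exists (fun n => ((c0 n).1, 0)); split; first by move=> I n _ _; rewrite /zeval /= !cd_mul0r.
  move=> h h0 hq L; have [hr hrho _] := qle _ hq; have [Uh _] := HK _ h0 hr.
  have cconj (z : C) : cabs (conjc z) = cabs z by case: z => a b; rewrite /cabs /= sqrrN.
  have Ew : w0 + conjc h = conjc (w0 + h).
    by case: (w0) i0 (h) => a b /= -> [a' b']; apply/eqP; rewrite eq_complex /= !add0r !eqxx.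
  apply: real_laurent; first by rewrite /Q Ew par.
    exact: Hc0.
  by apply: Hc0; rewrite ?conjc_eq0 ?cconj.
pose M := m.+2; pose al n := zeval J (c n).
(* [c] expands [h ^ M * Q h], so exponent [n] has index [M + n]; as [Negz j] is [-(j + 1)], it takes
   index [M - j.+1]. *)
pose a (n : int) := match n with
  | Posz j => al (M + j)%N
  | Negz j => if (j < M)%N then al (M - j.+1)%N else 0 end.
exists q; split => //.
  move=> x /(Sigma0_slice Ju)-/(_ qb)[I [h [Iu _ -> h0 hq]]].
  by have [hr _ _] := qle _ hq; apply/(circular_spt hk _ cf Iu); have [] := HK _ h0 hr.
exists a; last first.
  exists M => -[j|j]; first by rewrite ltNge (le_trans _ (_ : 0 <= Posz j))// oppr_le0.
  move=> H; have Mj : (M <= j)%N by move: H; rewrite NegzE ltrN2 ltz_nat ltnS.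
  by rewrite /a ltnNge Mj.
move=> x /(Sigma0_slice Ju)-/(_ qb)[I [h [Iu EI -> h0 hq]]].
have [hr hrho hr'] := qle _ hq; have [Uh _] := HK _ h0 hr; have [n1 n2] := av _ h0 hr'.
have term n : laurent_term (spt J w0) a n (spt I (w0 + h)) = cact I (zpow h n) (a n).
  by rewrite -EI (laurent_termE hk)// [w0 + h]addrC addrK.
pose s2 := \sum_(j < M) cact I (h^-1 ^+ j.+1) (al (M - j.+1)%N).
exists (fn f (spt I (w0 + h)) - s2), s2; split; last by rewrite subrK.
  (* The error of a partial sum is the remainder of the stem expansion at order [M + l], evaluated
     at [I] and divided by [h ^ M]; for fixed [h] it decays like [(1 / 2) ^ l]. *)
  have key l : fn f (spt I (w0 + h)) - s2 - \sum_(0 <= j < l) cact I (h ^+ j) (al (M + j)%N) =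
      cact I (h^-1 ^+ M) (zeval I (remainder M c (Q h) h (M + l))).
    have hV : h^-1 ^+ M * h ^+ M = 1 by rewrite -exprMn mulVf// expr1n.
    rewrite /remainder; set S := \sum_(n < _) _.
    have -> : zeval I (zscale (h ^+ M) (Q h) - S) = cact I (h ^+ M) (fn f (spt I (w0 + h))) -
        \sum_(n < M + l) cact I (h ^+ n) (al n).
      rewrite vf// cact_eval// (_ : \sum_(n < M + l) cact I (h ^+ n) (al n) = zeval I S).
        by rewrite /zeval /= cd_mulBr; apply: cd_coordP => s; rewrite !cd_coordE; ring.
      rewrite /S (big_morph (zeval I) (id1 := 0) (op1 := +%R)) => [|X Y|].
      + by apply: eq_bigr => n _; rewrite -cact_eval// ca.
      + by rewrite /zeval /= cd_mulDr addrACA.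
      + by rewrite /zeval /= cd_mul0r addr0.
    rewrite cactB cactM// hV cact1 -addrA -opprD; congr (_ - _).
    rewrite (big_morph (cact I (h^-1 ^+ M)) (id1 := 0) (op1 := +%R)) => [|X Y|]; last first.
    + by rewrite /cact cd_mul0r !scaler0 addr0.
    + exact: cactD.
    rewrite big_split_ord /= big_mkord; congr (_ + _); last first.
      by apply: eq_bigr => j _; rewrite cactM// exprD mulrA hV mul1r.
    rewrite /s2 (reindex_inj rev_ord_inj) /=; apply: eq_bigr => j _.
    have jM : h^-1 ^+ M = h^-1 ^+ (M - j) * h^-1 ^+ j by rewrite -exprD subnK// ltnW.
    rewrite cactM// subnSK// subKn ?(ltnW (ltn_ord j))//; congr (cact I _ _).
    by rewrite jM -mulrA -exprMn mulVf// expr1n mulr1.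
  have bnd l : `|fn f (spt I (w0 + h)) - s2 - \sum_(0 <= j < l) cact I (h ^+ j) (al (M + j)%N)| <=
      cabs (h^-1 ^+ M) * (act_const I * (act_const I * (2 * B))) * (1 / 2) ^+ l.
    have cI := act_const_ge1 I; have cI0 : 0 <= act_const I by rewrite (le_trans _ cI).
    rewrite key (le_trans (cact_norm _ _ _))// -!mulrA ler_wpM2l ?cabs_ge0// ler_wpM2l//.
    rewrite (le_trans (zeval_norm _ _))// ler_wpM2l//.
    have Eb : B * (1 / 2) ^+ (M + l) <= B * (1 / 2) ^+ l.
      rewrite ler_wpM2l// exprD ler_piMl ?exprn_ge0//.
      by rewrite exprn_ile1//; lra.
    rewrite mulr_natl mulr2n; apply: lerD; apply: (le_trans _ Eb); apply: cd_norm_le => s.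
      by apply: le_trans (Hc _ h0 hq _ s); exact: (ler_Re_cabs (zcoord s _)).
    by apply: le_trans (Hc _ h0 hq _ s); exact: (ler_Im_cabs (zcoord s _)).
  rewrite (_ : (fun m0 : nat => _) = fun j : nat => cact I (h ^+ j) (al (M + j)%N)); last first.
    by apply/funext => j; rewrite term.
  apply/cvgrPdist_le => e e0.
  set D := cabs (h^-1 ^+ M) * _ in bnd.
  have half1 : `|1 / 2 : R| < 1 by rewrite ger0_norm//; lra.
  have D1 : 0 < `|D| + 1 by rewrite ltr_wpDl.
  have eD : 0 < e / (`|D| + 1) by rewrite divr_gt0.
  have /cvgrPdist_le /(_ _ eD) := cvg_expr half1; apply: filterS => l; rewrite sub0r normrN => hl.
  rewrite (le_trans (bnd l))// (le_trans (ler_norm _))// normrM.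
  rewrite (le_trans (ler_wpM2l (normr_ge0 D) hl))// mulrC mulrAC ler_pdivrMr//.
  by rewrite ler_pM2l// lerDl.
rewrite (_ : (fun m0 : nat => _) = fun j : nat => if (j < M)%N then cact I (h^-1 ^+ j.+1) (al (M - j.+1)%N) else 0); last first.
  by apply/funext => j; rewrite term /=; case: ifP => //; rewrite /cact cd_mul0r !scaler0 addr0.
apply: cvg_near_cst; exists M => // l /= Ml.
rewrite /series /= (@big_cat_nat _ _ _ M 0 l)//= [X in _ + X]big1_seq ?addr0.
  by rewrite big_mkord /s2; apply: eq_bigr => j _; rewrite ltn_ord.
by move=> j /andP[_]; rewrite mem_index_iota => /andP[Mj _]; rewrite ltnNge Mj.
Qed.

End GrowthPole.

(** * Meromorphic functions *)

Section Meromorphic.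
Variable R : realType.
Local Notation C := R[i].
Implicit Types (f : C -> C) (w h : C).

Definition vanishes_near f w := exists2 s : R, 0 < s &
  forall h, h != 0 -> cabs h < s -> f (w + h) = 0.

Definition meromorphic_at f w := exists (r : R) (m : nat) (K : R), 0 < r /\
  forall h, h != 0 -> cabs h < r ->
    (exists d, sdiff f (w + h) d) /\ cabs h ^+ m * cabs (f (w + h)) <= K.

Definition bounded_below_near f w := exists (s c : R) (n : nat), [/\ 0 < s, 0 < c &
  forall h, h != 0 -> cabs h < s -> c * cabs h ^+ n <= cabs (f (w + h))].

Lemma meromorphic_dichotomy f w : meromorphic_at f w ->
  vanishes_near f w \/ bounded_below_near f w.
Proof.
move=> [r [m [K [r0 H]]]]; apply: (@order_dichotomy _ (fun h => f (w + h)) m r K r0).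
  by move=> h h0 hr; have [[d Hd] _] := H h h0 hr; exists d; exact: sdiff_shift.
by move=> h h0 hr; have [] := H h h0 hr.
Qed.

(** The shift is real, so that it keeps a real centre on the real axis. *)
Lemma small_point (r : R) : 0 < r -> exists h, [/\ h != 0, cabs h < r & conjc h = h].
Proof.
move=> r0; exists (r / 2)%:C%C; have r2 : 0 < r / 2 by rewrite divr_gt0.
by rewrite -cabs_gt0 cabs_real gtr0_norm// r2 /= oppr0; split=> //; lra.
Qed.

Lemma vanishes_near_eq0 f w d : sdiff f w d -> vanishes_near f w -> f w = 0.
Proof.
move=> /sdiff_continuous cf [s s0 Hs]; apply/eqP; rewrite -cabs_eq0 eq_le cabs_ge0 andbT.
apply/ler_addgt0Pr => e /cf[r r0 Hr].
have rs : 0 < Num.min r s by rewrite lt_min r0.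
have [h [h0 + _]] := small_point rs; rewrite lt_min => /andP[hr hs].
by have := Hr (w + h); rewrite addrC addKr Hs// sub0r cabsN add0r => /(_ hr)/ltW.
Qed.

Lemma punctured_open (s : R) h h' : cabs h < s -> cabs h' < Num.min (cabs h) (s - cabs h) ->
  h + h' != 0 /\ cabs (h + h') < s.
Proof.
rewrite lt_min => hs /andP[h1 h2]; split; last by have := cabsD h h'; lra.
rewrite -cabs_gt0; have := cabs_sub_ge h (- h'); rewrite cabsN opprK; lra.
Qed.

Lemma vanishes_near_open f : copen (vanishes_near f).
Proof.
move=> w [s s0 Hs]; exists s => // w' ws; have [->|ne] := eqVneq w' w; first by exists s.
have h0 : 0 < cabs (w' - w) by rewrite cabs_gt0 subr_eq0.
exists (Num.min (cabs (w' - w)) (s - cabs (w' - w))); first by rewrite lt_min h0 subr_gt0.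
move=> h _ /(punctured_open ws)[n1 n2].
by have := Hs _ n1 n2; rewrite addrA addrCA subrr addr0.
Qed.

(** The lower bound around [w] holds at all nearby points, which excludes vanishing around any of
    them. *)
Lemma not_vanishes_near_open f (U : set C) : copen U -> (forall w, U w -> meromorphic_at f w) ->
  copen (U `&` ~` vanishes_near f).
Proof.
move=> oU mer w [Uw nv]; have [r r0 Hr] := oU _ Uw.
have [//|[s [c [n [s0 c0 H]]]]] := meromorphic_dichotomy (mer _ Uw).
exists (Num.min r s) => [|w']; first by rewrite lt_min r0.
rewrite lt_min => /andP[wr ws]; split; first exact: Hr.
have [->//|ne] := eqVneq w' w.
have h0 : 0 < cabs (w' - w) by rewrite cabs_gt0 subr_eq0.
move=> [t t0 Ht].
have m0 : 0 < Num.min t (Num.min (cabs (w' - w)) (s - cabs (w' - w))).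
  by rewrite !lt_min t0 h0 subr_gt0.
have [h [hn0 + _]] := small_point m0; rewrite lt_min => /andP[ht /(punctured_open ws)[n1 n2]].
have := H _ n1 n2; rewrite addrA addrCA subrr addr0 Ht// cabs0 leNgt mulr_gt0//.
by rewrite exprn_gt0// cabs_gt0.
Qed.

(** Within [D], local vanishing and its negation are both open conditions, so the first cuts out an
    open and closed part of [E]. [E] is kept apart from [D] so as to be one of its components. *)
Lemma identity_theorem f (D E : set (R * R)) w0 w : open D -> connected E -> E `<=` D ->
  (forall w, D (plane w) -> meromorphic_at f w) ->
  E (plane w0) -> vanishes_near f w0 -> E (plane w) -> vanishes_near f w.
Proof.
move=> oD cE sub mer Ew0 v0 Ew.
pose V : set (R * R) := [set z | vanishes_near f (Complex z.1 z.2)].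
have VE w1 : V (plane w1) = vanishes_near f w1 by case: w1.
have oV : open V.
  by apply/copen_plane => w1 /=; rewrite VE => /vanishes_near_open[r r0 Hr]; exists r => // w2 /Hr; rewrite VE.
have oNV : open (D `&` ~` V).
  apply/copen_plane => w1 [Dw1 nV]; have oU := (copen_plane D).1 oD.
  have nV1 : (~` vanishes_near f) w1 by rewrite /= -VE.
  have [r r0 Hr] := not_vanishes_near_open oU mer (conj Dw1 nV1).
  by exists r => // w2 /Hr[D2 n2]; split => //=; rewrite VE.
suff : E `&` V = E by move=> EV; have : E (plane w) by []; rewrite -EV => -[_]; rewrite VE.
apply: cE.
- by exists (plane w0); split => //; rewrite VE.
- by exists V.
- exists (~` (D `&` ~` V)); first exact: open_closedC.
  apply/seteqP; split => z [Ez]; first by move=> Vz; split => // -[_].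
  by move=> nz; split => //; apply: contrapT => nV; apply: nz; split => //; exact: sub.
Qed.

End Meromorphic.

(** * Semiregular functions *)

Section SemiregularAlgebra.
Variables (R : realType) (k : nat).
Hypothesis hk : (1 <= k <= 3)%N.
Local Notation A := (CD R k).
Local Notation C := R[i].
Variable Om : set A.
Hypotheses (circOm : circular Om) (openOm : open Om).
Implicit Types (w c d : C) (I J x y : A) (P Q T : C -> A * A) (f g h : pfun R k) (U V : set C).

Let k_le3 : (k <= 3)%N. Proof. by case/andP: hk. Qed.

(** Semiregularity in terms of the stem function: growth is demanded at regular and singular points
    alike, which spares case distinctions in sums and products. *)
Definition sem_stem f P := [/\ is_stem f P, dom f `<=` Om &
  forall w0, csh Om w0 -> growth P (csh (dom f)) w0].

Lemma sem_stem_semiregular f P : sem_stem f P -> semiregular Om f.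
Proof.
move=> [sP sub gr]; have [cf oU _ _ _] := sP; split.
- by split => //; exact: (open_circular hk).
- exact: is_stem_regular sP.
- move=> y Oy _; left; have [J [w0 [Ju Ey]]] := spt_surj hk y.
  by rewrite Ey; apply: (growth_pole hk sP Ju); apply: gr; exists J => //; rewrite -Ey.
Qed.

Lemma semiregular_sem_stem f : semiregular Om f -> exists P, sem_stem f P.
Proof.
move=> sf; have [[_ _ sub] /(stem_is_stem hk) sP _] := sf.
by exists (zval (stem f)); split => //; exact: semiregular_growth.
Qed.

Lemma growth_domain P U w0 : growth P U w0 ->
  exists2 r : R, 0 < r & forall h : C, h != 0 -> cabs h < r -> U (w0 + h).
Proof. by move=> [r [m [K [r0 H]]]]; exists r => // h h0 hr; have [] := H h h0 hr. Qed.

(** Growth provides a punctured disc of regularity around every point of [csh Om], so each domain is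
    dense and meets every other. *)
Lemma sem_stem_meet f g P Q : sem_stem f P -> sem_stem g Q ->
  exists w, csh (dom f) w /\ csh (dom g) w.
Proof.
move=> [sP subf _] [_ _ grg]; have [cf oU _ _ _] := sP.
have [w0 Uw0] : exists w, csh (dom f) w.
  have [[x fx] _] := (circularP hk _).1 cf; have [J [w [Ju Ex]]] := spt_surj hk x.
  by exists w, J; rewrite -?Ex.
have [r r0 Hr] := oU _ Uw0.
have [s s0 Hs] := growth_domain (grg _ (csh_subset subf Uw0)).
have rs : 0 < Num.min r s by rewrite lt_min r0.
have [h [h0 + _]] := small_point rs; rewrite lt_min => /andP[hr hs].
by exists (w0 + h); split; [apply: Hr; rewrite addrC addKr|exact: Hs].
Qed.

Lemma agreeP f g P Q : is_stem f P -> is_stem g Q ->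
  agree f g <-> (forall w, csh (dom f) w -> csh (dom g) w -> P w = Q w).
Proof.
move=> sP sQ; have [cf _ _ _ vf] := sP; have [cg _ _ _ vg] := sQ; split.
  move=> ag w Uw Vw; apply: (is_stem_uniq hk sP sQ Uw Vw) => J Ju.
  by apply: ag; apply/(circular_spt hk).
move=> H x fx gx; have [J [w [Ju Ex]]] := spt_surj hk x.
have Uw : csh (dom f) w by exists J; rewrite -?Ex.
have Vw : csh (dom g) w by exists J; rewrite -?Ex.
by rewrite Ex vf// vg// H.
Qed.

Lemma zhol_limit_eq P Q w (r : R) : zhol P w -> zhol Q w -> 0 < r ->
  (forall h : C, h != 0 -> cabs h < r -> P (w + h) = Q (w + h)) -> P w = Q w.
Proof.
move=> hP hQ r0 H.
have E s : zcoord s (P w) = zcoord s (Q w).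
  have [d hd] := hP s; have [d' hd'] := hQ s.
  have hdiff := sdiffD hd (sdiffM (@sdiff_cst _ (-1) w) hd').
  apply/eqP; rewrite -subr_eq0 -mulN1r; apply/eqP/(vanishes_near_eq0 hdiff).
  by exists r => // h h0 hr; rewrite H// mulN1r subrr.
by apply: zpairP => s; have := E s => -[].
Qed.

Lemma sem_stem_cst a : sem_stem (pcst Om a) (fun=> (a, 0)).
Proof.
have sP := is_stem_cst a circOm (copen_csh openOm); have [_ oU hol _ _] := sP.
by split => // w0 Ow0; exact: (growth_regular oU Ow0 (hol _ Ow0)).
Qed.

(** The order [m + m'] fits products exactly; for sums the surplus powers of [h] are absorbed by
    [|h| <= 1]. *)
Lemma growth_combine P Q T U V W w0 (B : R -> R -> R) :
  growth P U w0 -> growth Q V w0 -> (forall w, U w -> V w -> W w) ->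
  (forall (h : C) m m' (K K' : R), cabs h <= 1 -> zbounded K (zscale (h ^+ m) (P (w0 + h))) ->
     zbounded K' (zscale (h ^+ m') (Q (w0 + h))) ->
     zbounded (B K K') (zscale (h ^+ (m + m')) (T (w0 + h)))) ->
  growth T W w0.
Proof.
move=> [r [m [K [r0 HP]]]] [s [m' [K' [s0 HQ]]]] UVW HT.
exists (Num.min (Num.min r s) 1), (m + m')%N, (B K K'); split.
  by rewrite !lt_min r0 s0 ltr01.
move=> h h0; rewrite !lt_min => /andP[/andP[hr hs] /ltW h1].
have [Uh Ph] := HP h h0 hr; have [Vh Qh] := HQ h h0 hs.
by split; [exact: UVW|exact: HT].
Qed.

Lemma sem_stem_add f g P Q : sem_stem f P -> sem_stem g Q ->
  sem_stem (padd f g) (fun w => P w + Q w).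
Proof.
move=> F G; have ne := sem_stem_meet F G; have [sP subf gf] := F; have [sQ subg gg] := G.
have [cf _ _ _ _] := sP; have [cg _ _ _ _] := sQ.
split; first exact: (is_stem_add hk).
  by move=> x [/subf].
move=> w0 Ow0; apply: (growth_combine (B := fun K K' => K + K') (gf _ Ow0) (gg _ Ow0)).
  by move=> w Uw Vw; apply/(cshI hk).
move=> h m m' K K' h1 hP hQ.
rewrite (_ : zscale _ _ = zscale (h ^+ m') (zscale (h ^+ m) (P (w0 + h))) +
   zscale (h ^+ m) (zscale (h ^+ m') (Q (w0 + h)))); last first.
  rewrite !zscaleA -!exprD [(m' + m)%N]addnC.
  by apply: zpairP => s /=; rewrite !cd_coordE; ring.
have small (X : A * A) (L : R) n : zbounded L X -> zbounded L (zscale (h ^+ n) X).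
  move=> hX s; rewrite zcoord_scale cabsM cabsX (le_trans _ (hX s))// ler_piMl ?cabs_ge0//.
  by rewrite exprn_ile1// cabs_ge0.
by apply: zboundedD; exact: small.
Qed.

Lemma sem_stem_mul f g P Q : sem_stem f P -> sem_stem g Q ->
  sem_stem (pmul f g) (fun w => zmul (P w) (Q w)).
Proof.
move=> F G; have ne := sem_stem_meet F G; have [sP subf gf] := F; have [sQ subg gg] := G.
have [cf _ _ _ _] := sP; have [cg _ _ _ _] := sQ.
split; first exact: (is_stem_mul hk).
  by move=> x [/subf].
move=> w0 Ow0; apply: (growth_combine (B := fun K K' => 2 ^+ k * (K * K')) (gf _ Ow0) (gg _ Ow0)).
  by move=> w Uw Vw; apply/(cshI hk).
move=> h m m' K K' h1 hP hQ.
rewrite exprD -zscaleA -zmul_scaler -zmul_scalel.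
exact: zbounded_mul.
Qed.

Lemma sem_stem_conj f P : sem_stem f P -> sem_stem (pconj f) (fun w => zconj (P w)).
Proof.
move=> [sP subf gf]; split => //; first exact: is_stem_conj.
move=> w0 /gf[r [m [K [r0 H]]]]; exists r, m, K; split => // h h0 hr.
have [Uh Bh] := H h h0 hr; split => //.
rewrite (_ : zscale _ _ = zconj (zscale (h ^+ m) (P (w0 + h)))); first exact: zbounded_conj.
by apply: zpairP => s /=; rewrite !cd_linE.
Qed.

Lemma sem_stem_scale r f P : sem_stem f P -> sem_stem (pscale r f) (fun w => r *: P w).
Proof.
move=> [sP subf gf]; split => //; first exact: is_stem_scale.
move=> w0 /gf[q [m [K [q0 H]]]]; exists q, m, (cabs r%:C%C * K); split => // h h0 hr.
have [Uh Bh] := H h h0 hr; split => //.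
rewrite (_ : zscale _ _ = zscale r%:C%C (zscale (h ^+ m) (P (w0 + h)))); first exact: zbounded_scale.
rewrite zscaleA; case: (h ^+ m) => u v.
by apply: zpairP => s /=; rewrite !cd_coordE; ring.
Qed.

Lemma sem_agree f g P Q : sem_stem f P -> sem_stem g Q -> (forall w, P w = Q w) -> agree f g.
Proof. by move=> [sP _ _] [sQ _ _] E; apply/(agreeP sP sQ) => w _ _; exact: E. Qed.

Local Notation SEM := (semiregular Om).
Local Notation zero := (pcst Om 0).
Local Notation one := (pcst Om (cd_one R k)).

Lemma semiregular_quotient :
  quotient_operations SEM agree padd pscale pmul pconj zero one.
Proof.
split.
- by move=> f _ x _ _.
- by move=> f g _ _ ag x gx fx; rewrite ag.
(* Transitivity is not pointwise: a common point of [dom f] and [dom h] may lie outside [dom g]. The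
   punctured disc around it lies in [dom g], and continuity of the stems closes the gap. *)
- move=> f g h /semiregular_sem_stem[P F] /semiregular_sem_stem[Q G] /semiregular_sem_stem[T H].
  have [sP subf _] := F; have [sQ _ gg] := G; have [sT _ _] := H.
  move=> /(agreeP sP sQ) PQ /(agreeP sQ sT) QT; apply/(agreeP sP sT) => w Uw Ww.
  have [_ oU hP _ _] := sP; have [_ oW hT _ _] := sT.
  have [r r0 Hr] := oU _ Uw; have [s s0 Hs] := oW _ Ww.
  have [q q0 Hq] := growth_domain (gg _ (csh_subset subf Uw)).
  apply: (@zhol_limit_eq _ _ _ (Num.min q (Num.min r s)) (hP _ Uw) (hT _ Ww)).
    by rewrite !lt_min q0 r0.
  move=> z z0; rewrite !lt_min => /andP[zq /andP[zr zs]].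
  have Ez : w + z - w = z by rewrite addrC addKr.
  have h1 : csh (dom f) (w + z) by apply: Hr; rewrite Ez.
  have h2 : csh (dom h) (w + z) by apply: Hs; rewrite Ez.
  by rewrite PQ ?QT//; exact: Hq.
- exact: sem_stem_semiregular (sem_stem_cst 0).
- exact: sem_stem_semiregular (sem_stem_cst _).
- move=> f g /semiregular_sem_stem[P F] /semiregular_sem_stem[Q G].
  exact: sem_stem_semiregular (sem_stem_add F G).
- by move=> r f /semiregular_sem_stem[P F]; exact: sem_stem_semiregular (sem_stem_scale r F).
- move=> f g /semiregular_sem_stem[P F] /semiregular_sem_stem[Q G].
  exact: sem_stem_semiregular (sem_stem_mul F G).
- by move=> f /semiregular_sem_stem[P F]; exact: sem_stem_semiregular (sem_stem_conj F).
- move=> f f' g g' /semiregular_sem_stem[P F] /semiregular_sem_stem[P' F'].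
  move=> /semiregular_sem_stem[Q G] /semiregular_sem_stem[Q' G'].
  by move=> E1 E2 x [fx gx] [fx' gx'] /=; rewrite E1// E2.
- by move=> r f f' _ _ E x fx fx' /=; rewrite E.
- move=> f f' g g' /semiregular_sem_stem[P F] /semiregular_sem_stem[P' F'].
  move=> /semiregular_sem_stem[Q G] /semiregular_sem_stem[Q' G'].
  have [sP _ _] := F; have [sP' _ _] := F'; have [sQ _ _] := G; have [sQ' _ _] := G'.
  move=> /(agreeP sP sP') EP /(agreeP sQ sQ') EQ.
  have [sM _ _] := sem_stem_mul F G; have [sM' _ _] := sem_stem_mul F' G'.
  have [[cf _ _ _ _] [cf' _ _ _ _]] := (sP, sP').
  have [[cg _ _ _ _] [cg' _ _ _ _]] := (sQ, sQ').
  apply/(agreeP sM sM') => w /(cshI hk _ cf cg)[? ?] /(cshI hk _ cf' cg')[? ?].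
  by rewrite EP ?EQ.
- move=> f f' /semiregular_sem_stem[P F] /semiregular_sem_stem[P' F'].
  have [sP _ _] := F; have [sP' _ _] := F'; move=> /(agreeP sP sP') EP.
  have [sM _ _] := sem_stem_conj F; have [sM' _ _] := sem_stem_conj F'.
  by apply/(agreeP sM sM') => w ? ?; rewrite EP.
Qed.

Lemma semiregular_laws : algebra_laws SEM agree padd pscale pmul zero one.
Proof.
split.
- by move=> f g h _ _ _ x _ _ /=; rewrite addrA.
- by move=> f g _ _ x _ _ /=; rewrite addrC.
- by move=> f _ x _ _ /=; rewrite add0r.
- by move=> f _ x _ _ /=; rewrite scaleN1r subrr.
- by move=> r s f _ x _ _ /=; rewrite scalerA.
- by move=> f _ x _ _ /=; rewrite scale1r.
- by move=> r f g _ _ x _ _ /=; rewrite scalerDr.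
- by move=> r s f _ x _ _ /=; rewrite scalerDl.
- move=> f g h /semiregular_sem_stem[P F] /semiregular_sem_stem[Q G] /semiregular_sem_stem[T H].
  apply: (sem_agree (sem_stem_mul (sem_stem_add F G) H)
    (sem_stem_add (sem_stem_mul F H) (sem_stem_mul G H))) => w; exact: zmulDl.
- move=> f g h /semiregular_sem_stem[P F] /semiregular_sem_stem[Q G] /semiregular_sem_stem[T H].
  apply: (sem_agree (sem_stem_mul F (sem_stem_add G H))
    (sem_stem_add (sem_stem_mul F G) (sem_stem_mul F H))) => w; exact: zmulDr.
- move=> r f g /semiregular_sem_stem[P F] /semiregular_sem_stem[Q G].
  apply: (sem_agree (sem_stem_mul (sem_stem_scale r F) G)
    (sem_stem_scale r (sem_stem_mul F G))) => w; exact: zmulZl.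
- move=> r f g /semiregular_sem_stem[P F] /semiregular_sem_stem[Q G].
  apply: (sem_agree (sem_stem_mul F (sem_stem_scale r G))
    (sem_stem_scale r (sem_stem_mul F G))) => w; exact: zmulZr.
- move=> f /semiregular_sem_stem[P F].
  apply: (sem_agree (sem_stem_mul (sem_stem_cst _) F) F) => w; exact: zmul1l.
- move=> f /semiregular_sem_stem[P F].
  apply: (sem_agree (sem_stem_mul F (sem_stem_cst _)) F) => w; exact: zmul1r.
Qed.

Lemma sem_stem_associator f g h P Q T : sem_stem f P -> sem_stem g Q -> sem_stem h T ->
  sem_stem (associator padd pscale pmul f g h) (fun w => zassoc (P w) (Q w) (T w)).
Proof.
move=> F G H; have := sem_stem_add (sem_stem_mul (sem_stem_mul F G) H)
  (sem_stem_scale (-1) (sem_stem_mul F (sem_stem_mul G H))).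
rewrite (_ : (fun w => _) = fun w => zassoc (P w) (Q w) (T w))//.
by apply/funext => w; rewrite scaleN1r.
Qed.

Lemma semiregular_alternative : alternative_laws SEM agree padd pscale pmul zero.
Proof.
split => f g /semiregular_sem_stem[P F] /semiregular_sem_stem[Q G].
- by apply: (sem_agree (sem_stem_associator F F G) (sem_stem_cst 0)) => w; rewrite zassoc_altl.
- by apply: (sem_agree (sem_stem_associator F G F) (sem_stem_cst 0)) => w; rewrite zassoc_flex.
- by apply: (sem_agree (sem_stem_associator G F F) (sem_stem_cst 0)) => w; rewrite zassoc_altr.
Qed.

Lemma semiregular_star : star_laws SEM agree padd pscale pmul pconj one.
Proof.
split.
- move=> f g /semiregular_sem_stem[P F] /semiregular_sem_stem[Q G].
  apply: (sem_agree (sem_stem_conj (sem_stem_add F G))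
    (sem_stem_add (sem_stem_conj F) (sem_stem_conj G))) => w; exact: zconjD.
- move=> r f /semiregular_sem_stem[P F].
  apply: (sem_agree (sem_stem_conj (sem_stem_scale r F))
    (sem_stem_scale r (sem_stem_conj F))) => w; exact: zconjZ.
- move=> f /semiregular_sem_stem[P F].
  apply: (sem_agree (sem_stem_conj (sem_stem_conj F)) F) => w; exact: zconjK.
- move=> f g /semiregular_sem_stem[P F] /semiregular_sem_stem[Q G].
  apply: (sem_agree (sem_stem_conj (sem_stem_mul F G))
    (sem_stem_mul (sem_stem_conj G) (sem_stem_conj F))) => w; exact: zconjM.
- move=> r; have H := sem_stem_scale r (sem_stem_cst (cd_one R k)).
  apply: (sem_agree (sem_stem_conj H) H) => w.
  by apply: zpairP => s /=; rewrite !cd_linE.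
Qed.

End SemiregularAlgebra.

(** * Inverses and zero divisors *)

Section Inverses.
Variables (R : realType) (k : nat).
Hypothesis hk : (1 <= k <= 3)%N.
Local Notation A := (CD R k).
Local Notation C := R[i].
Variable Om : set A.
Hypotheses (circOm : circular Om) (openOm : open Om).
Implicit Types (w c d : C) (I J x y : A) (P Q T : C -> A * A) (f g : pfun R k) (U V W : set C).

Let k_gt0 : (0 < k)%N. Proof. by case/andP: hk. Qed.
Local Notation SEM := (semiregular Om).
Local Notation zero := (pcst Om 0).
Local Notation one := (pcst Om (cd_one R k)).

Lemma is_stem_exists W P : W !=set0 -> copen W -> (forall w, W w -> W (conjc w)) ->
  (forall w, W w -> zhol P w) -> (forall w, W w -> P (conjc w) = zbar (P w)) ->
  exists2 f, is_stem f P & forall w, csh (dom f) w <-> W w.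
Proof.
move=> [w1 W1] oW cW hol par.
pose F := (fun z : R * R => (P (Complex z.1 z.2)).1, fun z : R * R => (P (Complex z.1 z.2)).2).
pose f := PFun [set x : A | exists J w, [/\ imag_unit J, W w & x = spt J w]] (Defs.induced F).
have FE w : zval F w = P w by case: w => a b; rewrite /zval /=; case: (P _).
have fE w : csh (dom f) w <-> W w.
  split=> [[J Ju [J' [w' [Ju' Ww' E]]]]|Ww]; last first.
    by have [J Ju] := exists_imag_unit R k_gt0; exists J => //; exists J, w.
  by have [->|->] := spt_cases Ju Ju' E => //; exact: cW.
exists f => //; split.
- apply/(circularP hk); split.
    by have [J Ju] := exists_imag_unit R k_gt0; exists (spt J w1), J, w1.
  move=> J J' w Ju Ju' h; exists J', w; split => //; apply/fE; exists J => //.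
- by move=> w /fE /oW[r r0 Hr]; exists r => // w' /Hr /fE.
- by move=> w /fE /hol.
- by move=> w /fE /par.
- by move=> J w Ju /fE Ww; apply: induced_spt => //; exact: par.
Qed.

Lemma csh_dom_subset f : circular (dom f) -> (forall w, csh (dom f) w -> csh Om w) -> dom f `<=` Om.
Proof.
move=> cf H x fx; have [J [w [Ju Ex]]] := spt_surj hk x.
by rewrite Ex; apply/(circular_spt hk w circOm Ju)/H; exists J; rewrite -?Ex.
Qed.

Lemma sem_stem_meromorphic f P w0 s : sem_stem Om f P -> csh Om w0 ->
  meromorphic_at (fun w => zcoord s (P w)) w0.
Proof.
move=> [[_ _ hol _ _] _ gr] /gr[r [m [K [r0 H]]]]; exists r, m, K; split => // h h0 hr.
have [Uh Bh] := H h h0 hr; split; first exact: hol.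
by have := Bh s; rewrite zcoord_scale cabsM cabsX.
Qed.

(** As a coordinate of a product of stems, [znorm] inherits holomorphy and growth from the
    vector-valued case. *)
Lemma znorm_coord (X : A * A) : zcoord [::] (zmul X (zconj X)) = znorm X.
Proof.
have E j : cd_coord [::] (cd_one R j) = 1 by elim: j.
rewrite zmul_conjr /zcoord /= !cd_coordZ E !mulr1.
by [].
Qed.

Lemma sem_stem_norm f P : sem_stem Om f P ->
  sem_stem Om (pnorm f) (fun w => zscalar k (znorm (P w))).
Proof.
move=> F; have := sem_stem_mul hk F (sem_stem_conj hk F).
by rewrite (_ : (fun w => _) = (fun w => zscalar k (znorm (P w))))//; apply/funext => w; rewrite zmul_conjr.
Qed.

Lemma znorm_meromorphic f P w0 : sem_stem Om f P -> csh Om w0 ->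
  meromorphic_at (fun w => znorm (P w)) w0.
Proof.
move=> F Ow; have := sem_stem_meromorphic [::] (sem_stem_mul hk F (sem_stem_conj hk F)) Ow.
by rewrite (_ : (fun w => _) = (fun w => znorm (P w)))//; apply/funext => w; rewrite znorm_coord.
Qed.

Lemma znorm_bar (X : A * A) : znorm (zbar X) = conjc (znorm X).
Proof.
rewrite /znorm /= cd_sumsqN cd_conjN cd_mulNr.
by rewrite -[- cd_mul _ _]scaleN1r cd_coord1Z mulN1r mulrN.
Qed.

Lemma zscale_bar c (X : A * A) : zscale (conjc c) (zbar X) = zbar (zscale c X).
Proof. by case: c => a b; apply: zpairP => s /=; rewrite !cd_coordE; ring. Qed.

(** The dichotomy turns the hypothesis into a lower bound for the norm, so its zeros are isolated
    and its reciprocal has growth. Both products reduce to one by pulling out the scalar, without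
    associativity. *)
Lemma sem_stem_inverse f P : sem_stem Om f P ->
  (forall w, csh Om w -> ~ vanishes_near (fun c => znorm (P c)) w) ->
  has_inverse SEM agree pmul one f.
Proof.
move=> F nv; have [sP sub gr] := F; have [cf of_ hol par val] := sP.
have bb w : csh Om w -> bounded_below_near (fun c => znorm (P c)) w.
  by move=> Ow; have [/(nv _ Ow)//|] := meromorphic_dichotomy (znorm_meromorphic F Ow).
have nhol w : csh (dom f) w -> exists d, sdiff (fun c => znorm (P c)) w d.
  move=> Uw; have [d Hd] := zhol_mul (hol _ Uw) (zhol_conj (hol _ Uw)) [::]; exists d.
  by apply: (sdiff_eq_near (@ltr01 R) _ Hd) => c _; rewrite znorm_coord.
pose W : set C := [set w | csh (dom f) w /\ znorm (P w) != 0].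
pose H w := zscale (znorm (P w))^-1 (zconj (P w)).
have nearW w0 : csh Om w0 -> growth H W w0.
  move=> Ow0; have [r [m [K [r0 Hr]]]] := gr _ Ow0; have [s [c [n [s0 c0 Hs]]]] := bb _ Ow0.
  (* The lower bound [c * |h| ^ n] for the norm gives [|h| ^ n / |N| <= 1 / c], and [h ^ m] takes
     care of the conjugate. *)
  exists (Num.min r s), (m + n)%N, (c^-1 * K); split; first by rewrite lt_min r0.
  move=> h h0; rewrite lt_min => /andP[hr hs].
  have [Uh Bh] := Hr h h0 hr; have lb := Hs h h0 hs.
  have nz : 0 < cabs (znorm (P (w0 + h))).
    by apply: lt_le_trans lb; rewrite mulr_gt0// exprn_gt0// cabs_gt0.
  split; first by split; rewrite // -cabs_gt0.
  have -> : zscale (h ^+ (m + n)) (H (w0 + h)) =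
     zscale (h ^+ n * (znorm (P (w0 + h)))^-1) (zconj (zscale (h ^+ m) (P (w0 + h)))).
    have -> : zconj (zscale (h ^+ m) (P (w0 + h))) = zscale (h ^+ m) (zconj (P (w0 + h))).
      by apply: zpairP => s' /=; rewrite !cd_linE.
    by rewrite /H !zscaleA exprD; congr zscale; ring.
  move=> s'; apply: le_trans (zbounded_scale _ (zbounded_conj Bh) s') _.
  have K0 : 0 <= K by apply: le_trans (Bh [::]); exact: cabs_ge0.
  apply: ler_wpM2r => //; rewrite cabsM cabsV cabsX ler_pdivrMr//.
  by rewrite mulrC ler_pdivlMr// mulrC.
have W0 : W !=set0.
  have [[x Ox] _] := (circularP hk Om).1 circOm; have [J [w [Ju Ex]]] := spt_surj hk x.
  have Ow : csh Om w by exists J; rewrite -?Ex.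
  have [r r0 Hr] := growth_domain (nearW _ Ow); have [h [h0 hr _]] := small_point r0.
  by exists (w + h); exact: Hr.
have oW : copen W.
  move=> w [Uw nz]; have [r r0 Hr] := of_ _ Uw; have [d /sdiff_continuous Hd] := nhol _ Uw.
  have n0 : 0 < cabs (znorm (P w)) by rewrite cabs_gt0.
  have [s s0 Hs] := Hd _ n0.
  exists (Num.min r s); first by rewrite lt_min r0.
  move=> w'; rewrite lt_min => /andP[/Hr U' /Hs lt]; split => //.
  by apply/eqP => E; move: lt; rewrite E sub0r cabsN ltxx.
have [g sH gE] : exists2 g, is_stem g H & forall w, csh (dom g) w <-> W w.
  apply: is_stem_exists => //.
  - by move=> w [Uw nz]; split; [exact: csh_conj|rewrite par// znorm_bar conjc_eq0].
  - move=> w [Uw nz]; have [d Hd] := nhol _ Uw.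
    exact: zhol_scale (sdiffV Hd nz) (zhol_conj (hol _ Uw)).
  - by move=> w [Uw nz]; rewrite /H par// znorm_bar -conjc_inv -zbar_conj zscale_bar.
have [cg _ _ _ _] := sH.
have G : sem_stem Om g H.
  split => //.
    by apply: csh_dom_subset => // w /gE[Uw _]; exact: csh_subset sub Uw.
  by move=> w0 /nearW[r [m [K [r0 Hr]]]]; exists r, m, K; split => // h h0 /(Hr h h0)[/gE].
have oneE : zscalar k 1 = (cd_one R k, 0) by rewrite /zscalar /= scale1r scale0r.
have S1 := sem_stem_cst circOm openOm (cd_one R k).
exists g; split; first exact: (sem_stem_semiregular hk G).
- have FG := sem_stem_mul hk F G; have [sFG _ _] := FG; have [s1 _ _] := S1.
  apply/(agreeP hk sFG s1) => w /(cshI hk _ cf cg)[_ /gE[_ nz]] _.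
  by rewrite /H zmul_scaler zmul_conjr zscale_scalar mulVf// oneE.
- have FG := sem_stem_mul hk G F; have [sFG _ _] := FG; have [s1 _ _] := S1.
  apply/(agreeP hk sFG s1) => w /(cshI hk _ cg cf)[/gE[_ nz] _] _.
  by rewrite /H zmul_scalel zmul_conjl zscale_scalar mulVf// oneE.
Qed.

Lemma agree_zeroP f P : sem_stem Om f P ->
  agree f zero <-> forall w, csh (dom f) w -> P w = 0.
Proof.
move=> [sP sub _]; have [s0 _ _] := sem_stem_cst circOm openOm (0 : A).
split=> [/(agreeP hk sP s0) H w Uw|H]; first by apply: H => //; exact: csh_subset sub Uw.
by apply/(agreeP hk sP s0) => w Uw _; exact: H.
Qed.

Lemma vanishes_near_agree f P : sem_stem Om f P ->
  (forall w s, csh Om w -> vanishes_near (fun c => zcoord s (P c)) w) -> agree f zero.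
Proof.
move=> F van; have [[_ _ hol _ _] sub _] := F; apply/(agree_zeroP F) => w Uw.
have E s : zcoord s (P w) = 0.
  by have [d Hd] := hol _ Uw s; apply: (vanishes_near_eq0 Hd); apply: van; exact: csh_subset sub Uw.
by apply: zpairP => s; have := E s => -[]; rewrite !cd_coord0.
Qed.

(* At real points stem functions take values in A x 0, where N is the squared
   Euclidean norm; so N(f) = 0 near a real point forces f = 0 there. *)
Lemma slice_domain_norm f P w : slice_domain Om -> sem_stem Om f P -> ~ agree f zero ->
  csh Om w -> ~ vanishes_near (fun c => znorm (P c)) w.
Proof.
move=> [D [cD oD conD [a Da] OmE]] F nz Ow van; apply: nz.
have OE c : csh Om c <-> D (plane c) by rewrite OmE; exact: csh_circularization.
have Oa : csh Om (Complex a 0) by apply/OE.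
have [s s0 Hs] : vanishes_near (fun c => znorm (P c)) (Complex a 0).
  apply: (@identity_theorem _ _ D D w _ oD conD) => //; last exact/OE.
  by move=> c /OE; exact: znorm_meromorphic F.
have [[_ _ _ par _] _ gr] := F; have [r r0 Hr] := growth_domain (gr _ Oa).
apply: (vanishes_near_agree F) => c s' /OE Dc.
apply: (@identity_theorem _ _ D D (Complex a 0) _ oD conD) => //.
  by move=> c' /OE; exact: sem_stem_meromorphic F.
(* The vanishing of [P] is only available along the real axis, not in a disc. A single real point
   near [a] nevertheless contradicts the lower bound of the other alternative. *)
have [//|[t [e [n [t0 e0 Ht]]]]] := meromorphic_dichotomy (sem_stem_meromorphic s' F Oa).
have m0 : 0 < Num.min t (Num.min r s) by rewrite !lt_min t0 r0.
have [h [h0 + hR]] := small_point m0; rewrite !lt_min => /andP[ht /andP[hr hs]].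
have /(congr1 snd) /= X1 : zbar (P (Complex a 0 + h)) = P (Complex a 0 + h).
  rewrite -par; last exact: Hr.
  by rewrite rmorphD /= hR oppr0.
have P2 : (P (Complex a 0 + h)).2 = 0.
  by apply: cd_coordP => q; have := congr1 (cd_coord q) X1; rewrite !cd_coordE; lra.
have := Hs _ h0 hs; rewrite /znorm P2 => -[+ _].
rewrite -[X in _ - cd_sumsq X](scale0r (0 : A)) cd_sumsqZ expr0n mul0r subr0.
move=> /eqP; rewrite cd_sumsq_eq0 => /eqP P1.
have := Ht _ h0 ht; rewrite /zcoord P1 P2 cd_coord0 cabs0 leNgt mulr_gt0//.
by rewrite exprn_gt0// cabs_gt0.
Qed.

Lemma product_domain_norm f P w : product_domain Om -> sem_stem Om f P ->
  ~ agree (pnorm f) zero -> csh Om w -> ~ vanishes_near (fun c => znorm (P c)) w.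
Proof.
move=> [D [cD oD _ [C1 [C2 [_ comp conjE]]] OmE]] F nz Ow van; apply: nz.
have OE c : csh Om c <-> D (plane c) by rewrite OmE; exact: csh_circularization.
have [[_ _ _ par _] _ gr] := F.
have sym c : csh Om c -> vanishes_near (fun c => znorm (P c)) c ->
    vanishes_near (fun c => znorm (P c)) (conjc c).
  move=> /gr/growth_domain[r r0 Hr] [s s0 Hs]; exists (Num.min r s); first by rewrite lt_min r0.
  (* The increment is renamed so that it appears as the conjugate of some [h'], to which parity and
     the vanishing near [c] apply. *)
  move=> h h0; have : h = conjc (conjc h) by rewrite conjcK.
  move: (conjc h) => h' E; rewrite E in h0 *.
  have -> : cabs (conjc h') = cabs h' by case: (h') => u v; rewrite /cabs /= sqrrN.
  have h'0 : h' != 0 by rewrite -conjc_eq0.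
  rewrite lt_min => /andP[hr hs].
  by rewrite -rmorphD /= par ?znorm_bar ?Hs ?conjc0//; exact: Hr.
have cover c : D (plane c) -> C1 (plane c) \/ C2 (plane c).
  move=> Dc; have : [set C1; C2] (connected_component D (plane c)) by rewrite -comp; exists (plane c).
  by move=> [] <-; [left|right]; exact: connected_component_refl.
have con B : [set C1; C2] B -> connected B /\ B `<=` D.
  by rewrite -comp => -[z Dz <-]; split; [exact: component_connected|exact: connected_component_sub].
have [con1 sub1] := con C1 (or_introl erefl).
have ident c c' : C1 (plane c) -> vanishes_near (fun c => znorm (P c)) c -> C1 (plane c') ->
    vanishes_near (fun c => znorm (P c)) c'.
  apply: (@identity_theorem _ _ D C1 c c' oD con1 sub1).
  by move=> q /OE; exact: znorm_meromorphic F.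
have C2E c : C2 (plane c) -> C1 (plane (conjc c)).
  rewrite -conjE => -[z C1z]; case: c => u v; rewrite /plane /plane_conj /= => -[<- <-].
  by rewrite opprK; case: z C1z.
(* The given point is moved into the first component, if necessary by conjugation; from there the
   vanishing spreads over that component and back to the other. *)
have [c [C1c vc]] : exists c, C1 (plane c) /\ vanishes_near (fun c => znorm (P c)) c.
  have [Cw|/C2E Cw] := cover _ ((OE w).1 Ow); first by exists w.
  by exists (conjc w); split => //; exact: sym.
have all_van q : csh Om q -> vanishes_near (fun c => znorm (P c)) q.
  move=> /OE/cover[|/C2E C1q]; first exact: ident vc.
  rewrite -(conjcK q); apply: sym; first exact/OE/sub1.
  exact: ident vc C1q.
apply: (vanishes_near_agree (sem_stem_norm F)) => q s /all_van[r r0 Hr]; exists r => // h h0 hr.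
by rewrite Hr// /zcoord /= !scale0r !cd_coord0.
Qed.

Lemma product_domain_singular : product_domain Om ->
  exists f, [/\ SEM f, ~ agree f zero & agree (pnorm f) zero].
Proof.
move=> [D [cD _ real_free _ OmE]]; have oO := copen_csh openOm.
have im0 w : csh Om w -> complex.Im w != 0.
  rewrite OmE => /(csh_circularization hk _ cD); case: w => a b Dw; apply/eqP => /= b0.
  by apply: (real_free a); move: Dw; rewrite b0.
have [I Iu] := exists_imag_unit R k_gt0; have [I0 I1] := (imag_unitP I).1 Iu.
(* The sign of the imaginary part makes parity automatic, and it is constant on the disc of radius
   [|Im w|], so [P] is locally constant off the real axis. *)
pose P w : A * A := (cd_one R k, Num.sg (complex.Im w) *: I).
have [w0 Ow0] : exists w, csh Om w.
  have [[x Ox] _] := (circularP hk Om).1 circOm; have [J [w [Ju Ex]]] := spt_surj hk x.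
  by exists w, J; rewrite -?Ex.
have hol w : csh Om w -> zhol P w.
  move=> /im0 nz; have r0 : 0 < `|complex.Im w| by rewrite normr_gt0.
  apply: (zhol_eq_near r0 _ (zhol_cst (P w) w)) => c /(le_lt_trans (ler_Im_cabs _)).
  case: w c nz r0 => a b [a' b'] /= nz r0 lt; congr pair; congr (_ *: _).
  have [b0|b0|b0] := ltgtP b 0; last by rewrite b0 eqxx in nz.
    by move: lt; rewrite (ltr0_norm b0) ltr_norml => /andP[? ?]; rewrite !ltr0_sg//=; lra.
  by move: lt; rewrite (gtr0_norm b0) ltr_norml => /andP[? ?]; rewrite !gtr0_sg//=; lra.
have par w : csh Om w -> P (conjc w) = zbar (P w).
  by case: w => a b _; rewrite /P /zbar /= sgrN scaleNr.
have [f sP fE] := is_stem_exists (ex_intro _ w0 Ow0) oO (fun w => @csh_conj _ _ Om w) hol par.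
have [cf _ _ _ _] := sP.
have F : sem_stem Om f P.
  split => //; first by apply: csh_dom_subset => // w /fE.
  by move=> w Ow; apply: growth_regular; [case: sP|exact/fE|exact: hol].
exists f; split; first exact: (sem_stem_semiregular hk F).
  move=> /(agree_zeroP F)/(_ w0 ((fE w0).2 Ow0)) /(congr1 (fun X => cd_coord1 X.1)) /=.
  have -> : cd_coord1 (0 : A) = 0 by rewrite -(scale0r (0 : A)) cd_coord1Z mul0r.
  by rewrite cd_coord1_one => /eqP; rewrite oner_eq0.
apply/(agree_zeroP (sem_stem_norm F)) => w /(cshI hk _ cf cf)[/fE/im0 nz _].
rewrite /znorm /= cd_sumsq_one cd_sumsqZ I1 sqr_sg nz mulr1 subrr.
rewrite cd_mul1l cd_conjZ cd_coord1Z cd_coord1_conj I0 !mulr0.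
by rewrite /zscalar /= !scale0r.
Qed.

End Inverses.

Theorem theorem6p6 (R : realType) (k : nat) (hk : (1 <= k <= 3)%N)
    (Om : set (CD R k)) (circOm : circular Om) (openOm : open Om) :
  let SEM := semiregular Om in
  let zero := pcst Om 0 in
  let one := pcst Om (cd_one R k) in
  [/\ alternative_star_algebra SEM agree padd pscale pmul pconj zero one,
      slice_domain Om -> division_algebra SEM agree pmul zero one
    & product_domain Om ->
        (exists f, [/\ SEM f, ~ agree f zero & agree (pnorm f) zero]) /\
        (forall f, SEM f -> ~ agree (pnorm f) zero ->
           has_inverse SEM agree pmul one f)].
Proof.
split.
- split.
  + exact: semiregular_quotient.
  + exact: semiregular_laws.
  + exact: semiregular_alternative.
  + exact: semiregular_star.
- move=> sd f /(semiregular_sem_stem hk circOm)[P F] nz.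
  by apply: (sem_stem_inverse hk circOm openOm F) => w; exact: slice_domain_norm sd F nz.
- move=> pd; split; first exact: product_domain_singular.
  move=> f /(semiregular_sem_stem hk circOm)[P F] nz.
  by apply: (sem_stem_inverse hk circOm openOm F) => w; exact: product_domain_norm pd F nz.
Qed.
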